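(* Let $N\ge 1$, $p>1$, let $\Omega\subset\mathbb{R}^N$ be a bounded smooth domain and let $w\in\mathcal{A}_t$. Let $\beta\ge 0$ on $\Omega$ with $|\{x\in\Omega:\beta(x)>0\}|>0$, and suppose that either $\beta\in L^\infty(\Omega)$, or $1\le p_s<N$ and $\beta\in L^{\frac{q}{q-p}}(\Omega)$ for some $q\in(p,p_s^* )$, where $p_s^*=\frac{Np_s}{N-p_s}$. Then the first eigenvalue $\lambda_1$ of the problem $$-\operatorname{div}(w|\nabla u|^{p-2}\nabla u)=\lambda\beta(x)|u|^{p-2}u\ \text{ in }\Omega,\qquad u=0\ \text{ on }\partial\Omega,$$ is simple, i.e. any two eigenfunctions corresponding to $\lambda_1$ are constant multiples of each other a.e. in $\Omega$.
   Context: A weight on $\Omega$ is a measurable real-valued function that is positive a.e. The class $\mathcal{A}_p$ consists of the weights $a$ on $\Omega$ with $a\in L^1_{loc}(\Omega)$ and $a^{-1/(p-1)}\in L^1_{loc}(\Omega)$. The class $\mathcal{A}_t$ consists of those $a\in\mathcal{A}_p$ for which $a^{-s}\in L^1(\Omega)$ for some $s\in(\frac{N}{p},\infty)\cap[\frac{1}{p-1},\infty)$; for this $s$ put $p_s=\frac{ps}{s+1}$. For $w\in\mathcal{A}_p$, $W^{1,p}(\Omega,w)$ is the space of real-valued functions $u$ on $\Omega$ with $\|u\|_{1,p,w}=\left(\int_\Omega|u|^p\,dx+\int_\Omega w|\nabla u|^p\,dx\right)^{1/p}<\infty$ ($\nabla u$ the weak gradient), and $X=W_0^{1,p}(\Omega,w)$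 is the closure of $C_c^\infty(\Omega)$ in this norm. A real number $\lambda$ is an eigenvalue, with eigenfunction $u$, if $u\in X$, $u\not\equiv 0$, and $\int_\Omega w|\nabla u|^{p-2}\nabla u\cdot\nabla\varphi\,dx=\lambda\int_\Omega\beta|u|^{p-2}u\,\varphi\,dx$ for all $\varphi\in X$. The first (principal) eigenvalue is $$\lambda_1=\inf\left\{\int_\Omega w(x)|\nabla v|^p\,dx:\ v\in X,\ \int_\Omega\beta(x)|v|^p\,dx=1\right\}.$$ *)

(* Defs.v *)
From HB Require Import structures.
From mathcomp Require Import all_boot all_order all_algebra.
From mathcomp Require Import all_classical all_reals all_analysis.

Set Implicit Arguments.
Unset Strict Implicit.
Unset Printing Implicit Defensive.

Import Order.TTheory GRing.Theory Num.Theory.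
Import numFieldNormedType.Exports.

Local Open Scope classical_set_scope.
Local Open Scope ring_scope.

(* The product sigma-algebra on R^n, generated by the coordinate maps, as the
   library does for n.-tuple; it is put on 'rV[R]_n because the topology and
   the derivatives live there. *)
Definition measure_rV_display : measure_display -> measure_display.
Proof. exact. Qed.

Section measurable_rV.
Context {R : realType} {n : nat}.

Let coors : 'I_n -> 'rV[R]_n -> measurableTypeR R := fun i x => x ord0 i.

Let rV_set0 : g_sigma_preimage coors set0.
Proof. exact: sigma_algebra0. Qed.

Let rV_setC A : g_sigma_preimage coors A -> g_sigma_preimage coors (~` A).
Proof. exact: sigma_algebraC. Qed.

Let rV_bigcup (F : _^nat) : (forall i, g_sigma_preimage coors (F i)) ->
  g_sigma_preimage coors (\bigcup_i (F i)).
Proof. exact: sigma_algebra_bigcup. Qed.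

HB.instance Definition _ :=
  @isMeasurable.Build (measure_rV_display R.-ocitv.-measurable.-sigma)
    'rV[R]_n (g_sigma_preimage coors) rV_set0 rV_setC rV_bigcup.

End measurable_rV.

Lemma measurable_coord_rV (R : realType) n (i : 'I_n) :
  measurable_fun [set: 'rV[R]_n]
    ((fun x => x ord0 i) : 'rV[R]_n -> measurableTypeR R).
Proof.
move=> _ Y mY; rewrite setTI; apply: sub_sigma_algebra => /=.
rewrite -bigcup_seq/=; exists i => /=; first by rewrite mem_index_enum.
by exists Y => //; rewrite setTI.
Qed.

Lemma measurable_fun_rV d (T : measurableType d) (R : realType) n
    (f : T -> 'rV[R]_n) :
  (forall i, measurable_fun [set: T]
     ((fun z => f z ord0 i) : T -> measurableTypeR R)) ->
  measurable_fun [set: T] f.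
Proof.
move=> mf _ Y mY; move: Y mY.
suff : measurable `<=` [set Y : set 'rV[R]_n | measurable (f @^-1` Y)].
  by move=> H Y /H; rewrite setTI.
apply: smallest_sub; first split => //=.
- by rewrite preimage_set0.
- by move=> A mA; rewrite setTD preimage_setC; exact: measurableC.
- by move=> F mF; rewrite preimage_bigcup; exact: bigcup_measurable.
- rewrite -bigcup_seq; apply: bigcup_sub => i _ _ [B mB <-] /=.
  by rewrite setTI -[X in measurable X]setTI; exact: mf.
Qed.

Section lebesgue_rV.
Context {R : realType}.

(* R * R^n identified with R^(n+1), first coordinate in front *)
Definition cons_rV n (z : measurableTypeR R * 'rV[R]_n) : 'rV[R]_n.+1 :=
  \row_i (if unlift ord0 i is Some j then z.2 ord0 j else z.1).

Definition uncons_rV n (x : 'rV[R]_n.+1) : measurableTypeR R * 'rV[R]_n :=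
  (x ord0 ord0, \row_j x ord0 (lift ord0 j)).

Lemma cons_rVK n : cancel (@cons_rV n) (@uncons_rV n).
Proof.
move=> [a y]; rewrite /uncons_rV !mxE unlift_none /=; congr pair.
by apply/rowP => j; rewrite !mxE liftK.
Qed.

Lemma measurable_cons_rV n : measurable_fun [set: _] (@cons_rV n).
Proof.
apply: measurable_fun_rV => i; rewrite /cons_rV.
case: (unliftP ord0 i) => [j ->|->].
- under eq_fun do rewrite mxE liftK.
  exact: (measurableT_comp (measurable_coord_rV j) measurable_snd).
- under eq_fun do rewrite mxE unlift_none.
  exact: measurable_fst.
Qed.

Lemma measurable_uncons_rV n : measurable_fun [set: _] (@uncons_rV n).
Proof.
apply/measurable_fun_pairP; split; first exact: measurable_coord_rV.
apply: measurable_fun_rV => i; rewrite /uncons_rV /=.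
under eq_fun do rewrite mxE.
exact: measurable_coord_rV.
Qed.

Section step.
Variables (n : nat) (m : {sigma_finite_measure set 'rV[R]_n -> \bar R}).

Definition lebesgue_rV_step : set 'rV[R]_n.+1 -> \bar R :=
  pushforward (@lebesgue_measure R \x m)%E (@cons_rV n).


Let step0 : lebesgue_rV_step set0 = 0%E.
Proof. by rewrite /lebesgue_rV_step /pushforward preimage_set0 measure0. Qed.

Let step_ge0 A : (0 <= lebesgue_rV_step A)%E.
Proof. by apply: measure_ge0; exact: measurable_cons_rV. Qed.

Let step_additive : semi_sigma_additive lebesgue_rV_step.
Proof. by apply: measure_semi_sigma_additive; exact: measurable_cons_rV. Qed.

HB.instance Definition _ := isMeasure.Build _ _ _ lebesgue_rV_step
  step0 step_ge0 step_additive.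

Let step_sigma_finite : sigma_finite setT lebesgue_rV_step.
Proof.
have /sigma_finiteP[F [TF ndF Foo]] := sigma_finiteT (@lebesgue_measure R).
have /sigma_finiteP[G [TG ndG Goo]] := sigma_finiteT m.
exists (fun k => @uncons_rV n @^-1` (F k `*` G k)).
  rewrite -preimage_bigcup; apply/esym; rewrite -(preimage_setT (@uncons_rV n)).
  congr (_ @^-1` _); apply/seteqP; split => // -[x y] _.
  have [i _ Fx] : (\bigcup_i F i) x by rewrite -TF.
  have [j _ Gy] : (\bigcup_i G i) y by rewrite -TG.
  exists (maxn i j) => //; split => /=.
  - by move: x Fx; exact/subsetPset/ndF/leq_maxl.
  - by move: y Gy; exact/subsetPset/ndG/leq_maxr.
move=> k; have [mF Fk] := Foo k; have [mG Gk] := Goo k.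
have mFG : measurable (F k `*` G k) by exact: measurableX.
split; first by rewrite -[X in measurable X]setTI; exact: measurable_uncons_rV.
rewrite /lebesgue_rV_step /pushforward -comp_preimage.
rewrite (_ : _ \o _ = id); last by apply/funext => z /=; rewrite cons_rVK.
by rewrite preimage_id product_measure1E// lte_mul_pinfty// ge0_fin_numE.
Qed.

HB.instance Definition _ := Measure_isSigmaFinite.Build _ _ _ lebesgue_rV_step
  step_sigma_finite.

End step.

Fixpoint borel_lebesgue_rV n : {sigma_finite_measure set 'rV[R]_n -> \bar R} :=
  if n is n'.+1 then lebesgue_rV_step (borel_lebesgue_rV n')
  else dirac (0 : 'rV[R]_0).

End lebesgue_rV.

(* Euclidean space with its Lebesgue-measurable sets: the Caratheodory
   sigma-algebra of the outer measure induced by borel_lebesgue_rV n. As a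
   bare type this is 'rV[R]_n. *)
Notation lebesgue_space R n :=
  (caratheodory_type (mu_ext (@borel_lebesgue_rV R n))).

Definition leb (R : realType) (n : nat) : set (lebesgue_space R n) -> \bar R :=
  @completed_measure_extension _ _ _ (@borel_lebesgue_rV R n).

HB.instance Definition _ (R : realType) n := Measure.on (@leb R n).

Fact leb_sigma_finite (R : realType) n : sigma_finite setT (@leb R n).
Proof. exact/completed_measure_extension_sigma_finite/sigma_finiteT. Qed.

HB.instance Definition _ (R : realType) n :=
  @Measure_isSigmaFinite.Build _ _ _ (@leb R n) (@leb_sigma_finite R n).

Arguments leb : clear implicits.

(* Functions are defined on the whole space; every notion attached to Om only
   depends on their values on Om (up to null sets where applicable). *)
Definition lmeasurable (R : realType) n (Om : set 'rV[R]_n)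
    (f : 'rV[R]_n -> R) : Prop :=
  measurable_fun (Om : set (lebesgue_space R n)) f.

Definition ae_in (R : realType) n (Om : set 'rV[R]_n)
    (P : 'rV[R]_n -> Prop) : Prop :=
  {ae leb R n, forall x, Om x -> P x}.

Definition in_Lp (R : realType) n (Om : set 'rV[R]_n) (p : \bar R)
    (f : 'rV[R]_n -> R) : Prop :=
  lmeasurable Om f /\
  finite_norm (leb R n) p ((f \_ Om) : lebesgue_space R n -> R).

Definition in_L1loc (R : realType) n (Om : set 'rV[R]_n)
    (f : 'rV[R]_n -> R) : Prop :=
  lmeasurable Om f /\
  forall K : set 'rV[R]_n, compact K -> K `<=` Om ->
    (\int[leb R n]_(x in K) `|f x|%:E < +oo)%E.

Section euclidean.
Context {R : realType} {n : nat}.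
Implicit Types (u v x : 'rV[R]_n) (f : 'rV[R]_n -> R) (i : 'I_n).

(* the library norm on 'rV[R]_n is the sup norm *)
Definition dotp u v : R := \sum_i u ord0 i * v ord0 i.

Definition enorm u : R := Num.sqrt (dotp u u).

Definition partial i f : 'rV[R]_n -> R := 'D_(delta_mx ord0 i) f.

Fixpoint cont_diff (k : nat) f : Prop :=
  continuous f /\
  if k is k'.+1 then
    forall i, (forall x, derivable f x (delta_mx ord0 i)) /\
              cont_diff k' (partial i f)
  else True.

Definition smooth f : Prop := forall k, cont_diff k f.

(* C_c^oo(Om), each function being extended by 0 outside Om *)
Definition test_function (Om : set 'rV[R]_n) f : Prop :=
  [/\ smooth f, compact (closure [set x | f x != 0]) &
      closure [set x | f x != 0] `<=` Om].

End euclidean.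

(* C^oo boundary: near each boundary point, and up to the choice of a
   coordinate axis and of an orientation, Om is the region above the graph of
   a smooth function of the n - 1 other coordinates. *)
Definition smooth_boundary (R : realType) n (Om : set 'rV[R]_n) : Prop :=
  forall x0, (closure Om `\` interior Om) x0 ->
    exists (i : 'I_n) (s : bool) (gam : 'rV[R]_n.-1 -> R),
      smooth gam /\
      \forall x \near x0,
        Om x <-> 0 < (-1) ^+ s * (x ord0 i - gam (col' i x)).

Definition bounded_smooth_domain (R : realType) n (Om : set 'rV[R]_n) : Prop :=
  [/\ Om !=set0, open Om, connected Om, bounded_set Om & smooth_boundary Om].

Definition weight (R : realType) n (Om : set 'rV[R]_n)
    (a : 'rV[R]_n -> R) : Prop :=
  lmeasurable Om a /\ ae_in Om (fun x => 0 < a x).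

Definition class_Ap (R : realType) n (Om : set 'rV[R]_n) (p : R)
    (a : 'rV[R]_n -> R) : Prop :=
  [/\ weight Om a, in_L1loc Om a &
      in_L1loc Om (fun x => a x `^ (- (p - 1)^-1))].

Definition At_exponent (R : realType) n (Om : set 'rV[R]_n) (p : R)
    (a : 'rV[R]_n -> R) (s : R) : Prop :=
  [/\ n%:R / p < s, (p - 1)^-1 <= s & in_Lp Om 1%:E (fun x => a x `^ (- s))].

Definition class_At (R : realType) n (Om : set 'rV[R]_n) (p : R)
    (a : 'rV[R]_n -> R) : Prop :=
  class_Ap Om p a /\ exists s, At_exponent Om p a s.

Section sobolev.
Context {R : realType} {n : nat}.
Variables (Om : set 'rV[R]_n) (p : R) (w : 'rV[R]_n -> R).
Implicit Types (u v phi : 'rV[R]_n -> R).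

Definition is_weak_gradient u (g : 'rV[R]_n -> 'rV[R]_n) : Prop :=
  [/\ in_L1loc Om u, (forall i, in_L1loc Om (fun x => g x ord0 i)) &
      forall phi, test_function Om phi -> forall i,
        (\int[leb R n]_(x in Om) (u x * partial i phi x)%:E =
         - \int[leb R n]_(x in Om) (g x ord0 i * phi x)%:E)%E].

(* a representative of the weak gradient, which is unique a.e. in Om; it is
   arbitrary when u has no weak gradient *)
Definition wgrad u : 'rV[R]_n -> 'rV[R]_n :=
  xget (fun=> 0) [set g | is_weak_gradient u g].

Definition energy u : \bar R :=
  (\int[leb R n]_(x in Om) (w x * enorm (wgrad u x) `^ p)%:E)%E.

Definition sobolev_norm u : \bar R :=
  ((\int[leb R n]_(x in Om) (`|u x| `^ p)%:E + energy u) `^ p^-1)%E.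

Definition W1p : set ('rV[R]_n -> R) :=
  [set u | (exists g, is_weak_gradient u g) /\ (sobolev_norm u < +oo)%E].

Definition W1p0 : set ('rV[R]_n -> R) :=
  [set u | W1p u /\ forall e : R, 0 < e ->
     exists phi, test_function Om phi /\
       (sobolev_norm (u \- phi)%R < e%:E)%E].

Variable beta : 'rV[R]_n -> R.

(* 0 `^ r = 0 for r != 0, hence |z|^(p-2) z = 0 at z = 0, also for p < 2 *)
Definition is_eigenfunction (lambda : R) u : Prop :=
  [/\ W1p0 u, ~ ae_in Om (fun x => u x = 0) &
      forall phi, W1p0 phi ->
        (\int[leb R n]_(x in Om)
            (w x * enorm (wgrad u x) `^ (p - 2)
               * dotp (wgrad u x) (wgrad phi x))%:E =
         lambda%:E * \int[leb R n]_(x in Om)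
            (beta x * `|u x| `^ (p - 2) * u x * phi x)%:E)%E].

Definition first_eigenvalue : R :=
  inf [set r | exists v, [/\ W1p0 v,
    (\int[leb R n]_(x in Om) (beta x * `|v x| `^ p)%:E = 1%:E)%E &
    energy v = r%:E]].

End sobolev.

Definition p_sub (R : realType) (p s : R) : R := p * s / (s + 1).

Definition critical_exponent (R : realType) (n : nat) (r : R) : R :=
  n%:R * r / (n%:R - r).

(* Main.v *)
Require Import Defs.
From HB Require Import structures.
From mathcomp Require Import all_boot all_order all_algebra.
From mathcomp Require Import all_classical all_reals all_analysis.
From mathcomp Require Import measurable_realfun ess_sup_inf lra ring.

(** Write E(u) for the energy, the integral of w |grad u|^p, and B(u) for lambda1
    times the integral of beta |u|^p. By homogeneity B <= E on test functions
    (first_eigenvalue_le), and an eigenfunction for lambda1, tested against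
    itself, satisfies E(u) = B(u) (eigenfunction_minimizer). Everything else is
    deduced from these two facts.

    The quotient E / B has a hidden convexity. The function
    F = (|u|^p + |v|^p)^(1/p) satisfies B(F) = B(u) + B(v), whereas
    |grad F|^p <= |grad u|^p + |grad v|^p, because grad F / F is the mean of
    grad u / u and grad v / v with weights |u|^p / F^p and |v|^p / F^p. As
    B(F) <= E(F), the integral of the loss in this inequality, the deficit, is at
    most E(u) + E(v) - B(u) - B(v) (hidden_convexity). A smooth regularization of
    F sends two test functions to a test function, so that the inequality
    B <= E is only applied to test functions, and Fatou's lemma gives the
    general case. If u and v are eigenfunctions, then the deficit vanishes, and
    strict convexity yields grad u / u = grad v / v where u and v do not vanish
    (minimizers_log_grad).

    What has to be excluded is that u vanishes on a set of positive measure, or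
    that v / u takes different values on two regions separated by zeros of u.
    Both follow from the fact that log u has locally finite energy
    (log_caccioppoli): the deficit of u and a small multiple t zeta of a test
    function is O(t^p) by minimality, and at least of the order of
    t^p |zeta|^p |grad u / u|^p where t zeta is small compared to u. Therefore, if
    u grad v = v grad u, the bounded functions
    u (al u + be v) / (u^2 + v^2) have a vanishing weak gradient on all of Om,
    including the zeros of u (proportional_ratio), and are constant because Om is
    connected (weakly_constant). For v = u this says that the indicator function
    of the set where u does not vanish is constant, hence u is nonzero almost
    everywhere. For two eigenfunctions, u^2 / (u^2 + v^2) and u v / (u^2 + v^2)
    are constant, and v / u is the quotient of the second by the first.

    The integrability of w^(-1/(p-1)) on compact sets enters through the
    inequality z <= w z^p + w^(-1/(p-1)) (weight_young), which turns bounds on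
    the energy into domination of the gradients. *)

Set Implicit Arguments.
Unset Strict Implicit.
Unset Printing Implicit Defensive.

Import Order.TTheory GRing.Theory Num.Theory.
Import numFieldNormedType.Exports.

Local Open Scope classical_set_scope.
Local Open Scope ring_scope.

(** * Boxes and Borel sets in R^n *)

Section boxes.
Context {R : realType} {n : nat}.
Implicit Types (a b x y : 'rV[R]_n) (U : set 'rV[R]_n).

Definition open_box a b : set 'rV[R]_n :=
  [set x | forall i, a ord0 i < x ord0 i < b ord0 i].

Definition closed_box a b : set 'rV[R]_n :=
  [set x | forall i, a ord0 i <= x ord0 i <= b ord0 i].

Lemma ball_rVP x y e : 0 < e ->
  ball x e y <-> forall i, `|x ord0 i - y ord0 i| < e.
Proof.
move=> e0; split => [[_ H] i|H]; first exact: H.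
by split => // i j; rewrite ord1; exact: H.
Qed.

Lemma le_coord_norm x i : `|x ord0 i| <= `|x|.
Proof.
rewrite leNgt; apply/negP => H.
have x0 : 0 < `|x ord0 i| by apply: le_lt_trans H.
have : ball (0 : 'rV[R]_n) `|x ord0 i| x.
  by rewrite mx_norm_ball /ball_ /= sub0r normrN.
by move=> /(ball_rVP _ _ x0)/(_ i); rewrite mxE sub0r normrN ltxx.
Qed.

Lemma measurable_coord_preimage i (B : set (measurableTypeR R)) : measurable B ->
  measurable [set x : 'rV[R]_n | B (x ord0 i)].
Proof.
move=> mB; rewrite -[X in measurable X]setTI.
exact: (@measurable_coord_rV R n i measurableT B mB).
Qed.

Lemma measurable_all_coord (B : 'I_n -> set (measurableTypeR R)) : (forall i, measurable (B i)) ->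
  measurable [set x : 'rV[R]_n | forall i, B i (x ord0 i)].
Proof.
move=> mB; rewrite (_ : mkset _ =
    \bigcap_(i in [set: 'I_n]) [set x : 'rV[R]_n | B i (x ord0 i)]).
  apply: fin_bigcap_measurable; first exact: finite_finset.
  by move=> i _; exact: measurable_coord_preimage.
by apply/seteqP; split => x /= H i; [move=> _|]; exact: (H i).
Qed.

Lemma measurable_open_box a b : measurable (open_box a b).
Proof.
have := @measurable_all_coord (fun i => `]a ord0 i, b ord0 i[%classic).
rewrite (_ : mkset _ = open_box a b).
  by apply => i; exact: measurable_itv.
by apply/seteqP; split => x /= H i; have := H i; rewrite /= in_itv.
Qed.

Lemma measurable_closed_box a b : measurable (closed_box a b).
Proof.
have := @measurable_all_coord (fun i => `[a ord0 i, b ord0 i]%classic).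
rewrite (_ : mkset _ = closed_box a b).
  by apply => i; exact: measurable_itv.
by apply/seteqP; split => x /= H i; have := H i; rewrite /= in_itv.
Qed.

Lemma open_box_open a b : open (open_box a b).
Proof.
have H (x : 'rV[R]_n) : open_box a b x -> nbhs x (open_box a b).
  move=> abx.
  apply: (@filter_forall _ 'I_n (fun i (y : 'rV[R]_n) =>
    a ord0 i < y ord0 i < b ord0 i) (nbhs x) (nbhs_filter x)) => i.
  have xi : x ord0 i \in `]a ord0 i, b ord0 i[ by rewrite in_itv; exact: abx.
  have /(@coord_continuous R 1 n ord0 i x) := near_in_itvoo xi.
  by apply: (@filterS _ _ (nbhs_filter x)) => y; rewrite /= in_itv.
by rewrite openE => x; exact: H.
Qed.

Lemma closed_box_closed a b : closed (closed_box a b).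
Proof.
rewrite (_ : closed_box a b = \bigcap_(i in [set: 'I_n])
   ((fun x : 'rV[R]_n => x ord0 i) @^-1` `[a ord0 i, b ord0 i]%classic)).
  apply: closed_bigI => i _.
  apply: preimage_closed; last exact: itv_closed.
  by move=> x _; exact: coord_continuous.
by apply/seteqP; split => x /= H i //; have := H i; rewrite /= in_itv //=; apply.
Qed.

Lemma closed_box_compact a b : compact (closed_box a b).
Proof.
have := @rV_compact _ n (fun i => `[a ord0 i, b ord0 i]%classic).
rewrite (_ : [set v | _] = closed_box a b).
  by apply => i; exact: segment_compact.
by apply/seteqP; split => x /= H i; have := H i; rewrite /= in_itv.
Qed.

Lemma nbhs_closed_box x U : nbhs x U ->
  exists a b, open_box a b x /\ closed_box a b `<=` U.
Proof.
move=> /nbhs_ballP[e /= e0 eU].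
exists (\row_i (x ord0 i - e / 2)), (\row_i (x ord0 i + e / 2)); split.
  by move=> i; rewrite !mxE; apply/andP; split; lra.
move=> y H; apply: eU; apply/ball_rVP => // i; have := H i; rewrite !mxE.
by rewrite ltr_norml => /andP[? ?]; apply/andP; split; lra.
Qed.

Definition rat_box (q : 'rV[rat]_n * 'rV[rat]_n) : set 'rV[R]_n :=
  open_box (map_mx ratr q.1) (map_mx ratr q.2).

Lemma nbhs_rat_box x U : nbhs x U -> exists q, rat_box q x /\ rat_box q `<=` U.
Proof.
move=> /nbhs_closed_box[a [b [abx abU]]].
have /choice[r hr] i : exists r : rat, a ord0 i < ratr r < x ord0 i.
  have /andP[/rat_in_itvoo[r] h _] := abx i.
  by exists r; move: h; rewrite in_itv.
have /choice[s hs] i : exists s : rat, x ord0 i < ratr s < b ord0 i.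
  have /andP[_ /rat_in_itvoo[s] h] := abx i.
  by exists s; move: h; rewrite in_itv.
exists (\row_i r i, \row_i s i); split.
  by move=> i; rewrite !mxE; move: (hr i) (hs i) => /andP[_ ->] /andP[->].
move=> y H; apply: abU => i; have := H i; rewrite !mxE.
move: (hr i) (hs i) => /andP[h1 _] /andP[_ h2] /andP[h3 h4].
by rewrite (ltW (lt_trans h1 h3)) (ltW (lt_trans h4 h2)).
Qed.

(** Open sets are countable unions of boxes, so the coordinate sigma-algebra
    contains the Borel sets of the norm topology. *)
Lemma open_measurable_rV U : open U -> measurable U.
Proof.
move=> oU; rewrite (_ : U = \bigcup_q (if `[< rat_box q `<=` U >] then
    rat_box q else set0)).
  apply: countable_bigcupT_measurable => [|q]; first exact: countableP.
  by case: ifP => _ //; exact: measurable_open_box.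
apply/seteqP; split => [x Ux|x [q _]].
  have [q [qx qU]] := nbhs_rat_box (open_nbhs_nbhs (conj oU Ux)).
  by exists q => //; case: asboolP.
by case: asboolP => // h /h.
Qed.

Lemma closed_measurable_rV U : closed U -> measurable U.
Proof. by move/closed_openC/open_measurable_rV/measurableC; rewrite setCK. Qed.

Lemma compact_measurable_rV U : compact U -> measurable U.
Proof.
move=> cU; apply: closed_measurable_rV.
by apply: compact_closed => //; exact: (@norm_hausdorff R 'rV[R]_n).
Qed.

Lemma continuous_measurable_rV (f : 'rV[R]_n -> R) :
  continuous f -> measurable_fun setT f.
Proof.
move=> cf mT; apply: (measurability _ (RGenOInfty.measurableE R)) => //.
move=> _ [_ [a ->] <-]; rewrite setTI; apply: open_measurable_rV.
by apply: open_comp => [x _|]; [exact: cf|exact: rray_open].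
Qed.

End boxes.

(** * Lebesgue measure of boxes; integrals of Borel functions *)

Section lebesgue_borel.
Context {R : realType} {n : nat}.
Local Open Scope ereal_scope.

Lemma borel_lebesgue_measurable (A : set 'rV[R]_n) :
  measurable A -> measurable (A : set (lebesgue_space R n)).
Proof. exact: caratheodory_measurable_mu_ext. Qed.

Lemma leb_borelE (A : set 'rV[R]_n) :
  measurable A -> leb R n A = borel_lebesgue_rV n A.
Proof. exact: measurable_mu_extE. Qed.

Lemma measurable_funT_borel_lebesgue d (Y : measurableType d)
    (f : 'rV[R]_n -> Y) :
  measurable_fun setT f ->
  measurable_fun (setT : set (lebesgue_space R n)) f.
Proof.
move=> mf _ B mB; apply: borel_lebesgue_measurable.
exact: (mf measurableT B mB).
Qed.

(** The identity map from Lebesgue to Borel measurable sets is measurable and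
    pushes one measure forward to the other. *)
Lemma integral_leb_borel (f : 'rV[R]_n -> \bar R) :
  measurable_fun [set: 'rV[R]_n] f ->
  (leb R n).-integrable setT (f : lebesgue_space R n -> \bar R) ->
  \int[leb R n]_x f x = \int[@borel_lebesgue_rV R n]_x f x.
Proof.
move=> mf fi.
have mid : measurable_fun (setT : set (lebesgue_space R n))
    (id : lebesgue_space R n -> 'rV[R]_n).
  exact: measurable_funT_borel_lebesgue.
have := @integral_pushforward _ _ _ _ _ _ mid (leb R n) setT f mf fi measurableT.
rewrite /= => <-; apply: eq_measure_integral => A mA _ /=.
by rewrite /pushforward preimage_id leb_borelE.
Qed.

End lebesgue_borel.

Section box_measure.
Context {R : realType}.
Local Open Scope ereal_scope.

Lemma borel_lebesgue_open_box n (a b : 'rV[R]_n) :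
  (forall i, a ord0 i < b ord0 i)%R ->
  borel_lebesgue_rV n (open_box a b) = (\prod_i (b ord0 i - a ord0 i))%:E.
Proof.
elim: n a b => [|n IH] a b ab.
  rewrite big_ord0 /= diracE mem_set //=; last by case.
rewrite /= /lebesgue_rV_step /pushforward.
pose a' := (uncons_rV a).2; pose b' := (uncons_rV b).2.
rewrite (_ : _ @^-1` _ =
    `]a ord0 ord0, b ord0 ord0[%classic `*` open_box a' b'); last first.
  apply/seteqP; split => -[t y] /=.
    move=> H; split; first by have := H ord0; rewrite mxE unlift_none in_itv.
    by move=> i; have := H (lift ord0 i); rewrite !mxE liftK.
  rewrite in_itv => -[/= H0 H] i; rewrite mxE.
  case: (unliftP ord0 i) => [j ->|->]; last by [].
  by have := H j; rewrite !mxE.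
rewrite product_measure1E; [|exact: measurable_itv|exact: measurable_open_box].
rewrite big_ord_recl EFinM; congr (_ * _).
  have := @lebesgue_measure_itv R `]a ord0 ord0, b ord0 ord0[.
  by rewrite /= lte_fin ab.
rewrite /= IH; last by move=> i; rewrite !mxE.
by congr (_%:E); apply: eq_bigr => i _; rewrite !mxE.
Qed.

Lemma leb_open_box_gt0 n (a b x : 'rV[R]_n) : open_box a b x ->
  0 < leb R n (open_box a b).
Proof.
move=> abx; rewrite leb_borelE; last exact: measurable_open_box.
have ab i : (a ord0 i < b ord0 i)%R.
  by have /andP[] := abx i; exact: lt_trans.
by rewrite borel_lebesgue_open_box// lte_fin prodr_gt0// => i _; rewrite subr_gt0.
Qed.

Lemma leb_open_box_lty n (a b : 'rV[R]_n) : leb R n (open_box a b) < +oo.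
Proof.
rewrite leb_borelE; last exact: measurable_open_box.
have [[x abx]|h] := pselect (open_box a b !=set0).
  rewrite borel_lebesgue_open_box ?ltry// => i.
  by have /andP[] := abx i; exact: lt_trans.
rewrite (_ : open_box a b = set0) ?measure0 ?ltry//.
by rewrite -subset0 => x abx; apply: h; exists x.
Qed.

Lemma bounded_sub_box n (A : set 'rV[R]_n) : bounded_set A ->
  exists a b : 'rV[R]_n, A `<=` open_box a b.
Proof.
move=> [M [_ HM]].
exists (const_mx (- (M + 2))%R), (const_mx (M + 2)%R) => x Ax i.
rewrite !mxE -ltr_norml (le_lt_trans (le_coord_norm x i))//.
rewrite (le_lt_trans (HM (M + 1)%R _ _ Ax))//; lra.
Qed.

Lemma leb_bounded_lty n (A : set 'rV[R]_n) :
  measurable (A : set (lebesgue_space R n)) ->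
  bounded_set A -> leb R n A < +oo.
Proof.
move=> mA /bounded_sub_box[a [b Aab]].
apply: le_lt_trans (leb_open_box_lty a b).
have mB := borel_lebesgue_measurable (measurable_open_box a b).
by apply: le_measure; rewrite ?inE.
Qed.

End box_measure.

(** * Smooth functions *)

Section directional_derivatives.
Context {R : realType}.

(** The difference quotients of f and of f o g along w are literally the same.
    *)
Lemma is_derive_affine (V W : normedModType R) (f : V -> R) (g : W -> V)
    (x w : W) (v : V) (df : R) :
  (forall h : R, g (h *: w + x) = h *: v + g x) ->
  is_derive (g x) v f df -> is_derive x w (f \o g) df.
Proof.
move=> gE [df1 <-].
have E : (fun h : R => h^-1 *: (((f \o g) \o shift x) (h *: w) - (f \o g) x)) =
         (fun h : R => h^-1 *: ((f \o shift (g x)) (h *: v) - f (g x))).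
  by apply/funext => h /=; rewrite gE.
by split; [rewrite /derivable E|rewrite /derive E].
Qed.

Lemma is_derive_line (V : normedModType R) (f : V -> R) (x v : V) (df : R) :
  is_derive x v f df <-> is_derive (0 : R) 1 (fun h : R => f (h *: v + x)) df.
Proof.
split => [fx|].
  apply: (@is_derive_affine _ _ f (fun h : R => h *: v + x) _ _ v).
    by move=> h; rewrite addr0 scale0r add0r [h%:A]mulr1.
  by rewrite scale0r add0r.
have E : (fun h : R => h^-1 *: (((fun h : R => f (h *: v + x)) \o shift (0 : R)) (h *: (1 : R)) - f (0 *: v + x))) =
         (fun h : R => h^-1 *: ((f \o shift x) (h *: v) - f x)).
  by apply/funext => h /=; rewrite addr0 scale0r add0r [h%:A]mulr1.
by move=> [d1 <-]; split; [move: d1; rewrite /derivable E|rewrite /derive E].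
Qed.

Lemma is_derive_comp1 (V : normedModType R) (f : V -> R) (h : R -> R) (x v : V)
    (df dh : R) :
  is_derive x v f df -> is_derive (f x) 1 h dh ->
  is_derive x v (h \o f) (dh * df).
Proof.
move=> /is_derive_line fx hx; apply/is_derive_line.
apply: (@is_derive1_comp _ h (fun t : R => f (t *: v + x))).
by rewrite scale0r add0r.
Qed.

Lemma is_derive_mul (V : normedModType R) (f g : V -> R) (x v : V) (df dg : R) :
  is_derive x v f df -> is_derive x v g dg ->
  is_derive x v (fun y => f y * g y) (f x * dg + g x * df).
Proof. by move=> fx gx; exact: is_deriveM. Qed.

Lemma is_derive_add (V : normedModType R) (f g : V -> R) (x v : V) (df dg : R) :
  is_derive x v f df -> is_derive x v g dg ->
  is_derive x v (fun y => f y + g y) (df + dg).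
Proof. by move=> fx gx; exact: is_deriveD. Qed.

End directional_derivatives.

Section continuity.
Context {R : realType} {T : topologicalType}.
Implicit Types f g : T -> R.

Lemma continuous_addf f g : continuous f -> continuous g ->
  continuous (fun x => f x + g x).
Proof. by move=> cf cg x; apply: cvgD; [exact: cf|exact: cg]. Qed.

Lemma continuous_mulf f g : continuous f -> continuous g ->
  continuous (fun x => f x * g x).
Proof. by move=> cf cg x; apply: cvgM; [exact: cf|exact: cg]. Qed.

Lemma continuous_is_derive_comp (h dh : R -> R) f :
  (forall x, is_derive (f x) 1 h (dh (f x))) -> continuous f ->
  continuous (fun x => h (f x)).
Proof.
move=> hd cf x; apply: (@continuous_comp _ _ _ f h); first exact: cf.
by apply/differentiable_continuous/derivable1_diffP; have [] := hd x.
Qed.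

End continuity.

Section smooth_functions.
Context {R : realType} {n : nat}.
Implicit Types (f g : 'rV[R]_n -> R) (k : nat).
Local Notation e i := (delta_mx ord0 i : 'rV[R]_n).

Lemma cont_diffS k f (df : 'I_n -> 'rV[R]_n -> R) : continuous f ->
  (forall i x, is_derive x (e i) f (df i x)) ->
  (forall i, cont_diff k (df i)) -> cont_diff k.+1 f.
Proof.
move=> cf fd cd; split => // i; split => [x|]; first by have [] := fd i x.
rewrite (_ : partial i f = df i); first exact: cd.
by apply/funext => x; have [_ <-] := fd i x.
Qed.

Lemma cont_diff_is_derive k f i x : cont_diff k.+1 f ->
  is_derive x (e i) f (partial i f x).
Proof. by move=> [_ /(_ i)[H _]]; split. Qed.

Lemma cont_diff_continuous k f : cont_diff k f -> continuous f.
Proof. by case: k => [|k] []. Qed.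

Lemma cont_diffW k f : cont_diff k.+1 f -> cont_diff k f.
Proof.
elim: k f => [|k IH] f; first by move=> [].
move=> [cf H]; split => // i; have [H1 H2] := H i.
by split => //; exact: IH.
Qed.

Lemma cont_diff_cst k (c : R) : cont_diff k ((fun=> c) : 'rV[R]_n -> R).
Proof.
elim: k c => [|k IH] c; first by split => //; exact: cst_continuous.
apply: (@cont_diffS k _ (fun _ _ => 0)); first exact: cst_continuous.
by move=> i; exact: IH.
Qed.

Lemma is_derive_coord (i j : 'I_n) (x : 'rV[R]_n) :
  is_derive x (e i) (fun y => y ord0 j) ((i == j)%:R : R).
Proof.
apply: (@is_derive_affine _ _ _ id (fun y : 'rV[R]_n => y ord0 j) _ _
  ((i == j)%:R)).
by move=> h; rewrite !mxE eqxx eq_sym.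
Qed.

Lemma cont_diff_coord k j : cont_diff k (fun y : 'rV[R]_n => y ord0 j).
Proof.
case: k => [|k]; first by split => //; exact: coord_continuous.
apply: (@cont_diffS k _ (fun i _ => (i == j)%:R)) => [|i x|i].
- exact: coord_continuous.
- exact: is_derive_coord.
- exact: cont_diff_cst.
Qed.

Lemma cont_diffD k f g : cont_diff k f -> cont_diff k g ->
  cont_diff k (fun x => f x + g x).
Proof.
elim: k f g => [|k IH] f g fk gk.
  by split => //; apply: continuous_addf; [exact: fk.1|exact: gk.1].
apply: (@cont_diffS k _ (fun i x => partial i f x + partial i g x)).
- by apply: continuous_addf; [exact: fk.1|exact: gk.1].
- by move=> i x; apply: is_derive_add; apply: (@cont_diff_is_derive k).
- by move=> i; apply: IH; [have [_ /(_ i)[]] := fk|have [_ /(_ i)[]] := gk].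
Qed.

Lemma cont_diffM k f g : cont_diff k f -> cont_diff k g ->
  cont_diff k (fun x => f x * g x).
Proof.
elim: k f g => [|k IH] f g fk gk.
  by split => //; apply: continuous_mulf; [exact: fk.1|exact: gk.1].
apply: (@cont_diffS k _ (fun i x => f x * partial i g x + g x * partial i f x)).
- by apply: continuous_mulf; [exact: fk.1|exact: gk.1].
- by move=> i x; apply: is_derive_mul; apply: (@cont_diff_is_derive k).
- move=> i; apply: cont_diffD; apply: IH; try exact: cont_diffW.
  + by have [_ /(_ i)[]] := gk.
  + by have [_ /(_ i)[]] := fk.
Qed.

Lemma cont_diff_comp k (h dh : R -> R) f :
  (forall x, is_derive (f x) 1 h (dh (f x))) ->
  cont_diff k.+1 f -> cont_diff k (dh \o f) -> cont_diff k.+1 (h \o f).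
Proof.
move=> hd fk dhk; apply: (@cont_diffS k _ (fun i x => dh (f x) * partial i f x)).
- by apply: continuous_is_derive_comp hd _; exact: cont_diff_continuous fk.
- by move=> i x; apply: is_derive_comp1 => //; exact: (@cont_diff_is_derive k).
- by move=> i; apply: cont_diffM => //; have [_ /(_ i)[]] := fk.
Qed.

Lemma cont_diff_powR k f (r : R) : (forall x, 0 < f x) -> cont_diff k f ->
  cont_diff k (fun x => f x `^ r).
Proof.
move=> f0; elim: k r => [|k IH] r fk.
  split => //; apply: (@continuous_is_derive_comp _ _ (@powR R ^~ r)
    (fun t => r * t `^ (r - 1)) f); last exact: fk.1.
  by move=> x; exact: is_derive1_powR.
apply: (@cont_diff_comp k (@powR R ^~ r) (fun t => r * t `^ (r - 1))) => //.
  by move=> x; exact: is_derive1_powR.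
apply: cont_diffM; first exact: cont_diff_cst.
by apply: IH; exact: cont_diffW.
Qed.

Lemma smooth_continuous f : smooth f -> continuous f.
Proof. by move=> /(_ 0%N)[]. Qed.

Lemma smooth_partial f i : smooth f -> smooth (partial i f).
Proof. by move=> fs k; have [_ /(_ i)[]] := fs k.+1. Qed.

Lemma smooth_is_derive f i x : smooth f -> is_derive x (e i) f (partial i f x).
Proof. by move=> /(_ 1%N); exact: cont_diff_is_derive. Qed.

Lemma partialE f i x (d : R) : is_derive x (e i) f d -> partial i f x = d.
Proof. by case=> _ <-. Qed.

Lemma smooth_cst (c : R) : smooth ((fun=> c) : 'rV[R]_n -> R).
Proof. by move=> k; exact: cont_diff_cst. Qed.

Lemma smooth_coord j : smooth (fun y : 'rV[R]_n => y ord0 j).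
Proof. by move=> k; exact: cont_diff_coord. Qed.

Lemma smoothD f g : smooth f -> smooth g -> smooth (fun x => f x + g x).
Proof. by move=> fs gs k; exact: cont_diffD. Qed.

Lemma smoothM f g : smooth f -> smooth g -> smooth (fun x => f x * g x).
Proof. by move=> fs gs k; exact: cont_diffM. Qed.

Lemma smoothZ (c : R) f : smooth f -> smooth (fun x => c * f x).
Proof. by apply: smoothM; exact: smooth_cst. Qed.

Lemma smooth_powR f (r : R) : (forall x, 0 < f x) -> smooth f ->
  smooth (fun x => f x `^ r).
Proof. by move=> f0 fs k; exact: cont_diff_powR. Qed.

Lemma smooth_prod (I : Type) (s : seq I) (P : pred I) (F : I -> 'rV[R]_n -> R) :
  (forall i, P i -> smooth (F i)) -> smooth (fun x => \prod_(i <- s | P i) F i x).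
Proof.
move=> Fs; elim: s => [|j s IH].
  rewrite (_ : (fun x => _) = fun=> 1); first exact: smooth_cst.
  by apply/funext => x; rewrite big_nil.
rewrite (_ : (fun x => _) = if P j then
    (fun x => F j x * \prod_(i <- s | P i) F i x)
    else fun x => \prod_(i <- s | P i) F i x).
  by case: ifP => // Pj; apply: smoothM => //; exact: Fs.
by apply/funext => x; rewrite big_cons; case: ifP.
Qed.

(** One derivative of h o f is dh o f times a derivative of f, hence smooth.
    *)
Lemma smooth_antiderivative (h dh : R -> R) f :
  (forall t, is_derive (t : R) (1 : R) h (dh t)) -> smooth f -> smooth (dh \o f) ->
  smooth (h \o f).
Proof.
move=> hd fs dhs k; apply: cont_diffW.
by apply: (@cont_diff_comp k h dh) => //; move=> x; exact: hd.
Qed.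

End smooth_functions.

(** * Integration by parts for test functions *)

Section zero_outside.
Context d (T : measurableType d) (R : realType) (mu : {measure set T -> \bar R}).
Local Open Scope ereal_scope.

Lemma integrable_zero_outside (D : set T) (f : T -> \bar R) : measurable D ->
  (forall x, ~ D x -> f x = 0) -> mu.-integrable D f -> mu.-integrable setT f.
Proof.
move=> mD f0 /(integrable_mkcond _ mD); congr (_.-integrable _ _).
apply/funext => x; rewrite patchE; case: ifPn => // /negP xD.
by rewrite f0// => Dx; apply: xD; rewrite inE.
Qed.

Lemma integral_zero_outside (D : set T) (f : T -> \bar R) :
  (forall x, ~ D x -> f x = 0) ->
  \int[mu]_(x in D) f x = \int[mu]_x f x.
Proof.
move=> f0; rewrite integral_mkcond; apply: eq_integral => x _.
rewrite patchE; case: ifPn => // /negP xD.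
by rewrite f0// => Dx; apply: xD; rewrite inE.
Qed.

End zero_outside.

Section continuous_integrable.
Context {R : realType} {n : nat}.
Implicit Types (f : 'rV[R]_n -> R) (K : set 'rV[R]_n).

Lemma continuous_compact_bound f K : continuous f -> compact K ->
  exists C : R, forall x, K x -> `|f x| <= C.
Proof.
move=> cf cK.
have cfK : {within K, continuous f}.
  by apply: continuous_subspaceT => x; exact: cf.
have /compact_bounded[M [_ HM]] := continuous_compact cfK cK.
exists (M + 1) => x Kx; apply: (HM (M + 1)); first by rewrite ltrDl.
by exists x.
Qed.

End continuous_integrable.

Section borel_parts.
Context {R : realType}.
Local Notation e i := (delta_mx ord0 i).

Definition cube n (M : R) : set 'rV[R]_n :=
  closed_box (const_mx (- M)) (const_mx M).

Lemma cubeP n (M : R) (x : 'rV[R]_n) :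
  cube M x <-> forall i, `|x ord0 i| <= M.
Proof.
by split=> H i; have := H i; rewrite !mxE ler_norml.
Qed.

Lemma borel_cube_lty n (M : R) : (borel_lebesgue_rV n (@cube n M) < +oo)%E.
Proof.
have mC := @measurable_closed_box R n (const_mx (- M)) (const_mx M).
have mO := @measurable_open_box R n (const_mx (- (M + 1))) (const_mx (M + 1)).
have := leb_open_box_lty (const_mx (- (M + 1))) (const_mx (M + 1) : 'rV[R]_n).
rewrite leb_borelE//; apply: le_lt_trans; apply: le_measure; rewrite ?inE//.
by move=> x H i; have := H i; rewrite !mxE => /andP[h1 h2]; apply/andP; split; lra.
Qed.

Lemma borel_integrable_supp n (f : 'rV[R]_n -> R) (M : R) : continuous f ->
  (forall x, ~ cube M x -> f x = 0) ->
  (@borel_lebesgue_rV R n).-integrable setT (EFin \o f).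
Proof.
move=> cf f0.
have mC := @measurable_closed_box R n (const_mx (- M)) (const_mx M).
apply: (integrable_zero_outside mC) => [x Mx|]; first by rewrite /= f0.
apply: measurable_bounded_integrable => //.
- exact: borel_cube_lty.
- by apply: measurable_funTS; exact: continuous_measurable_rV.
- have [C HC] := continuous_compact_bound cf (@closed_box_compact R n
    (const_mx (- M)) (const_mx M)).
  exists C; split; first exact: num_real.
  by move=> D CD x Mx; apply: le_trans (ltW CD); exact: HC.
Qed.

Lemma cons_rV_ord0 n (t : R) (y : 'rV[R]_n) : cons_rV (t, y) ord0 ord0 = t.
Proof. by rewrite mxE unlift_none. Qed.

Lemma cons_rV_lift n (t : R) (y : 'rV[R]_n) j :
  cons_rV (t, y) ord0 (lift ord0 j) = y ord0 j.
Proof. by rewrite mxE liftK. Qed.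

Lemma cons_rVDl n (h t : R) (y : 'rV[R]_n) :
  cons_rV (h *: (1 : R) + t, y) = h *: e ord0 + cons_rV (t, y).
Proof.
apply/rowP => i; rewrite !mxE; case: (unliftP ord0 i) => [j ->|->].
  by rewrite andbF mulr0 add0r.
by rewrite eqxx.
Qed.

Lemma cons_rVDr n (h t : R) (y : 'rV[R]_n) j :
  cons_rV (t, h *: e j + y) = h *: e (lift ord0 j) + cons_rV (t, y).
Proof.
apply/rowP => i; rewrite !mxE; case: (unliftP ord0 i) => [k ->|->].
  by rewrite !mxE (inj_eq lift_inj).
by rewrite mulr0 add0r.
Qed.

Lemma continuous_cons_rVl n (y : 'rV[R]_n) :
  continuous (fun t : R => cons_rV (t, y) : 'rV[R]_n.+1).
Proof.
move=> t A /nbhs_ballP[eps /= eps0 HA]; apply/nbhs_ballP; exists eps => // s ts.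
apply: HA; apply/ball_rVP => // i.
case: (unliftP ord0 i) => [k ->|->]; first by rewrite !cons_rV_lift subrr normr0.
by rewrite !cons_rV_ord0.
Qed.

Lemma continuous_cons_rVr n (t : R) :
  continuous (fun y : 'rV[R]_n => cons_rV (t, y)).
Proof.
move=> y A /nbhs_ballP[eps /= eps0 HA]; apply/nbhs_ballP; exists eps => // z yz.
apply: HA; apply/ball_rVP => // i.
case: (unliftP ord0 i) => [k ->|->]; last by rewrite !cons_rV_ord0 subrr normr0.
by rewrite !cons_rV_lift; exact: (ball_rVP _ _ eps0).1.
Qed.

Lemma integral_derivative0 (f df : R -> R) (M : R) :
  (forall t, is_derive t (1 : R) f (df t)) -> continuous df ->
  (forall t, M < `|t| -> f t = 0) -> (forall t, M < `|t| -> df t = 0) ->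
  (\int[lebesgue_measure]_t (df t)%:E = 0)%E.
Proof.
move=> fd cdf f0 df0; pose B := `|M| + 1.
have MB : M < B by rewrite /B; have := ler_norm M; lra.
have B0 : 0 < B by rewrite /B; have := normr_ge0 M; lra.
have cf : continuous f.
  by move=> t; apply/differentiable_continuous/derivable1_diffP; have [] := fd t.
rewrite -(@integral_zero_outside _ _ R (@lebesgue_measure R)
  `[- B, B]%classic (fun t => (df t)%:E)); last first.
  move=> t /= /negP; rewrite in_itv /= -ler_norml -ltNge => Bt.
  by rewrite df0//; exact: lt_trans Bt.
rewrite (@continuous_FTC2 _ df f).
- by rewrite !f0 ?subee// ?normrN ger0_norm// ltW.
- by rewrite gt0_cp//.
- by apply: continuous_subspaceT => x; exact: cdf.
- split=> [x _||]; first by have [] := fd x.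
  + by apply: cvg_at_right_filter; exact: cf.
  + by apply: cvg_at_left_filter; exact: cf.
- by move=> x _; rewrite derive1E; have [_ ->] := fd x.
Qed.

(** Fubini reduces to the coordinate along which one differentiates, where the
    fundamental theorem of calculus applies to a function vanishing far out. *)
Lemma borel_integral_partial0 n (f : 'rV[R]_n -> R) (i : 'I_n) (M : R) :
  (forall x, derivable f x (e i)) -> continuous (partial i f) ->
  (forall x, ~ cube M x -> f x = 0) ->
  (forall x, ~ cube M x -> partial i f x = 0) ->
  (\int[@borel_lebesgue_rV R n]_x (partial i f x)%:E = 0)%E.
Proof.
elim: n f i => [f []//|n IH f i fd cdf f0 df0].
have intf := borel_integrable_supp cdf df0.
have mdf : measurable_fun setT (EFin \o partial i f).
  by apply/measurable_EFinP; exact: continuous_measurable_rV.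
have fD x : is_derive x (e i) f (partial i f x) by split.
have mcons := @measurable_cons_rV R n.
have icons : (@lebesgue_measure R \x @borel_lebesgue_rV R n)%E.-integrable setT
    ((EFin \o partial i f) \o @cons_rV R n).
  move/integrableP: intf => [_]; rewrite /= ge0_integral_pushforward//; last first.
    apply/measurable_EFinP; apply: measurableT_comp => //.
    exact: continuous_measurable_rV.
  by move=> h; apply/integrableP; split; [exact: measurableT_comp|exact: h].
rewrite /= [LHS](integral_pushforward mcons mdf) //.
have Cout t y : ~ cube M y -> ~ cube M (cons_rV (t, y)).
  move=> h /cubeP H; apply/h/cubeP => j; have := H (lift ord0 j).
  by rewrite cons_rV_lift.
have Cout0 t y : M < `|t| -> ~ cube M (@cons_rV R n (t, y)).
  by move=> h /cubeP /(_ ord0); rewrite cons_rV_ord0 leNgt h.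
case: (unliftP ord0 i) => [j|] iE.
  rewrite preimage_setT -(integral12_prod_meas1 icons) /fubini_F /=.
  apply: integral0_eq => t _.
  have gd y : is_derive y (e j) (f \o (fun y => cons_rV (t, y)))
      (partial i f (cons_rV (t, y))).
    apply: (@is_derive_affine _ _ _ f _ y (e j) (e i)) => // h.
    by rewrite cons_rVDr iE.
  have pE : partial j (f \o (fun y => cons_rV (t, y))) =
      (fun y => partial i f (cons_rV (t, y))).
    by apply/funext => y; exact: partialE.
  have := IH (f \o (fun y => cons_rV (t, y))) j; rewrite pE; apply.
  - by move=> y; have [] := gd y.
  - by move=> y; apply: continuous_comp; [exact: continuous_cons_rVr|exact: cdf].
  - by move=> y My; apply: f0; exact: Cout.
  - by move=> y My; apply: df0; exact: Cout.
rewrite preimage_setT -(integral21_prod_meas1 icons) /fubini_G /=.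
apply: integral0_eq => y _.
apply: (@integral_derivative0 (fun t => f (cons_rV (t, y)))
  (fun t => partial i f (cons_rV (t, y))) M) => [t||t Mt|t Mt].
- apply: (@is_derive_affine _ _ _ f (fun t : R => cons_rV (t, y)) t _ (e i)) => //.
  by move=> h; rewrite cons_rVDl iE.
- by move=> t; apply: continuous_comp; [exact: continuous_cons_rVl|exact: cdf].
- by apply: f0; exact: Cout0.
- by apply: df0; exact: Cout0.
Qed.

End borel_parts.

(** * Test functions *)

Section test_functions.
Context {R : realType} {n : nat}.
Implicit Types (Om : set 'rV[R]_n) (f g phi psi : 'rV[R]_n -> R).
Local Notation e i := (delta_mx ord0 i : 'rV[R]_n).

Definition supp f : set 'rV[R]_n := closure [set x | f x != 0].

Lemma suppN f x : ~ supp f x -> f x = 0.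
Proof.
by move=> h; apply: contrapT => /eqP fx; apply: h; exact: subset_closure.
Qed.

Lemma partial_suppN f i x : ~ supp f x -> partial i f x = 0.
Proof.
move=> h; have oU : open (~` supp f) by apply: closed_openC; exact: closed_closure.
have nf : \near x, f x = (fun=> 0) x.
  have := open_nbhs_nbhs (conj oU h).
  by apply: (@filterS _ _ (nbhs_filter x)) => y; exact: suppN.
by rewrite /partial (near_eq_derive _ nf) derive_cst.
Qed.

Lemma test_partial_suppN Om f i x :
  test_function Om f -> ~ Om x -> partial i f x = 0.
Proof. by move=> [_ _ fO] Ox; apply: partial_suppN => /fO. Qed.

Lemma compact_cube (K : set 'rV[R]_n) : compact K -> exists M, K `<=` cube M.
Proof.
move=> /compact_bounded[M [_ HM]]; exists (M + 1) => x Kx; apply/cubeP => i.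
apply: le_trans (le_coord_norm x i) _; apply: HM Kx; by rewrite ltrDl.
Qed.

(** The support of g lies in the union of the two supports. This serves for
    all combinations of two test functions that vanish at (0, 0). *)
Lemma test_function_supp Om phi psi g : test_function Om phi ->
  test_function Om psi -> smooth g ->
  (forall x, phi x = 0 -> psi x = 0 -> g x = 0) -> test_function Om g.
Proof.
move=> [_ cphi Ophi] [_ cpsi Opsi] gs g0.
have sub : supp g `<=` supp phi `|` supp psi.
  rewrite /supp -closureU; apply: closure_subset => x /= gx.
  have [px|px] := eqVneq (phi x) 0; last by left.
  by right; apply: contra_neq gx; exact: g0.
split => //; last by move=> x /sub[/Ophi|/Opsi].
by apply: subclosed_compact sub; [exact: closed_closure|exact: compactU].
Qed.

Lemma test_functionZ Om (c : R) phi :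
  test_function Om phi -> test_function Om (fun x => c * phi x).
Proof.
move=> tphi; apply: (test_function_supp tphi tphi).
  by apply: smoothZ; case: tphi.
by move=> x -> _; rewrite mulr0.
Qed.

Lemma test_functionMr Om g phi : smooth g ->
  test_function Om phi -> test_function Om (fun x => g x * phi x).
Proof.
move=> gs tphi; apply: (test_function_supp tphi tphi).
  by apply: smoothM => //; case: tphi.
by move=> x -> _; rewrite mulr0.
Qed.

Lemma test_function_cst0 Om : test_function Om (fun=> 0).
Proof.
split; first exact: smooth_cst.
- rewrite (_ : mkset _ = set0) ?closure0; first exact: compact0.
  by apply/seteqP; split => // x /=; rewrite eqxx.
- rewrite (_ : mkset _ = set0) ?closure0//.
  by apply/seteqP; split => // x /=; rewrite eqxx.
Qed.

Lemma open_lebesgue_measurable Om : open Om ->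
  measurable (Om : set (lebesgue_space R n)).
Proof. by move=> /open_measurable_rV/borel_lebesgue_measurable. Qed.

Lemma continuous_lmeasurable Om f : open Om -> continuous f -> lmeasurable Om f.
Proof.
move=> oO cf; apply: measurable_funTS; apply: measurable_funT_borel_lebesgue.
exact: continuous_measurable_rV.
Qed.

Lemma in_L1loc_integrableM_bounded Om (h g : 'rV[R]_n -> R) (K : set 'rV[R]_n)
    (C : R) :
  open Om -> in_L1loc Om h -> compact K -> K `<=` Om -> lmeasurable Om g ->
  (forall x, K x -> `|g x| <= C) -> (forall x, ~ K x -> g x = 0) ->
  (leb R n).-integrable (Om : set (lebesgue_space R n))
    (fun x => (h x * g x)%:E).
Proof.
move=> oO [mh Hh] cK KO mg HC g0.
have mO := open_lebesgue_measurable oO.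
have mK : measurable (K : set (lebesgue_space R n)).
  by apply: borel_lebesgue_measurable; exact: compact_measurable_rV.
have mhg : lmeasurable Om (fun x => h x * g x) by exact: measurable_funM.
have hK : (leb R n).-integrable (K : set (lebesgue_space R n)) (EFin \o h).
  apply/integrableP; split; last exact: Hh.
  by apply/measurable_EFinP; exact: measurable_funS mh.
have hgK : (leb R n).-integrable (K : set (lebesgue_space R n))
    (fun x => (h x * g x)%:E).
  apply: (le_integrable mK _ _ (integrableZl mK C hK)).
    by apply/measurable_EFinP; exact: measurable_funS mhg.
  move=> x Kx /=; rewrite lee_fin !normrM mulrC ler_wpM2r//.
  by apply: le_trans (HC _ Kx) _; exact: ler_norm.
apply/(integrable_mkcond _ mO).
rewrite (_ : _ \_ _ = (fun x => (h x * g x)%:E) \_ K).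
  by apply/(integrable_mkcond _ mK).
apply/funext => x; rewrite !patchE; case: ifPn => [/[1!inE] xO|/negP xO].
  by case: ifPn => // /negP xK; rewrite g0 ?mulr0// => Kx; apply: xK; rewrite inE.
by case: ifPn => // /[1!inE] /KO Ox; case: xO; rewrite inE.
Qed.

Lemma in_L1loc_integrableM Om (h g : 'rV[R]_n -> R) (K : set 'rV[R]_n) :
  open Om -> in_L1loc Om h -> compact K -> K `<=` Om -> continuous g ->
  (forall x, ~ K x -> g x = 0) ->
  (leb R n).-integrable (Om : set (lebesgue_space R n))
    (fun x => (h x * g x)%:E).
Proof.
move=> oO hh cK KO cg g0; have [C HC] := continuous_compact_bound cg cK.
apply: (in_L1loc_integrableM_bounded oO hh cK KO _ HC g0).
exact: continuous_lmeasurable.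
Qed.

Lemma in_L1loc_bounded Om (h : 'rV[R]_n -> R) (C : R) : lmeasurable Om h ->
  open Om -> (forall x, Om x -> `|h x| <= C) -> in_L1loc Om h.
Proof.
move=> mh oO hC; split => // K cK KO.
have mO := open_lebesgue_measurable oO.
have mK : measurable (K : set (lebesgue_space R n)).
  by apply: borel_lebesgue_measurable; exact: compact_measurable_rV.
have : (leb R n).-integrable (K : set (lebesgue_space R n)) (EFin \o h).
  apply: measurable_bounded_integrable => //.
  - by apply: leb_bounded_lty => //; exact: compact_bounded.
  - exact: measurable_funS mh.
  - exists C; split; first exact: num_real.
    by move=> D CD x Kx; apply: le_trans (ltW CD); apply: hC; exact: KO.
by case/integrableP.
Qed.

Lemma in_L1loc_cst Om (c : R) : open Om -> in_L1loc Om (fun=> c).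
Proof.
by move=> oO; apply: (@in_L1loc_bounded _ _ `|c|) => //; exact: measurable_cst.
Qed.

Lemma test_integrableM Om h phi : open Om -> in_L1loc Om h ->
  test_function Om phi ->
  (leb R n).-integrable (Om : set (lebesgue_space R n))
    (fun x => (h x * phi x)%:E).
Proof.
move=> oO hh [ps cp Op]; apply: (in_L1loc_integrableM oO hh cp Op).
- exact: smooth_continuous.
- by move=> x; exact: suppN.
Qed.

Lemma test_partial_integrableM Om h phi i : open Om -> in_L1loc Om h ->
  test_function Om phi ->
  (leb R n).-integrable (Om : set (lebesgue_space R n))
    (fun x => (h x * partial i phi x)%:E).
Proof.
move=> oO hh [ps cp Op]; apply: (in_L1loc_integrableM oO hh cp Op).
- by apply: smooth_continuous; exact: smooth_partial.
- by move=> x; exact: partial_suppN.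
Qed.

Lemma test_integral_partial0 Om f i : open Om -> test_function Om f ->
  (\int[leb R n]_(x in Om) (partial i f x)%:E = 0)%E.
Proof.
move=> oO tf; have [fs cf fO] := tf; have [M HM] := compact_cube cf.
have cdf : continuous (partial i f).
  by apply: smooth_continuous; exact: smooth_partial.
rewrite (@integral_zero_outside _ (lebesgue_space R n) R (leb R n) Om
  (fun x => (partial i f x)%:E)); last first.
  by move=> x Ox; rewrite (test_partial_suppN i tf Ox).
rewrite integral_leb_borel; last 2 first.
- by apply/measurable_EFinP; exact: continuous_measurable_rV.
- have l1 := in_L1loc_cst 1 oO.
  apply: (integrable_zero_outside (open_lebesgue_measurable oO)).
    by move=> x Ox; rewrite (test_partial_suppN i tf Ox).
  have := test_partial_integrableM i oO l1 tf.
  by under eq_fun do rewrite mul1r.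
apply: (@borel_integral_partial0 _ _ f i M) => //.
- by move=> x; have [] := smooth_is_derive i x fs.
- by move=> x Mx; apply: suppN => /HM.
- by move=> x Mx; apply: partial_suppN => /HM.
Qed.

End test_functions.

(** * Smooth bumps on the line *)

Section flat.
Context {R : realType}.
Implicit Types (t : R) (k : nat).

(** The functions t^(-k) exp(-1/t), extended by 0 to t <= 0, form a family that
    is stable under differentiation: this is why exp(-1/t) is smooth at 0. *)
Definition flat k t : R := if 0 < t then t^-1 ^+ k * expR (- t^-1) else 0.

Lemma flat_pos k t : 0 < t -> flat k t = t^-1 ^+ k * expR (- t^-1).
Proof. by rewrite /flat => ->. Qed.

Lemma flat_neg k t : t <= 0 -> flat k t = 0.
Proof. by rewrite /flat ltNge => ->. Qed.

Lemma flat_ge0 k t : 0 <= flat k t.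
Proof.
rewrite /flat; case: ifPn => // t0; rewrite mulr_ge0 ?expR_ge0//.
by rewrite exprn_ge0// invr_ge0 ltW.
Qed.

Lemma flat_gt0 k t : 0 < t -> 0 < flat k t.
Proof.
by move=> t0; rewrite flat_pos// mulr_gt0 ?expR_gt0// exprn_gt0// invr_gt0.
Qed.

Lemma flat0_le1 t : flat 0 t <= 1.
Proof.
have [t0|t0] := ltP 0 t; last by rewrite flat_neg.
by rewrite flat_pos// expr0 mul1r expR_le1 oppr_le0 invr_ge0 ltW.
Qed.

(** From exp(y) >= 1 + y^(k+2) / (k+2)!, taken at y = 1/t. A quadratic bound
    is what differentiability at 0 needs. *)
Lemma flat_sqr k : exists C : R, forall t, `|flat k t| <= C * t ^+ 2.
Proof.
exists (k.+2)`!%:R => t; rewrite ger0_norm ?flat_ge0//.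
have [t0|t0] := ltP 0 t; last by rewrite flat_neg// mulr_ge0 ?sqr_ge0.
rewrite flat_pos// expRN.
have y0 : 0 < t^-1 by rewrite invr_gt0.
have := expR_ge1Dxn k.+1 (ltW y0).
set E := expR _ => HE.
have F0 : 0 < (k.+2)`!%:R :> R by rewrite ltr0n fact_gt0.
have E0 : 0 < E by exact: expR_gt0.
have H1 : t^-1 ^+ k.+2 <= (k.+2)`!%:R * E.
  by rewrite mulrC -ler_pdivrMr//; lra.
rewrite ler_pdivrMr//.
have -> : t^-1 ^+ k = t^-1 ^+ k.+2 * t ^+ 2.
  by rewrite -addn2 exprD -mulrA -exprMn mulVf ?gt_eqF// expr1n mulr1.
by rewrite [leRHS]mulrAC ler_wpM2r ?sqr_ge0.
Qed.

Lemma is_derive_sqr_bound (f : R -> R) (C : R) :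
  (forall t, `|f t| <= C * t ^+ 2) -> is_derive (0 : R) (1 : R) f 0.
Proof.
move=> fC.
have f0 : f 0 = 0.
  by apply/eqP; rewrite -normr_le0; have := fC 0; rewrite expr0n mulr0.
have C0 : 0 <= C by have := fC 1; rewrite expr1n mulr1; exact: le_trans.
have L : (fun h : R => h^-1 *: ((f \o shift (0 : R)) (h *: (1 : R)) - f 0))
    @ (0 : R)^' --> (0 : R).
  apply/cvgrPdist_le => eps eps0.
  near=> h; rewrite /= f0 subr0 addr0 [h%:A]mulr1 sub0r normrN normrZ normfV.
  have h0 : h != 0 by near: h; exact: nbhs_dnbhs_neq.
  have hp : 0 < `|h| by rewrite normr_gt0.
  rewrite ler_pdivrMl// (le_trans (fC h))// -normr_id -real_normK ?num_real//.
  rewrite normr_id expr2 mulrA mulrC ler_pM2l//.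
  have hC : `|h| <= eps / (C + 1).
    near: h; apply/nbhs_dnbhs; exists (eps / (C + 1)) => /=.
      by rewrite divr_gt0//; lra.
    by move=> h /=; rewrite sub0r normrN => /ltW.
  have Ch : C * `|h| <= C * (eps / (C + 1)) by rewrite ler_wpM2l.
  have Ce : C * (eps / (C + 1)) <= eps.
    by rewrite mulrCA ger_pMr//; rewrite ler_pdivrMr ?mul1r; lra.
  exact: le_trans Ch Ce.
split; first by apply/cvg_ex; exists 0.
by rewrite /derive; apply/cvg_lim.
Unshelve. all: by end_near. Qed.

Lemma is_derive_flat k t :
  is_derive t (1 : R) (flat k) (- k%:R * flat k.+1 t + flat k.+2 t).
Proof.
have [t0|t0|->] := ltgtP t 0.
- rewrite !flat_neg ?(ltW t0)// mulr0 addr0.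
  have H0 : \near t, (fun=> 0) t = flat k t.
    by near=> s; rewrite flat_neg// ltW//; near: s; exact: lt_nbhsl.
  by apply: near_eq_is_derive H0 _; exact: is_derive_cst.
- rewrite !flat_pos//.
  have H0 : \near t, ((fun y => y ^+ k * expR (- y)) \o (fun s : R => s^-1)) t
      = flat k t.
    by near=> s; rewrite flat_pos//; near: s; exact: lt_nbhsr.
  apply: near_eq_is_derive H0 _.
  have tn0 : t != 0 by rewrite gt_eqF.
  have dV : is_derive t (1 : R) (fun s : R => s^-1) (- t^-1 ^+ 2).
    split; first by apply: derivableV => //; exact: derivable_id.
    have := deriveV tn0 (@derivable_id _ _ t (1 : R)).
    by rewrite derive_id => ->; rewrite exprVn [LHS]mulr1.
  have dE : is_derive (t^-1) (1 : R) (fun y : R => y ^+ k * expR (- y))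
      (t^-1 ^+ k * - expR (- t^-1) + expR (- t^-1) * (k%:R * t^-1 ^+ k.-1)).
    apply: is_derive_mul.
      split; first exact: exprn_derivable.
      by rewrite exp_derive; exact: mulr1.
    have := is_derive_comp1 (@is_deriveNid _ _ t^-1 (1 : R))
      (is_derive_expR (- t^-1)).
    by rewrite mulrN1.
  have [D1 D2] := is_derive_comp1 dV dE.
  split; first exact: D1.
  rewrite D2.
  case: k {dE D1 D2} => [|k] /=; rewrite ?mulr0 ?mul0r; first by rewrite !exprS expr0; ring.
  by rewrite !exprS; ring.
- rewrite !flat_neg// mulr0 addr0; have [C HC] := flat_sqr k.
  exact: is_derive_sqr_bound HC.
Unshelve. all: by end_near. Qed.

Lemma smooth_flat n k (f : 'rV[R]_n -> R) : smooth f -> smooth (flat k \o f).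
Proof.
move=> fs m; elim: m k => [|m IH] k.
  split => //; apply: (@continuous_is_derive_comp _ _ (flat k)
    (fun t => - k%:R * flat k.+1 t + flat k.+2 t) f).
    by move=> x; exact: is_derive_flat.
  exact: smooth_continuous.
apply: (@cont_diff_comp _ _ _ _ (fun t => - k%:R * flat k.+1 t + flat k.+2 t)) => //.
  by move=> x; exact: is_derive_flat.
apply: cont_diffD; last exact: IH.
by apply: cont_diffM; [exact: cont_diff_cst|exact: IH].
Qed.

Lemma continuous_flat k : continuous (flat k).
Proof.
move=> t; apply/differentiable_continuous/derivable1_diffP.
by have [] := is_derive_flat k t.
Qed.

End flat.

Section integral_positive.
Context d (T : measurableType d) (R : realType) (mu : {measure set T -> \bar R}).
Local Open Scope ereal_scope.

Lemma integral_gt0_pos (D E : set T) (f : T -> \bar R) : measurable D ->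
  measurable_fun D f -> (forall x, D x -> 0 <= f x) ->
  measurable E -> E `<=` D -> (forall x, E x -> 0 < f x) -> 0 < mu E ->
  0 < \int[mu]_(x in D) f x.
Proof.
move=> mD mf f0 mE ED fE muE; rewrite lt_def integral_ge0// andbT.
apply/negP => /eqP I0.
have : \int[mu]_(x in D) `|f x| = 0.
  by rewrite -I0; apply: eq_integral => x /[1!inE] Dx; rewrite gee0_abs// f0.
move/(ae_eq_integral_abs mu mD mf) => [N [mN N0 sN]].
have EN : E `<=` N.
  move=> x Ex; apply: sN => /= /(_ (ED _ Ex)) fx.
  by have := fE _ Ex; rewrite fx ltxx.
have : mu E <= mu N by apply: le_measure; rewrite ?inE.
by rewrite N0 leNgt muE.
Qed.

End integral_positive.

Section bumps.
Context {R : realType} {n : nat}.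
Implicit Types (al be : R) (phi psi : R -> R).
Local Notation mu := (@lebesgue_measure R).

(** One-dimensional building blocks of product test functions: smoothness is
    asked for along each coordinate of the ambient space. *)
Definition bump_fun al be phi : Prop :=
  [/\ continuous phi,
      forall i : 'I_n, smooth (fun x : 'rV[R]_n => phi (x ord0 i)) &
      forall t, ~ (al <= t <= be) -> phi t = 0].

(** As k grows this increases to the indicator function of ]al, be[. *)
Definition flat_bump al be (k : R) t : R :=
  flat 0 (k * (t - al)) * flat 0 (k * (be - t)).

Lemma flat_bump_ge0 al be k t : 0 <= flat_bump al be k t.
Proof. by rewrite mulr_ge0 ?flat_ge0. Qed.

Lemma flat_bump_le1 al be k t : flat_bump al be k t <= 1.
Proof. by rewrite mulr_ile1 ?flat_ge0 ?flat0_le1. Qed.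

Lemma flat_bump_gt0 al be k t : 0 < k -> al < t < be -> 0 < flat_bump al be k t.
Proof.
by move=> k0 /andP[? ?]; rewrite mulr_gt0// flat_gt0// mulr_gt0// subr_gt0.
Qed.

Lemma flat_bump_out al be k t : 0 <= k -> ~ (al < t < be) ->
  flat_bump al be k t = 0.
Proof.
move=> k0 /negP; rewrite negb_and -!leNgt => /orP[h|h].
  by rewrite /flat_bump flat_neg ?mul0r// mulr_ge0_le0// subr_le0.
by rewrite /flat_bump [X in _ * X]flat_neg ?mulr0// mulr_ge0_le0// subr_le0.
Qed.

Lemma bump_flat al be al' be' k : 0 <= k -> al <= al' -> be' <= be ->
  bump_fun al be (flat_bump al' be' k).
Proof.
move=> k0 ala beb; split.
- apply: continuous_mulf => t.
    apply: (@continuous_comp _ _ _ (fun t => k * (t - al')) (flat 0)); last exact: continuous_flat.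
    by apply: cvgM; [exact: cvg_cst|apply: cvgB; [exact: cvg_id|exact: cvg_cst]].
  apply: (@continuous_comp _ _ _ (fun t => k * (be' - t)) (flat 0)); last exact: continuous_flat.
  by apply: cvgM; [exact: cvg_cst|apply: cvgB; [exact: cvg_cst|exact: cvg_id]].
- move=> i; apply: smoothM.
    apply: (smooth_flat 0 (f := fun x : 'rV[R]_n => k * (x ord0 i - al'))).
    by apply: smoothZ; apply: smoothD; [exact: smooth_coord|exact: smooth_cst].
  apply: (smooth_flat 0 (f := fun x : 'rV[R]_n => k * (be' - x ord0 i))).
  apply: smoothZ; apply: smoothD; first exact: smooth_cst.
  rewrite (_ : (fun x => _) = (fun x : 'rV[R]_n => (-1) * x ord0 i)).
    by apply: smoothZ; exact: smooth_coord.
  by apply/funext => x; rewrite mulN1r.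
- move=> t h; apply: flat_bump_out => // /andP[h1 h2]; apply: h.
  by rewrite (le_trans ala (ltW h1)) (le_trans (ltW h2) beb).
Qed.

Lemma bump_lin al be phi psi (c d : R) : bump_fun al be phi -> bump_fun al be psi ->
  bump_fun al be (fun t => c * phi t + d * psi t).
Proof.
move=> [cf sf f0] [cg sg g0]; split.
- by apply: continuous_addf; apply: continuous_mulf => //; exact: cst_continuous.
- by move=> i; apply: smoothD; apply: smoothZ.
- by move=> t h; rewrite f0// g0// !mulr0 addr0.
Qed.

Lemma bump_integrable al be phi : bump_fun al be phi ->
  mu.-integrable setT (EFin \o phi).
Proof.
move=> [cf _ f0]; apply: (@integrable_zero_outside _ _ R mu `[al, be]%classic).
- exact: measurable_itv.
- by move=> t /= /negP; rewrite in_itv /= => /negP h; rewrite f0.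
- apply: continuous_compact_integrable; first exact: segment_compact.
  by apply: continuous_subspaceT => t; exact: cf.
Qed.

(** The primitive that vanishes on the left of the support also vanishes on
    the right of it, since the total integral is zero. *)
Lemma bump_antiderivative al be phi : bump_fun al be phi ->
  (\int[mu]_t phi t)%R = 0 ->
  exists Phi, bump_fun al be Phi /\ forall t : R, is_derive t (1 : R) Phi (phi t).
Proof.
move=> bphi I0; have [cf sf f0] := bphi; have fi := bump_integrable bphi.
pose Phi t := (\int[mu]_(s in `]-oo, t]) phi s)%R.
have dPhi (t : R) : is_derive t (1 : R) Phi (phi t).
  have tt1 : t < t + 1 by rewrite ltrDl.
  have fi1 : mu.-integrable `]-oo, t + 1] (EFin \o phi).
    by apply: integrableS fi => //; exact: measurable_itv.
  have FTC := @continuous_FTC1 R phi -oo%O t (t + 1) tt1 fi1.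
  have [|d1 d2] := FTC _ (cf t); first by rewrite ltNyr.
  by split; [exact: d1|rewrite -d2 derive1E].
exists Phi; split => //.
have cPhi : continuous Phi.
  by move=> t; apply/differentiable_continuous/derivable1_diffP; have [] := dPhi t.
split => //.
  move=> i; apply: (@smooth_antiderivative R n Phi phi (fun x => x ord0 i)).
  - exact: smooth_coord.
  - exact: sf.
move=> t /negP; rewrite negb_and -!ltNge => /orP[h|h].
  rewrite /Phi /Rintegral integral0_eq// => s /=; rewrite in_itv /= => st.
  by rewrite f0//; apply/negP; rewrite negb_and -!ltNge (le_lt_trans st h).
rewrite /Phi /Rintegral (@integral_zero_outside _ _ R mu) => [|s /=].
  exact: I0.
rewrite in_itv /= => /negP; rewrite -ltNge => ts.
by rewrite f0//; apply/negP; rewrite negb_and -!ltNge (lt_trans h ts) orbT.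
Qed.

Lemma bump_Rintegral_lin al be phi psi (c d : R) : bump_fun al be phi ->
  bump_fun al be psi ->
  (\int[mu]_t (c * phi t + d * psi t))%R =
  c * (\int[mu]_t phi t)%R + d * (\int[mu]_t psi t)%R.
Proof.
move=> bphi bpsi; have fi := bump_integrable bphi; have gi := bump_integrable bpsi.
have Zi h k : mu.-integrable setT (EFin \o h) ->
    mu.-integrable setT (EFin \o (fun t => k * h t)).
  by move=> hi; apply: eq_integrable (integrableZl measurableT k hi).
by rewrite RintegralD ?RintegralZl//; exact: Zi.
Qed.

Lemma flat_bump_Rintegral_gt0 al be : al < be ->
  0 < (\int[mu]_t flat_bump al be 1 t)%R.
Proof.
move=> ab; have b1 := @bump_flat al be al be 1 ler01 (lexx _) (lexx _).
have fi := bump_integrable b1; have [cf _ _] := b1.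
rewrite /Rintegral fine_gt0//; apply/andP; split; last first.
  have : (\int[mu]_t (flat_bump al be 1 t)%:E \is a fin_num)%E.
    exact: integrable_fin_num.
  by rewrite fin_numE => /andP[_]; rewrite ltey.
apply: (@integral_gt0_pos _ _ R mu setT `]al, be[%classic) => //.
- by apply/measurable_EFinP; exact: continuous_measurable_fun.
- by move=> t _; rewrite lee_fin flat_bump_ge0.
- by move=> t /=; rewrite in_itv lte_fin => h; exact: flat_bump_gt0.
- have := @lebesgue_measure_itv R `]al, be[; rewrite /= lte_fin ab -EFinB => ->.
  by rewrite lte_fin subr_gt0.
Qed.

End bumps.

(** * Product test functions and the averaging argument *)

Section product_bumps.
Context {R : realType} {n : nat}.
Variables (Om : set 'rV[R]_n) (a b : 'rV[R]_n).
Hypotheses (oO : open Om) (abO : closed_box a b `<=` Om).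
Implicit Types (psi rho : 'I_n -> R -> R) (h : 'rV[R]_n -> R).
Local Notation mu := (@lebesgue_measure R).
Local Notation e i := (delta_mx ord0 i : 'rV[R]_n).

Definition prodfun psi (x : 'rV[R]_n) : R := \prod_i psi i (x ord0 i).

Definition upd psi (i : 'I_n) (phi : R -> R) : 'I_n -> R -> R :=
  fun j => if j == i then phi else psi j.

Definition bumps psi : Prop := forall i, @bump_fun R n (a ord0 i) (b ord0 i) (psi i).

Lemma prodfun_out psi x : bumps psi -> ~ closed_box a b x -> prodfun psi x = 0.
Proof.
move=> bp nx; have [i hi] : exists i, ~ (a ord0 i <= x ord0 i <= b ord0 i).
  by apply/existsNP.
by rewrite /prodfun (bigD1 i)//=; have [_ _ ->] := bp i; rewrite ?mul0r.
Qed.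

Lemma prodfun_smooth psi : bumps psi -> smooth (prodfun psi).
Proof. by move=> bp; apply: smooth_prod => i _; have [_ + _] := bp i. Qed.

Lemma prodfun_test psi : bumps psi -> test_function Om (prodfun psi).
Proof.
move=> bp.
have sub : supp (prodfun psi) `<=` closed_box a b.
  have -> : closed_box a b = closure (closed_box a b).
    by apply/closure_id; exact: closed_box_closed.
  apply: closure_subset => x /= /eqP h.
  by apply: contrapT => nx; apply: h; exact: prodfun_out.
split; first exact: prodfun_smooth.
- apply: subclosed_compact sub; first exact: closed_closure.
  exact: closed_box_compact.
- exact: subset_trans abO.
Qed.

Lemma prodfun_upd psi i phi x :
  prodfun (upd psi i phi) x =
  phi (x ord0 i) * \prod_(j | j != i) psi j (x ord0 j).
Proof.
rewrite /prodfun (bigD1 i)//= /upd eqxx; congr (_ * _).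
by apply: eq_bigr => j /negPf ->.
Qed.

Lemma prodfunE psi i x :
  prodfun psi x = psi i (x ord0 i) * \prod_(j | j != i) psi j (x ord0 j).
Proof. by rewrite /prodfun (bigD1 i). Qed.

Lemma bumps_upd psi i phi : bumps psi -> @bump_fun R n (a ord0 i) (b ord0 i) phi ->
  bumps (upd psi i phi).
Proof. by move=> bp bphi j; rewrite /upd; case: eqP => [->|]. Qed.

Lemma partial_prodfun_upd psi i (Phi phi : R -> R) x :
  (forall t : R, is_derive t (1 : R) Phi (phi t)) ->
  partial i (prodfun (upd psi i Phi)) x = prodfun (upd psi i phi) x.
Proof.
move=> dPhi; apply: partialE.
rewrite (_ : prodfun (upd psi i Phi) =
   (fun x => Phi (x ord0 i) * \prod_(j | j != i) psi j (x ord0 j))); last first.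
  by apply/funext => y; exact: prodfun_upd.
have d1 : is_derive x (e i) (fun y : 'rV[R]_n => Phi (y ord0 i)) (phi (x ord0 i)).
  have := is_derive_comp1 (@is_derive_coord R n i i x) (dPhi (x ord0 i)).
  by rewrite eqxx mulr1.
have d2 : is_derive x (e i)
    (fun y : 'rV[R]_n => \prod_(j | j != i) psi j (y ord0 j)) 0.
  apply/is_derive_line.
  have -> : (fun h : R => \prod_(j | j != i) psi j ((h *: e i + x) ord0 j)) =
      fun=> \prod_(j | j != i) psi j (x ord0 j); last exact: is_derive_cst.
  apply/funext => h; apply: eq_bigr => j ji.
  by rewrite !mxE (negPf ji) andbF mulr0 add0r.
have := is_derive_mul d1 d2.
by rewrite mulr0 add0r mulrC prodfun_upd.
Qed.

Definition pairing h psi : R :=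
  (\int[leb R n]_(x in Om) (h x * prodfun psi x))%R.

Let mO := open_lebesgue_measurable oO.

Lemma pairing_integrable h psi : in_L1loc Om h -> bumps psi ->
  (leb R n).-integrable (Om : set (lebesgue_space R n))
    (EFin \o (fun x => h x * prodfun psi x)).
Proof.
by move=> hh bp; apply: (test_integrableM oO hh); exact: prodfun_test.
Qed.

(** The combination of psi i and rho that has integral zero is the derivative
    of a bump, so that its product with the other factors is a partial
    derivative of a test function. *)
Lemma pairing_upd h psi i (rho : R -> R) : in_L1loc Om h ->
  (forall zeta j, test_function Om zeta ->
    (\int[leb R n]_(x in Om) (h x * partial j zeta x)%:E = 0)%E) ->
  bumps psi -> @bump_fun R n (a ord0 i) (b ord0 i) rho ->
  (\int[mu]_t rho t)%R * pairing h psi =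
  (\int[mu]_t psi i t)%R * pairing h (upd psi i rho).
Proof.
move=> hh H bp br.
set r := (\int[mu]_t rho t)%R; set s := (\int[mu]_t psi i t)%R.
pose phi t := r * psi i t + (- s) * rho t.
have bphi : @bump_fun R n (a ord0 i) (b ord0 i) phi by exact: bump_lin.
have I0 : (\int[mu]_t phi t)%R = 0.
  rewrite (@bump_Rintegral_lin R n (a ord0 i) (b ord0 i))// -/r -/s; lra.
have [Phi [bPhi dPhi]] := bump_antiderivative bphi I0.
have := H _ i (prodfun_test (bumps_upd bp bPhi)).
under eq_integral do rewrite (partial_prodfun_upd _ _ _ dPhi).
move=> K; have {}K : pairing h (upd psi i phi) = 0 by rewrite /pairing /Rintegral K.
have E : pairing h (upd psi i phi) = r * pairing h psi - s * pairing h (upd psi i rho).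
  have bur := bumps_upd bp br.
  rewrite /pairing -!RintegralZl//; try exact: pairing_integrable.
  rewrite -RintegralB//.
  - apply: eq_Rintegral => x _.
    rewrite !prodfun_upd (prodfunE psi i) /phi; ring.
  - apply: eq_integrable (integrableZl mO r (pairing_integrable hh bp)) => //.
  - apply: eq_integrable (integrableZl mO s (pairing_integrable hh bur)) => //.
by apply/eqP; rewrite -subr_eq0 -E K.
Qed.

Lemma pairing_mix h psi rho (s : seq 'I_n) : in_L1loc Om h ->
  (forall zeta j, test_function Om zeta ->
    (\int[leb R n]_(x in Om) (h x * partial j zeta x)%:E = 0)%E) ->
  bumps psi -> bumps rho -> uniq s ->
  (\prod_(i <- s) (\int[mu]_t rho i t)%R) * pairing h psi =
  (\prod_(i <- s) (\int[mu]_t psi i t)%R) *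
    pairing h (fun i => if i \in s then rho i else psi i).
Proof.
move=> hh H bp br; elim: s => [_|j s IH /= /andP[js us]].
  by rewrite !big_nil.
rewrite !big_cons -!mulrA (IH us) mulrCA [RHS]mulrCA; congr (_ * _).
pose m i := if i \in s then rho i else psi i.
have bm : bumps m by move=> i; rewrite /m; case: ifP.
rewrite -/m (pairing_upd hh H bm (br j)).
rewrite {1}/m (negPf js); congr (_ * _); congr (pairing h _).
apply/funext => i; rewrite /upd /m in_cons.
by case: eqP => [->|].
Qed.

(** The factors are replaced one at a time. A functional that annihilates all
    partial derivatives thus sees nothing of a product but the integrals of
    its factors. *)
Lemma pairing_prod h psi rho : in_L1loc Om h ->
  (forall zeta j, test_function Om zeta ->
    (\int[leb R n]_(x in Om) (h x * partial j zeta x)%:E = 0)%E) ->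
  bumps psi -> bumps rho ->
  (\prod_i (\int[mu]_t rho i t)%R) * pairing h psi =
  (\prod_i (\int[mu]_t psi i t)%R) * pairing h rho.
Proof.
move=> hh H bp br.
rewrite (pairing_mix hh H bp br (index_enum_uniq _)); congr (_ * pairing h _).
by apply/funext => i; rewrite mem_index_enum.
Qed.

End product_bumps.

(** * From product bumps to boxes, and from boxes to measurable sets *)

Section box_limits.
Context {R : realType}.

Lemma cvg_prod_seq (I : Type) (s : seq I) (f : I -> R^nat) (l : I -> R) :
  (forall i, f i k @[k --> \oo] --> l i) ->
  (\prod_(i <- s) f i k) @[k --> \oo] --> \prod_(i <- s) l i.
Proof.
move=> fl; elim: s => [|i s IH].
  by under eq_fun do rewrite big_nil; rewrite big_nil; exact: cvg_cst.
under eq_fun do rewrite big_cons; rewrite big_cons.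
by apply: cvgM.
Qed.

Lemma cvg_invn0 : (k.+1%:R : R)^-1 @[k --> \oo] --> (0 : R).
Proof. exact: cvg_harmonic. Qed.

Lemma flat0_cvg (y : R) :
  flat 0 (k.+1%:R * y) @[k --> \oo] --> ((0 < y)%R%:R : R).
Proof.
have [y0|y0] := ltP 0 y; last first.
  rewrite (_ : (fun k => _) = fun=> 0); first exact: cvg_cst.
  by apply/funext => k; rewrite flat_neg// mulr_ge0_le0.
rewrite (_ : (fun k => _) = fun k => expR (- (y^-1 * k.+1%:R^-1))); last first.
  apply/funext => k; rewrite flat_pos ?mulr_gt0//.
  by rewrite expr0 mul1r invfM mulrC.
rewrite (_ : true%:R = expR (0 : R)); last by rewrite expR0.
have H : (- (y^-1 * k.+1%:R^-1)) @[k --> \oo] --> (0 : R).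
  rewrite -oppr0; apply: cvgN; rewrite -(mulr0 y^-1).
  by apply: cvgM; [exact: cvg_cst|exact: cvg_invn0].
exact: (cvg_comp _ _ H (@continuous_expR R 0)).
Qed.

Lemma flat_bump_cvg (al be t : R) :
  flat_bump al be k.+1%:R t @[k --> \oo] --> ((al < t < be)%R%:R : R).
Proof.
rewrite -mulnb natrM -(subr_gt0 al) -(subr_gt0 t).
by apply: cvgM; exact: flat0_cvg.
Qed.

Lemma prodfun_flat_bump_cvg n (al be x : 'rV[R]_n) :
  prodfun (fun i => flat_bump (al ord0 i) (be ord0 i) k.+1%:R) x @[k --> \oo]
    --> (\1_(open_box al be) x : R).
Proof.
have -> : (\1_(open_box al be) x : R) =
    \prod_i (al ord0 i < x ord0 i < be ord0 i)%R%:R.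
  rewrite indicE; have [xb|xb] := boolP (x \in open_box al be).
    by rewrite big1// => i _; move: xb => /[1!inE] /(_ i) ->.
  have [i hi] : exists i, ~ (al ord0 i < x ord0 i < be ord0 i).
    by apply/existsNP => h; move/negP: xb; apply; rewrite inE.
  by rewrite (bigD1 i)//= (negPf (introN idP hi)) mul0r.
by apply: cvg_prod_seq => i; exact: flat_bump_cvg.
Qed.

Lemma prodfun_flat_bump01 n (al be x : 'rV[R]_n) (k : R) :
  0 <= prodfun (fun i => flat_bump (al ord0 i) (be ord0 i) k) x <= 1.
Proof.
rewrite /prodfun; apply/andP; split.
  by apply: prodr_ge0 => i _; exact: flat_bump_ge0.
by apply: Num.Theory.prodr_ile1 => i _; rewrite flat_bump_ge0 flat_bump_le1.
Qed.

Lemma bumps_flat n (a b al be : 'rV[R]_n) (k : R) : 0 <= k ->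
  (forall i, a ord0 i <= al ord0 i) -> (forall i, be ord0 i <= b ord0 i) ->
  bumps a b (fun i => flat_bump (al ord0 i) (be ord0 i) k).
Proof. by move=> k0 aal beb i; exact: bump_flat. Qed.

End box_limits.

Section lebesgue_hull.
Context {R : realType} {n : nat}.
Local Open Scope ereal_scope.

(** The outer measure is an infimum over countable Borel covers; the hull is
    the intersection of covers that are optimal up to 1/(m+1). *)
Lemma borel_hull (E : set 'rV[R]_n) :
  measurable (E : set (lebesgue_space R n)) -> leb R n E < +oo ->
  exists B : set 'rV[R]_n, [/\ measurable B, E `<=` B & leb R n (B `\` E) = 0].
Proof.
move=> mE Eoo.
have Efin : leb R n E \is a fin_num by rewrite ge0_fin_numE.
have /choice[F HF] (m : nat) : exists B : set 'rV[R]_n,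
    [/\ measurable B, E `<=` B & leb R n B <= leb R n E + (m.+1%:R^-1)%:E].
  have [|_ [F [mF EF] <-] HF] := @lb_ereal_inf_adherent _ _ (m.+1%:R^-1) _ Efin.
    by rewrite invr_gt0.
  exists (\bigcup_k F k); split => //; first exact: bigcupT_measurable.
  rewrite leb_borelE; last exact: bigcupT_measurable.
  apply: le_trans (ltW HF).
  by apply: measure_sigma_subadditive => //; exact: bigcupT_measurable.
pose B := \bigcap_m F m.
have mB : measurable B by apply: bigcapT_measurable => m; have [] := HF m.
have EB : E `<=` B by move=> x Ex m _; have [_ H _] := HF m; exact: H.
exists B; split => //.
have mB' := borel_lebesgue_measurable mB.
have BE : leb R n B <= leb R n E.
  apply/lee_addgt0Pr => e e0.
  have [m _ me] := @near_infty_natSinv_lt R (PosNum e0).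
  have [mF _ H] := HF m.
  apply: (le_trans (y := leb R n (F m))).
    apply: le_measure; rewrite ?inE//; first exact: borel_lebesgue_measurable.
    by move=> x; exact.
  apply: le_trans H _; rewrite leeD2l// lee_fin ltW//.
  by apply: (me m); rewrite /=.
rewrite measureD//; last exact: le_lt_trans Eoo.
rewrite (setIidr EB); apply/eqP; rewrite eq_le; apply/andP; split.
  by rewrite leeBlDr// add0e.
by rewrite leeBrDr// add0e; apply: le_measure; rewrite ?inE.
Qed.

End lebesgue_hull.

Section box_generation.
Context {R : realType} {n : nat}.

Definition open_boxes : set (set 'rV[R]_n) :=
  [set A | exists al be, A = open_box al be].

Lemma open_boxes_setI : setI_closed open_boxes.
Proof.
move=> _ _ [a1 [b1 ->]] [a2 [b2 ->]].
exists (\row_i Num.max (a1 ord0 i) (a2 ord0 i)),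
  (\row_i Num.min (b1 ord0 i) (b2 ord0 i)).
apply/seteqP; split => x.
  move=> [h1 h2] i; rewrite !mxE gt_max lt_min.
  by move: (h1 i) (h2 i) => /andP[-> ->] /andP[-> ->].
move=> h; split => i; have := h i; rewrite !mxE gt_max lt_min.
  by move=> /andP[/andP[-> _] /andP[-> _]].
by move=> /andP[/andP[_ ->] /andP[_ ->]].
Qed.

Lemma open_g_boxes (U : set 'rV[R]_n) : open U -> (<<s open_boxes >>) U.
Proof.
move=> oU.
have E : U = \bigcup_q (if `[< rat_box q `<=` U >] then
    @rat_box R n q else set0).
  apply/seteqP; split => [x Ux|x [q _]].
    have [q [qx qU]] := nbhs_rat_box (open_nbhs_nbhs (conj oU Ux)).
    by exists q => //; case: asboolP.
  by case: asboolP => // h /h.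
rewrite E.
apply: (@countable_bigcupT_measurable _ (g_sigma_algebraType open_boxes)).
  exact: countableP.
move=> q; case: ifP => _; last exact: measurable0.
by apply: sub_sigma_algebra; exists (map_mx ratr q.1), (map_mx ratr q.2).
Qed.

Lemma measurable_rV_boxes : @measurable _ 'rV[R]_n = <<s open_boxes >>.
Proof.
apply/seteqP; split; last first.
  apply: smallest_sub; first exact: sigma_algebra_measurable.
  by move=> _ [al [be ->]]; exact: measurable_open_box.
have mid : measurable_fun [set: g_sigma_algebraType open_boxes]
    (id : g_sigma_algebraType open_boxes -> 'rV[R]_n).
  apply: measurable_fun_rV => i mT.
  apply: (measurability _ (RGenOInfty.measurableE R)) => //.
  move=> _ [_ [c ->] <-]; rewrite setTI; apply: open_g_boxes.
  by apply: open_comp => [x _|]; [exact: coord_continuous|exact: rray_open].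
by move=> A mA; have := mid measurableT A mA; rewrite setTI preimage_id.
Qed.

End box_generation.

(** * The fundamental lemma of the calculus of variations *)

Section fundamental_lemma.
Context {R : realType} {n : nat}.
Variables (Om : set 'rV[R]_n) (a b : 'rV[R]_n) (h : 'rV[R]_n -> R).
Hypotheses (oO : open Om) (abO : closed_box a b `<=` Om) (hh : in_L1loc Om h).
Hypothesis h0 : forall psi, bumps a b psi -> pairing Om h psi = 0.
Local Notation mu := (leb R n).
Local Notation T := (lebesgue_space R n).
Local Open Scope ereal_scope.

Implicit Types (al be : 'rV[R]_n).

Let mO : measurable (Om : set T) := open_lebesgue_measurable oO.

Let mK : measurable (closed_box a b : set T).
Proof. by apply: borel_lebesgue_measurable; exact: measurable_closed_box. Qed.

Let sub_box al be : (forall i, a ord0 i <= al ord0 i)%R ->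
  (forall i, be ord0 i <= b ord0 i)%R -> open_box al be `<=` closed_box a b.
Proof.
move=> aal beb x hx i; have /andP[h1 h2] := hx i.
by rewrite (le_trans (aal i) (ltW h1)) (le_trans (ltW h2) (beb i)).
Qed.

Let mbox al be : measurable (open_box al be : set T).
Proof. by apply: borel_lebesgue_measurable; exact: measurable_open_box. Qed.

Let hK : mu.-integrable (closed_box a b : set T) (EFin \o h).
Proof.
have [mh Hh] := hh; apply/integrableP; split.
  by apply/measurable_EFinP; exact: measurable_funS mh.
by apply: Hh => //; exact: closed_box_compact.
Qed.

Let integral_box0 al be : (forall i, a ord0 i <= al ord0 i)%R ->
  (forall i, be ord0 i <= b ord0 i)%R ->
  \int[mu]_(x in open_box al be) (h x)%:E = 0.
Proof.
move=> aal beb.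
pose psi (k : nat) (i : 'I_n) := flat_bump (al ord0 i) (be ord0 i) k.+1%:R.
have bpsi k : bumps a b (psi k) by apply: bumps_flat.
have mhK : measurable_fun (closed_box a b : set T) h.
  by apply: measurable_funS (hh.1).
have mpsi k : measurable_fun (closed_box a b : set T) (prodfun (psi k)).
  apply: measurable_funS mO abO _; apply: continuous_lmeasurable => //.
  by apply: smooth_continuous; exact: prodfun_smooth (bpsi k).
have m1 : measurable_fun (closed_box a b : set T)
    (\1_(open_box al be : set T) : T -> R).
  by apply: measurable_funTS; exact: measurable_indic.
have cv : {ae mu, forall x, closed_box a b x ->
    (h x * prodfun (psi k) x)%:E @[k --> \oo] -->
    (h x * \1_(open_box al be) x)%:E}.
  apply: aeW => x _; apply: cvg_EFin; first exact: nearW.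
  by apply: cvgM; [exact: cvg_cst|exact: prodfun_flat_bump_cvg].
have dom : {ae mu, forall x k, closed_box a b x ->
    `|(h x * prodfun (psi k) x)%:E| <= `|h x|%:E}.
  apply: aeW => x k _; rewrite lee_fin normrM ler_piMr//.
  have /andP[p0 p1] := prodfun_flat_bump01 al be x k.+1%:R.
  by rewrite ger0_norm.
have [_ _ L] := @dominated_convergence _ T R mu (closed_box a b) mK
  (fun k x => (h x * prodfun (psi k) x)%:E)
  (fun x => (h x * \1_(open_box al be) x)%:E)
  (fun x => `|h x|%:E)
  (fun k => (measurable_EFinP _ _).2 (measurable_funM mhK (mpsi k)))
  ((measurable_EFinP _ _).2 (measurable_funM mhK m1))
  cv (integrable_norm hK) dom.
have I0 k : \int[mu]_(x in closed_box a b) (h x * prodfun (psi k) x)%:E = 0.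
  have := h0 (bpsi k); rewrite /pairing /Rintegral => E.
  have fi := pairing_integrable oO abO hh (bpsi k).
  have : \int[mu]_(x in Om) (h x * prodfun (psi k) x)%:E = 0.
    rewrite -[LHS]fineK; first by congr (_%:E).
    exact: integrable_fin_num fi.
  move=> OE; rewrite -[RHS]OE integral_mkcond [RHS]integral_mkcond.
  apply: eq_integral => x _; rewrite !patchE.
  case: ifPn => [/[1!inE]/abO xO|/negP xK]; first by rewrite mem_set.
  by case: ifPn => // _; rewrite (prodfun_out (bpsi k)) ?mulr0// => xK'; apply: xK; rewrite inE.
have {}L : (fun=> 0 : \bar R) @ \oo -->
    \int[mu]_(x in closed_box a b) (h x * \1_(open_box al be) x)%:E.
  by move: L; under eq_fun do rewrite I0.
have <- : \int[mu]_(x in closed_box a b) (h x * \1_(open_box al be) x)%:E =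
    \int[mu]_(x in open_box al be) (h x)%:E.
  rewrite integral_mkcond [RHS]integral_mkcond; apply: eq_integral => x _.
  rewrite !patchE indicE; case: ifPn => xK.
    by case: ifPn => _; rewrite ?mulr1 ?mulr0.
  case: ifPn => // /[1!inE] /(sub_box aal beb) xK'.
  by move/negP: xK; case; rewrite inE.
by apply/esym; apply: cvg_unique L; [exact: ereal_hausdorff|exact: cvg_cst].
Qed.

Let hQ : mu.-integrable (open_box a b : set T) (EFin \o h).
Proof. by apply: integrableS hK => //; exact: sub_box. Qed.

Let integral_borel0 (S : set 'rV[R]_n) : measurable S ->
  \int[mu]_(x in S `&` open_box a b) (h x)%:E = 0.
Proof.
rewrite measurable_rV_boxes.
pose P (S : set 'rV[R]_n) := \int[mu]_(x in S `&` open_box a b) (h x)%:E = 0.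
have mI (A : set 'rV[R]_n) : measurable A ->
    measurable (A `&` open_box a b : set T).
  by move=> mA; apply: measurableI => //; exact: borel_lebesgue_measurable.
apply: (@dynkin_induction _ 'rV[R]_n open_boxes P measurable_rV_boxes
  open_boxes_setI) => //.
- by rewrite /P setTI; exact: integral_box0.
- move=> _ [al [be ->]]; rewrite /P.
  rewrite (_ : _ `&` _ = open_box (\row_i Num.max (al ord0 i) (a ord0 i))
    (\row_i Num.min (be ord0 i) (b ord0 i))).
    apply: integral_box0 => i; rewrite mxE; first by rewrite le_max lexx orbT.
    by rewrite ge_min lexx orbT.
  apply/seteqP; split => x.
    move=> [h1 h2] i; rewrite !mxE gt_max lt_min.
    by move: (h1 i) (h2 i) => /andP[-> ->] /andP[-> ->].
  move=> hx; split => i; have := hx i; rewrite !mxE gt_max lt_min.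
    by move=> /andP[/andP[-> _] /andP[-> _]].
  by move=> /andP[/andP[_ ->] /andP[_ ->]].
- move=> A mA PA; have Q0 := integral_box0 (fun i => lexx _) (fun i => lexx _).
  move: Q0; rewrite -[X in \int[_]_(x in X) _](setTI (open_box a b)).
  rewrite -(setUv A) setIUl integral_setU.
  + by rewrite PA add0e.
  + exact: mI.
  + by apply: mI; exact: measurableC.
  + by rewrite -setIUl setUv setTI; exact: measurable_int hQ.
  + by apply/disj_setPS => x [[Ax _] [nAx _]]; exact: nAx.
- move=> F mF tF PF; rewrite /P setI_bigcupl integral_bigcup.
  + by apply: eseries0 => k _ _; exact: PF.
  + by apply: trivIset_setIr.
  + by move=> k; exact: mI.
  + apply: integrableS hQ => //.
      by apply: bigcupT_measurable => k; exact: mI.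
    by move=> x [k _ []].
Qed.

(** Products of bumps approximate the indicator functions of boxes, boxes
    generate the Borel sets, and a Lebesgue measurable set differs from its
    Borel hull by a null set: hence h has integral zero over every measurable
    subset of the box. *)
Lemma orthogonal_bumps_ae0 :
  {ae mu, forall x, open_box a b x -> h x = 0%R}.
Proof.
have : ae_eq mu (open_box a b) (EFin \o h) (cst 0).
  apply: integral_ae_eq => //.
  move=> E EQ mE; rewrite integral0.
  have Eoo : mu E < +oo.
    apply: le_lt_trans (leb_open_box_lty a b).
    by apply: le_measure; rewrite ?inE.
  have [B [mB EB BE0]] := borel_hull mE Eoo.
  have mB' := borel_lebesgue_measurable mB.
  rewrite -(integral_borel0 mB).
  have BQ : B `&` open_box a b = E `|` ((B `&` open_box a b) `\` E).
    by rewrite setDUK// => x Ex; split; [exact: EB|exact: EQ].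
  have mD : measurable ((B `&` open_box a b) `\` E : set T).
    by apply: measurableD => //; exact: measurableI.
  have dE : [disjoint E & (B `&` open_box a b) `\` E]%classic.
    by apply/disj_setPS => x [Ex [_]]; apply.
  have mh : measurable_fun (E `|` ((B `&` open_box a b) `\` E) : set T)
      (EFin \o h).
    by rewrite -BQ; apply: measurable_funS (measurable_int _ hQ).
  rewrite BQ (integral_setU mu mE mD mh dE).
  rewrite (@null_set_integral _ T R mu ((B `&` open_box a b) `\` E))//.
    + by rewrite adde0.
    + apply: measurable_funS (measurable_int _ hQ) => //.
      by move=> x [[]].
    + apply/eqP; rewrite eq_le measure_ge0 andbT -BE0.
      apply: le_measure; rewrite ?inE//; first exact: measurableD.
      by move=> x [[? _] ?].
by apply: filterS => x H Qx; have [] := H Qx.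
Qed.

End fundamental_lemma.

(** * Functions without distributional derivatives *)

Section weakly_constant.
Context {R : realType} {n : nat}.
Implicit Types (Om : set 'rV[R]_n) (f g h : 'rV[R]_n -> R).
Local Notation mu := (leb R n).

Lemma leb_ae_mono (P Q : 'rV[R]_n -> Prop) : (forall x, P x -> Q x) ->
  {ae mu, forall x, P x} -> {ae mu, forall x, Q x}.
Proof. by move=> PQ; apply: negligibleS => x /= nQ Px; apply: nQ; exact: PQ. Qed.

Lemma leb_ae_mono2 (P P' Q : 'rV[R]_n -> Prop) :
  (forall x, P x -> P' x -> Q x) ->
  {ae mu, forall x, P x} -> {ae mu, forall x, P' x} -> {ae mu, forall x, Q x}.
Proof.
move=> PQ h1 h2; apply: negligibleS (negligibleU h1 h2) => x /= nQ.
apply: contrapT => /not_orP[/contrapT Px /contrapT Px']; apply: nQ; exact: PQ.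
Qed.

Lemma in_L1loc_integrable Om h (K : set 'rV[R]_n) : open Om -> in_L1loc Om h ->
  compact K -> K `<=` Om ->
  mu.-integrable (K : set (lebesgue_space R n)) (EFin \o h).
Proof.
move=> oO [mh Hh] cK KO; apply/integrableP; split; last exact: Hh.
apply/measurable_EFinP; apply: measurable_funS mh => //.
exact: open_lebesgue_measurable.
Qed.

Lemma in_L1loc_lin Om f g (c d : R) : open Om -> in_L1loc Om f ->
  in_L1loc Om g -> in_L1loc Om (fun x => c * f x + d * g x).
Proof.
move=> oO hf hg.
have [mf _] := hf; have [mg _] := hg; split.
  by apply: measurable_funD; apply: measurable_funM => //; exact: measurable_cst.
move=> K cK KO.
have mK : measurable (K : set (lebesgue_space R n)).
  by apply: borel_lebesgue_measurable; exact: compact_measurable_rV.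
have fi := in_L1loc_integrable oO hf cK KO.
have gi := in_L1loc_integrable oO hg cK KO.
have /integrableP[_] := integrableD mK (integrableZl mK c fi) (integrableZl mK d gi).
by [].
Qed.

(** Lindelof's argument: countably many rational boxes suffice. *)
Lemma ae_in_cover Om (P : 'rV[R]_n -> Prop) :
  (forall x, Om x -> exists a b, open_box a b x /\
     {ae mu, forall y, open_box a b y -> P y}) -> ae_in Om P.
Proof.
move=> H.
pose good (q : 'rV[rat]_n * 'rV[rat]_n) :=
  {ae mu, forall y, @rat_box R n q y -> P y}.
pose F (k : nat) : set (lebesgue_space R n) :=
  if unpickle k is Some q then
    if `[< good q >] then [set y | ~ (@rat_box R n q y -> P y)] else set0
  else set0.
have F0 k : mu.-negligible (F k).
  rewrite /F; case: unpickle => [q|]; last exact: negligible_set0.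
  by case: asboolP => [gq|_]; [exact: gq|exact: negligible_set0].
apply: negligibleS (negligible_bigcup F0) => x /= /not_implyP[Ox nPx].
have [a [b [abx ae]]] := H x Ox.
have [q [qx qab]] := nbhs_rat_box (open_nbhs_nbhs (conj (@open_box_open R n a b) abx)).
exists (pickle q) => //; rewrite /F pickleK.
case: asboolP => [_|]; first by move=> /= /(_ qx).
by case; apply: leb_ae_mono ae => y h /qab; exact: h.
Qed.

Lemma pairing_lin Om a b f g (c d : R) psi : open Om -> closed_box a b `<=` Om ->
  in_L1loc Om f -> in_L1loc Om g -> bumps a b psi ->
  pairing Om (fun x => c * f x + d * g x) psi =
  c * pairing Om f psi + d * pairing Om g psi.
Proof.
move=> oO abO hf hg bp; have mO := open_lebesgue_measurable oO.
have fi := pairing_integrable oO abO hf bp.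
have gi := pairing_integrable oO abO hg bp.
rewrite /pairing -!RintegralZl// -RintegralD//.
- by apply: eq_Rintegral => x _; ring.
- exact: eq_integrable (integrableZl mO c fi).
- exact: eq_integrable (integrableZl mO d gi).
Qed.

Lemma nbhs_box Om x : open Om -> Om x ->
  exists a b, [/\ open_box a b x, closed_box a b `<=` Om &
    forall i, a ord0 i < b ord0 i].
Proof.
move=> oO Ox; have [a [b [abx abO]]] := nbhs_closed_box (open_nbhs_nbhs (conj oO Ox)).
exists a, b; split => // i; by have /andP[] := abx i; exact: lt_trans.
Qed.

(** The fundamental lemma of the calculus of variations; locally, products of
    bumps are enough test functions. *)
Lemma orthogonal_test_ae0 Om h : open Om -> in_L1loc Om h ->
  (forall zeta, test_function Om zeta ->
    (\int[mu]_(x in Om) (h x * zeta x)%:E = 0)%E) ->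
  ae_in Om (fun x => h x = 0).
Proof.
move=> oO hh H; apply: ae_in_cover => x Ox.
have [a [b [abx abO _]]] := nbhs_box oO Ox; exists a, b; split => //.
apply: (orthogonal_bumps_ae0 oO abO hh) => psi bp.
by rewrite /pairing /Rintegral H//; exact: prodfun_test bp.
Qed.

(** Subtract from g the constant that has the same pairing with one fixed
    product of bumps; by pairing_prod the difference is then orthogonal to all
    products of bumps. *)
Lemma weakly_constant_box Om g a b : open Om -> closed_box a b `<=` Om ->
  (forall i, a ord0 i < b ord0 i) -> in_L1loc Om g ->
  (forall zeta j, test_function Om zeta ->
    (\int[mu]_(x in Om) (g x * partial j zeta x)%:E = 0)%E) ->
  exists c, {ae mu, forall x, open_box a b x -> g x = c}.
Proof.
move=> oO abO ab hg H; have mO := open_lebesgue_measurable oO.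
pose rho i := flat_bump (a ord0 i) (b ord0 i) 1.
have br : bumps a b rho by apply: bumps_flat.
have h1 := in_L1loc_cst 1 oO.
have H1 zeta j : test_function Om zeta ->
    (\int[mu]_(x in Om) ((fun=> 1) x * partial j zeta x)%:E = 0)%E.
  by move=> tz; under eq_integral do rewrite mul1r; exact: test_integral_partial0.
have [x abx] : exists x, open_box a b x.
  exists (\row_i ((a ord0 i + b ord0 i) / 2)) => i; rewrite mxE; have := ab i; lra.
have P1 : 0 < pairing Om (fun=> 1) rho.
  have fi := pairing_integrable oO abO h1 br.
  rewrite /pairing /Rintegral fine_gt0//; apply/andP; split; last first.
    have := integrable_fin_num mO fi; rewrite fin_numE => /andP[_].
    by rewrite ltey.
  apply: (@integral_gt0_pos _ _ R mu Om (open_box a b) _ mO (measurable_int _ fi)).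
  - move=> y _; rewrite lee_fin mul1r.
    by have /andP[] := prodfun_flat_bump01 a b y 1.
  - by apply: borel_lebesgue_measurable; exact: measurable_open_box.
  - move=> y aby; apply: abO => i; have /andP[h2 h3] := aby i; by rewrite !ltW.
  - move=> y aby; rewrite lte_fin mul1r; apply: prodr_gt0 => i _.
    exact: flat_bump_gt0.
  - exact: leb_open_box_gt0 abx.
(* The constant is the mean of g with respect to the density prodfun rho. *)
pose c := pairing Om g rho / pairing Om (fun=> 1) rho.
exists c.
have hgc : in_L1loc Om (fun x => 1 * g x + (- c) * (fun=> 1) x).
  exact: in_L1loc_lin.
have : {ae mu, forall x, open_box a b x -> 1 * g x + (- c) * (fun=> 1) x = 0}.
  apply: (orthogonal_bumps_ae0 oO abO hgc) => psi bp.
  rewrite (pairing_lin _ _ oO abO hg h1 bp) mul1r.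
  have E1 := pairing_prod oO abO hg H bp br.
  have E2 := pairing_prod oO abO h1 H1 bp br.
  have A0 : 0 < \prod_i (\int[lebesgue_measure]_t rho i t)%R.
    by apply: prodr_gt0 => i _; apply: (@flat_bump_Rintegral_gt0 R n); exact: ab.
  apply: (mulfI (lt0r_neq0 A0)); rewrite mulr0 mulrDr E1 mulrCA E2 /c.
  by field; rewrite gt_eqF.
by apply: leb_ae_mono => y Hy /Hy; lra.
Qed.

Lemma two_boxes_constant (a b a' b' y : 'rV[R]_n) g (c c' : R) :
  open_box a b y -> open_box a' b' y ->
  {ae mu, forall x, open_box a b x -> g x = c} ->
  {ae mu, forall x, open_box a' b' x -> g x = c'} -> c = c'.
Proof.
move=> aby aby' ae1 ae2; apply: contrapT => cc'.
have [z [w E]] := open_boxes_setI (ex_intro _ a (ex_intro _ b erefl))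
  (ex_intro _ a' (ex_intro _ b' erefl)).
have zwy : open_box z w y by rewrite -E.
have : mu (open_box z w) = 0%E.
  apply: measure_negligible.
    by apply: borel_lebesgue_measurable; exact: measurable_open_box.
  have : {ae mu, forall x, ~ open_box z w x}.
    apply: leb_ae_mono2 ae1 ae2 => x h1 h2; rewrite -E => -[/h1 e1 /h2 e2].
    by apply: cc'; rewrite -e1 -e2.
  by apply: negligibleS => x /= zx; apply.
by apply/eqP; rewrite gt_eqF//; exact: leb_open_box_gt0 zwy.
Qed.

(** If two boxes meet, then they do so in a box, which has positive measure,
    so that their constants agree. The points around which the constant is a
    given one therefore form a set that is open and closed in Om. *)
Lemma weakly_constant Om g : open Om -> connected Om -> Om !=set0 ->
  in_L1loc Om g ->
  (forall zeta j, test_function Om zeta ->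
    (\int[mu]_(x in Om) (g x * partial j zeta x)%:E = 0)%E) ->
  exists c, ae_in Om (fun x => g x = c).
Proof.
move=> oO cO [x0 Ox0] hg H.
have loc x : Om x -> exists a b c, [/\ open_box a b x, open_box a b `<=` Om &
    {ae mu, forall y, open_box a b y -> g y = c}].
  move=> Ox; have [a [b [abx abO ab]]] := nbhs_box oO Ox.
  have [c Hc] := weakly_constant_box oO abO ab hg H.
  exists a, b, c; split => // y aby; apply: abO => i.
  by have /andP[h2 h3] := aby i; rewrite !ltW.
have [a0 [b0 [c0 [abx0 abO0 Hc0]]]] := loc _ Ox0.
exists c0.
pose U := [set x | exists a b, [/\ open_box a b x, open_box a b `<=` Om &
    {ae mu, forall y, open_box a b y -> g y = c0}]].
have UO : U `<=` Om by move=> x [a [b [abx + _]]]; exact.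
have box_nbhs (a b x : 'rV[R]_n) : open_box a b x -> nbhs x (open_box a b).
  by move=> abx; apply: open_nbhs_nbhs; split => //; exact: open_box_open.
have oU : open U.
  rewrite openE => x [a [b [abx abO Hab]]].
  by apply: filterS (box_nbhs _ _ _ abx) => y aby; exists a, b.
have oV : open (Om `\` U).
  rewrite openE => x [Ox nUx]; have [a [b [c [abx abO Hab]]]] := loc x Ox.
  apply: filterS (box_nbhs _ _ _ abx) => y aby; split; first exact: abO.
  move=> [a' [b' [aby' abO' Hab']]]; apply: nUx; exists a, b; split => //.
  by rewrite -(two_boxes_constant aby aby' Hab Hab').
have UE : U = Om.
  apply: cO; first by exists x0, a0, b0.
    by exists U => //; rewrite setIidr.
  exists (~` (Om `\` U)); first exact: open_closedC.
  apply/seteqP; split => x.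
    by move=> Ux; split; [exact: UO|case].
  by move=> [Ox nV]; apply: contrapT => nU; apply: nV.
apply: ae_in_cover => x; rewrite -[X in X x -> _]UE => -[a [b [abx _ Hab]]].
by exists a, b.
Qed.

End weakly_constant.

(** * Hidden convexity of the p-th power of the Euclidean norm *)

Section euclidean_norm.
Context {R : realType} {n : nat}.
Implicit Types (u v : 'rV[R]_n) (c : R).

Lemma dotpC u v : dotp u v = dotp v u.
Proof. by apply: eq_bigr => i _; rewrite mulrC. Qed.

Lemma dotpDl u u' v : dotp (u + u') v = dotp u v + dotp u' v.
Proof. by rewrite -big_split; apply: eq_bigr => i _; rewrite /= mxE mulrDl. Qed.

Lemma dotpZl c u v : dotp (c *: u) v = c * dotp u v.
Proof. by rewrite /dotp mulr_sumr; apply: eq_bigr => i _; rewrite mxE mulrA. Qed.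

Lemma dotp0l u : dotp 0 u = 0.
Proof. by apply: big1 => i _; rewrite mxE mul0r. Qed.

Lemma dotp_ge0 u : 0 <= dotp u u.
Proof. by apply: sumr_ge0 => i _; rewrite -expr2 sqr_ge0. Qed.

Lemma dotp_eq0 u : dotp u u = 0 -> u = 0.
Proof.
move=> /eqP; rewrite psumr_eq0; last by move=> i _; rewrite -expr2 sqr_ge0.
move=> /allP u0; apply/rowP => i; rewrite mxE; apply/eqP.
by have := u0 i (mem_index_enum i); rewrite /= mulf_eq0 orbb.
Qed.

Lemma enorm_ge0 u : 0 <= enorm u.
Proof. exact: sqrtr_ge0. Qed.

Lemma sqr_enorm u : enorm u ^+ 2 = dotp u u.
Proof. by rewrite sqr_sqrtr// dotp_ge0. Qed.

Lemma enormZ c u : enorm (c *: u) = `|c| * enorm u.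
Proof.
rewrite /enorm dotpZl dotpC dotpZl mulrA -expr2 sqrtrM ?sqr_ge0//.
by rewrite sqrtr_sqr.
Qed.

Lemma enorm0 : enorm (0 : 'rV[R]_n) = 0.
Proof. by rewrite /enorm dotp0l sqrtr0. Qed.

Lemma dotp_comb (s t : R) u v : dotp (s *: u + t *: v) (s *: u + t *: v) =
  s ^+ 2 * dotp u u + 2 * s * t * dotp u v + t ^+ 2 * dotp v v.
Proof.
rewrite dotpDl !dotpZl ![dotp _ (_ + _)]dotpC !dotpDl !dotpZl (dotpC v u); ring.
Qed.

Lemma cauchy_schwarz_sqr u v : dotp u v ^+ 2 <= dotp u u * dotp v v.
Proof.
have [v0|v0] := eqVneq (dotp v v) 0.
  by rewrite (dotp_eq0 v0) dotpC !dotp0l expr0n mulr0.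
have vp : 0 < dotp v v by rewrite lt_def v0 dotp_ge0.
have := dotp_ge0 (1 *: u + (- (dotp u v / dotp v v)) *: v); rewrite dotp_comb.
set c := dotp u v; set d := dotp v v; set f := dotp u u => H.
have : 0 <= f - c ^+ 2 / d.
  apply: le_trans H _; rewrite le_eqVlt; apply/orP; left; apply/eqP.
  by field; rewrite gt_eqF.
by rewrite subr_ge0 ler_pdivrMr.
Qed.

Lemma cauchy_schwarz u v : `|dotp u v| <= enorm u * enorm v.
Proof.
rewrite -(@ler_pXn2r _ 2)// ?nnegrE ?mulr_ge0 ?enorm_ge0//.
by rewrite real_normK ?num_real// exprMn !sqr_enorm cauchy_schwarz_sqr.
Qed.

Lemma enormD u v : enorm (u + v) <= enorm u + enorm v.
Proof.
rewrite -(@ler_pXn2r _ 2)// ?nnegrE ?addr_ge0 ?enorm_ge0//.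
rewrite sqr_enorm sqrrD !sqr_enorm -{1 2}(scale1r u) -{1 2}(scale1r v) dotp_comb.
have := le_trans (ler_norm _) (cauchy_schwarz u v).
by rewrite -mulr_natl => H; lra.
Qed.

Lemma le_coord_enorm u i : `|u ord0 i| <= enorm u.
Proof.
rewrite -(@ler_pXn2r _ 2)// ?nnegrE ?enorm_ge0//.
rewrite real_normK ?num_real// sqr_enorm /dotp (bigD1 i)//= -expr2 lerDl.
by apply: sumr_ge0 => j _; rewrite -expr2 sqr_ge0.
Qed.

Lemma enorm_convex_eq (t : R) u v : 0 < t < 1 -> enorm u = enorm v ->
  enorm (t *: u + (1 - t) *: v) = enorm u -> u = v.
Proof.
move=> /andP[t0 t1] uv H; apply/eqP; rewrite -subr_eq0; apply/eqP.
apply: dotp_eq0.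
have : enorm (t *: u + (1 - t) *: v) ^+ 2 = enorm u ^+ 2 by rewrite H.
have : enorm u ^+ 2 = enorm v ^+ 2 by rewrite uv.
have -> : u - v = 1 *: u + (- 1) *: v by rewrite scale1r scaleN1r.
rewrite !sqr_enorm !dotp_comb => E1 E2.
have : t * (1 - t) * (dotp u u + dotp v v - 2 * dotp u v) = 0.
  rewrite -E1 in E2 *.
  have -> : t * (1 - t) * (dotp u u + dotp u u - 2 * dotp u v) =
    dotp u u - (t ^+ 2 * dotp u u + 2 * t * (1 - t) * dotp u v +
      (1 - t) ^+ 2 * dotp u u) by ring.
  by rewrite E2 subrr.
move=> /eqP; rewrite mulf_eq0 mulf_eq0 gt_eqF//= subr_eq0 gt_eqF//= => /eqP.
by rewrite sqrrN !expr1n => H0; lra.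
Qed.

End euclidean_norm.

Section power_convexity.
Context {R : realType}.
Implicit Types (p t x y m : R).

Lemma bernoulli_lt p t : 1 < p -> 0 <= t -> t != 1 ->
  1 + p * (t - 1) < t `^ p.
Proof.
move=> p1 t0 t1; have [->|tn0] := eqVneq t 0.
  by rewrite powR0 ?gt_eqF//; lra.
have tp : 0 < t by rewrite lt_def tn0.
have lt0 : ln t != 0.
  by apply: contra_neq t1 => /eqP; rewrite ln_eq0// => /eqP.
rewrite /powR (negPf tn0).
set y := ln t; have tE : t = expR y by rewrite lnK// posrE.
have h1 : 1 + (p - 1) * y < expR ((p - 1) * y).
  by apply: expR_gt1Dx; rewrite mulf_neq0// gt_eqF//; lra.
have h2 := expR_ge1Dx (- y).
have E1 : expR (p * y) = expR y * expR ((p - 1) * y).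
  by rewrite -expRD; congr expR; ring.
have E2 : expR y * expR (- y) = 1 by rewrite -expRD subrr expR0.
have ey := expR_gt0 y.
have h3 : expR y * (1 + (p - 1) * y) < expR y * expR ((p - 1) * y).
  by rewrite ltr_pM2l.
have h4 : (p - 1) * (expR y * (1 + - y)) <= (p - 1) * (expR y * expR (- y)).
  by rewrite ler_pM2l ?subr_gt0// ler_pM2l.
rewrite E2 in h4; rewrite tE E1; lra.
Qed.

Lemma bernoulli_le p t : 1 < p -> 0 <= t -> 1 + p * (t - 1) <= t `^ p.
Proof.
move=> p1 t0; have [->|t1] := eqVneq t 1; first by rewrite powR1; lra.
exact/ltW/bernoulli_lt.
Qed.

(** Convexity of t^p, p > 1, with its equality case: the tangent at the mean
    lies below the graph and touches it only at the mean. *)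
Lemma powR_mean p t x y : 1 < p -> 0 <= t <= 1 -> 0 <= x -> 0 <= y ->
  (t * x + (1 - t) * y) `^ p <= t * x `^ p + (1 - t) * y `^ p.
Proof.
move=> p1 /andP[t0 t1] x0 y0; set m := _ + _.
have m0 : 0 <= m by rewrite addr_ge0// mulr_ge0//; lra.
have [->|mn0] := eqVneq m 0.
  by rewrite powR0 ?gt_eqF//; [rewrite addr_ge0// mulr_ge0 ?powR_ge0//; lra|lra].
have mp : 0 < m by rewrite lt_def mn0.
have tangent z : 0 <= z -> m `^ p * (1 + p * (z / m - 1)) <= z `^ p.
  move=> z0; have -> : z `^ p = m `^ p * (z / m) `^ p.
    by rewrite -powRM ?divr_ge0// mulrCA divff// mulr1.
  by rewrite ler_pM2l ?powR_gt0// bernoulli_le// divr_ge0.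
have hx : t * (m `^ p * (1 + p * (x / m - 1))) <= t * x `^ p.
  by rewrite ler_wpM2l// tangent.
have hy : (1 - t) * (m `^ p * (1 + p * (y / m - 1))) <= (1 - t) * y `^ p.
  by rewrite ler_wpM2l ?tangent//; lra.
apply: le_trans (lerD hx hy).
rewrite le_eqVlt; apply/orP; left; apply/eqP.
have -> : t * (m `^ p * (1 + p * (x / m - 1))) +
    (1 - t) * (m `^ p * (1 + p * (y / m - 1))) =
    m `^ p * (1 + p * ((t * x + (1 - t) * y) / m - 1)).
  by field; rewrite mn0.
by rewrite -/m divff// subrr mulr0 addr0 mulr1.
Qed.

Lemma powR_mean_eq p t x y : 1 < p -> 0 < t < 1 -> 0 <= x -> 0 <= y ->
  (t * x + (1 - t) * y) `^ p = t * x `^ p + (1 - t) * y `^ p -> x = y.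
Proof.
move=> p1 /andP[t0 t1] x0 y0; set m := _ + _ => E.
have m0 : 0 <= m by rewrite addr_ge0// mulr_ge0//; lra.
apply: contrapT => xy.
have mn0 : m != 0.
  apply/eqP => mz; apply: xy; rewrite /m in mz m0.
  have : 0 <= (1 - t) * y by rewrite mulr_ge0//; lra.
  have : 0 <= t * x by rewrite mulr_ge0//; lra.
  move=> h1 h2; have /eqP : t * x = 0 by lra.
  have /eqP : (1 - t) * y = 0 by lra.
  rewrite !mulf_eq0 subr_eq0 (gt_eqF t1) (gt_eqF t0) /=.
  by move=> /eqP -> /eqP ->.
have mp : 0 < m by rewrite lt_def mn0.
have tangent z : 0 <= z -> m `^ p * (1 + p * (z / m - 1)) <= z `^ p.
  move=> z0; have -> : z `^ p = m `^ p * (z / m) `^ p.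
    by rewrite -powRM ?divr_ge0// mulrCA divff// mulr1.
  by rewrite ler_pM2l ?powR_gt0// bernoulli_le// divr_ge0.
have stangent z : 0 <= z -> z != m ->
    m `^ p * (1 + p * (z / m - 1)) < z `^ p.
  move=> z0 zm; have -> : z `^ p = m `^ p * (z / m) `^ p.
    by rewrite -powRM ?divr_ge0// mulrCA divff// mulr1.
  rewrite ltr_pM2l ?powR_gt0// bernoulli_lt ?divr_ge0//.
  by apply: contra_neq zm => /divr1_eq.
have xm : x != m by apply/eqP => xm; apply: xy; move: xm; rewrite /m; nra.
have hx : t * (m `^ p * (1 + p * (x / m - 1))) < t * x `^ p.
  by rewrite ltr_pM2l// stangent.
have hy : (1 - t) * (m `^ p * (1 + p * (y / m - 1))) <= (1 - t) * y `^ p.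
  by rewrite ler_wpM2l ?tangent//; lra.
have := ltr_leD hx hy; rewrite -E.
have -> : t * (m `^ p * (1 + p * (x / m - 1))) +
    (1 - t) * (m `^ p * (1 + p * (y / m - 1))) =
    m `^ p * (1 + p * ((t * x + (1 - t) * y) / m - 1)).
  by field; rewrite mn0.
by rewrite -/m divff// subrr mulr0 addr0 mulr1 ltxx.
Qed.

End power_convexity.

Section convexity_deficit.
Context {R : realType} {n : nat} (p : R).
Hypothesis p1 : 1 < p.
Implicit Types (P Q : R) (X Y : 'rV[R]_n).

(** With P = |a|^p, X = grad a / a and Q = |b|^p, Y = grad b / b, the vector
    below is the gradient of (|a|^p + |b|^p)^(1/p). *)
Definition mean_grad P Q X Y : 'rV[R]_n :=
  (P + Q) `^ (p^-1 - 1) *: (P *: X + Q *: Y).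

(** Up to the factor P + Q, what is lost in the convexity of |X|^p at the mean
    of X and Y with weights P / (P + Q) and Q / (P + Q). *)
Definition deficit P Q X Y : R :=
  P * enorm X `^ p + Q * enorm Y `^ p - enorm (mean_grad P Q X Y) `^ p.

Let p0 : 0 < p. Proof. by apply: lt_trans p1. Qed.
Let pn0 : p != 0. Proof. by rewrite gt_eqF. Qed.

Lemma mean_gradE P Q X Y : 0 < P -> 0 < Q ->
  enorm (mean_grad P Q X Y) `^ p =
  (P + Q) * enorm ((P / (P + Q)) *: X + (1 - P / (P + Q)) *: Y) `^ p.
Proof.
move=> P0 Q0; have S0 : 0 < P + Q by rewrite addr_gt0.
have -> : mean_grad P Q X Y = ((P + Q) `^ p^-1) *:
    ((P / (P + Q)) *: X + (1 - P / (P + Q)) *: Y).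
  have pi0 : 0 < p^-1 by rewrite invr_gt0.
  rewrite /mean_grad -(mulr_powRB1 (ltW S0) pi0) [X in _ = X *: _]mulrC -[RHS]scalerA; congr (_ *: _).
  rewrite scalerDr !scalerA; congr (_ *: _ + _ *: _).
    by rewrite mulrCA divff ?mulr1// gt_eqF.
  by field; rewrite gt_eqF.
rewrite enormZ ger0_norm ?powR_ge0// powRM ?powR_ge0 ?enorm_ge0//.
by rewrite -powRrM mulVf// powRr1// ltW.
Qed.

Let theta P Q : 0 < P -> 0 < Q -> 0 < P / (P + Q) < 1.
Proof.
move=> P0 Q0; have S0 : 0 < P + Q by rewrite addr_gt0.
by rewrite divr_gt0//= ltr_pdivrMr// mul1r ltrDl.
Qed.

Let deficitE P Q X Y : 0 < P -> 0 < Q -> let t := P / (P + Q) in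
  deficit P Q X Y = (P + Q) * (t * enorm X `^ p + (1 - t) * enorm Y `^ p -
    enorm (t *: X + (1 - t) *: Y) `^ p).
Proof.
move=> P0 Q0 /=; rewrite /deficit mean_gradE//.
by field; rewrite gt_eqF// addr_gt0.
Qed.

Let enorm_comb (t : R) X Y : 0 <= t <= 1 ->
  enorm (t *: X + (1 - t) *: Y) <= t * enorm X + (1 - t) * enorm Y.
Proof.
move=> /andP[t0 t1]; apply: le_trans (enormD _ _) _.
by rewrite !enormZ !ger0_norm// subr_ge0.
Qed.

Lemma deficit_ge0 P Q X Y : 0 < P -> 0 < Q -> 0 <= deficit P Q X Y.
Proof.
move=> P0 Q0; have /andP[t0 t1] := theta P0 Q0.
rewrite deficitE//; apply: mulr_ge0; first by rewrite addr_ge0 ?ltW.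
rewrite subr_ge0.
apply: le_trans (powR_mean p1 _ (enorm_ge0 X) (enorm_ge0 Y)); last first.
  by rewrite (ltW t0) (ltW t1).
apply: ge0_ler_powR; rewrite ?nnegrE ?enorm_ge0 ?(ltW p0)//.
  by rewrite addr_ge0// mulr_ge0 ?enorm_ge0// ?(ltW t0)// subr_ge0 ltW.
by apply: enorm_comb; rewrite (ltW t0) (ltW t1).
Qed.

(** Equality in the scalar convexity inequality forces X and Y to have the
    same norm, and equality in the triangle inequality then forces them to be
    equal. *)
Lemma deficit_eq0 P Q X Y : 0 < P -> 0 < Q -> deficit P Q X Y = 0 -> X = Y.
Proof.
move=> P0 Q0; have /andP[t0 t1] := theta P0 Q0.
have t01 : 0 <= P / (P + Q) <= 1 by rewrite (ltW t0) (ltW t1).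
rewrite deficitE//; set t := P / (P + Q) in t0 t1 t01 *.
move=> /eqP; rewrite mulf_eq0 gt_eqF ?addr_gt0//= subr_eq0 => /eqP E.
have h1 := enorm_comb X Y t01.
have cx0 : 0 <= t * enorm X + (1 - t) * enorm Y.
  by rewrite addr_ge0// mulr_ge0 ?enorm_ge0// ?(ltW t0)// subr_ge0 ltW.
have h2 : enorm (t *: X + (1 - t) *: Y) `^ p <=
    (t * enorm X + (1 - t) * enorm Y) `^ p.
  by apply: ge0_ler_powR; rewrite ?nnegrE ?enorm_ge0 ?(ltW p0).
have h3 := powR_mean p1 t01 (enorm_ge0 X) (enorm_ge0 Y).
have XY : enorm X = enorm Y.
  apply: (@powR_mean_eq _ p t) => //; rewrite ?t0 ?t1 ?enorm_ge0//.
  by apply/eqP; rewrite eq_le h3/= E.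
apply: (@enorm_convex_eq _ _ t) => //; first by rewrite t0 t1.
have : enorm (t *: X + (1 - t) *: Y) `^ p = enorm X `^ p.
  by rewrite -E -XY; ring.
by apply: (powR_injective p0); rewrite nnegrE enorm_ge0.
Qed.

Local Notation q := ((p + 1) / 2).
(** The next three constants are those of the lower bound deficit_low; the
    slope (p + 1) / 2 is chosen strictly between 1 and p. *)
Definition small_ratio : R := (q - 1) / (q * (q + 1)).
Definition low_cst : R := (p - 1) / 4.
Definition high_cst : R := low_cst / ((p - 1) / (2 * p)) `^ p.

Lemma small_ratio_gt0 : 0 < small_ratio.
Proof.
have P1 := p1.
have q1 : 1 < q by lra.
by apply: divr_gt0; [lra|apply: mulr_gt0; lra].
Qed.

Lemma low_cst_gt0 : 0 < low_cst.
Proof. by have P1 := p1; rewrite /low_cst; lra. Qed.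

Lemma high_cst_gt0 : 0 < high_cst.
Proof.
have P1 := p1.
apply: divr_gt0; first exact: low_cst_gt0.
by apply/powR_gt0/divr_gt0; [lra|apply: mulr_gt0; lra].
Qed.

(** If y is at least a fixed fraction k of x, then the term in y alone is
    large enough. Otherwise the mean is at most (1 - s) x with p s = t (p + 1)
    / 2 > t, and Bernoulli applied to (1 + s)^p bounds (1 - s)^p by 1 - t
    minus a multiple of t. *)
Let scalar_low (t x y : R) : 0 <= t <= small_ratio -> t <= 1 ->
  0 <= x -> 0 <= y ->
  low_cst * t * x `^ p <= (1 - t) * x `^ p + t * y `^ p -
    ((1 - t) * x + t * y) `^ p + high_cst * t * y `^ p.
Proof.
have P1 := p1.
move=> /andP[t0 tr] t1 x0 y0.
have c0 := low_cst_gt0; have C0 := high_cst_gt0.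
set k := (p - 1) / (2 * p).
have k0 : 0 < k by apply: divr_gt0; [lra|apply: mulr_gt0; lra].
have [xy|yx] := leP (k * x) y.
  have := @powR_mean _ p (1 - t) x y p1 _ x0 y0.
  have -> : 1 - (1 - t) = t by ring.
  move=> /(_ _)/le_trans M.
  have {}M : ((1 - t) * x + t * y) `^ p <= (1 - t) * x `^ p + t * y `^ p.
    by apply: M => //; apply/andP; split; lra.
  have E : low_cst * x `^ p <= high_cst * y `^ p.
    rewrite /high_cst -/k [leRHS]mulrAC ler_pdivlMr ?powR_gt0// -mulrA ler_pM2l//.
    rewrite mulrC -powRM ?(ltW k0)//.
    have kx0 : 0 <= k * x by rewrite mulr_ge0// ltW.
    by apply: ge0_ler_powR; rewrite ?nnegrE ?kx0 ?(ltW p0) ?(ltW xy).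
  have : t * (low_cst * x `^ p) <= t * (high_cst * y `^ p) by rewrite ler_wpM2l.
  by lra.
have xp : 0 < x.
  rewrite lt_def x0 andbT; apply: contraTneq yx => ->.
  by rewrite mulr0 -leNgt.
pose s := (1 - k) * t.
have k1 : k < 1 by rewrite /k ltr_pdivrMr ?mulr_gt0//; lra.
have s0 : 0 <= s by rewrite /s mulr_ge0//; lra.
have s1 : s <= 1 by rewrite /s -[leRHS]mulr1 ler_pM//; lra.
have ps : p * s = q * t.
  by rewrite /s /k; field; rewrite gt_eqF.
have m0 : 0 <= (1 - t) * x + t * y by rewrite addr_ge0// mulr_ge0//; lra.
have mle : (1 - t) * x + t * y <= (1 - s) * x.
  have : t * y <= t * (k * x) by rewrite ler_wpM2l// ltW.
  by rewrite /s; lra.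
have H1 : ((1 - t) * x + t * y) `^ p <= (1 - s) `^ p * x `^ p.
  rewrite -powRM; [|by lra|by []].
  apply: ge0_ler_powR; rewrite ?nnegrE ?(ltW p0)//.
  by rewrite mulr_ge0//; lra.
have H2 : (1 - s) `^ p * (1 + q * t) <= 1.
  have B := @bernoulli_le _ p (1 + s) p1.
  have {}B : 1 + p * s <= (1 + s) `^ p by have := B _; rewrite addrAC subrr add0r; apply; lra.
  rewrite -ps; apply: (@le_trans _ _ ((1 - s) `^ p * (1 + s) `^ p)).
    by rewrite ler_wpM2l ?powR_ge0.
  rewrite -powRM; [|lra|lra].
  rewrite [leRHS](_ : 1 = 1 `^ p); last by rewrite powR1.
  apply: ge0_ler_powR; rewrite ?nnegrE ?(ltW p0)//.
    by rewrite mulr_ge0//; lra.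
  by nra.
have q1 : 1 < q by lra.
have H3 : 1 <= (1 - t - low_cst * t) * (1 + q * t).
  have cq : low_cst = (q - 1) / 2 by rewrite /low_cst; field.
  have : t * (q * (q + 1)) <= q - 1.
    by rewrite -ler_pdivlMr// mulr_gt0//; lra.
  rewrite cq => H; have : 0 <= t * ((q - 1) - t * (q * (q + 1))).
    by rewrite mulr_ge0// subr_ge0.
  by lra.
have qt0 : 0 < 1 + q * t by rewrite ltr_pwDl// mulr_ge0//; lra.
have H4 : (1 - s) `^ p <= 1 - t - low_cst * t.
  by rewrite -(ler_pM2r qt0) (le_trans H2).
have H5 : (1 - s) `^ p * x `^ p <= (1 - t - low_cst * t) * x `^ p.
  by rewrite ler_wpM2r ?powR_ge0.
have H6 : 0 <= t * y `^ p by rewrite mulr_ge0 ?powR_ge0.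
have H7 : 0 <= high_cst * (t * y `^ p) by rewrite mulr_ge0 ?(ltW C0).
by lra.
Qed.

(** The deficit is of first order in a small weight Q: unless |Y| is at least
    a fixed fraction of |X|, it is at least a fixed multiple of Q |X|^p. *)
Lemma deficit_low P Q X Y : 0 < P -> 0 < Q -> Q <= small_ratio * P ->
  low_cst * (Q * enorm X `^ p) <=
  deficit P Q X Y + high_cst * (Q * enorm Y `^ p).
Proof.
have P1 := p1.
move=> P0 Q0 QP; have /andP[t0 t1] := theta P0 Q0.
have S0 : 0 < P + Q by rewrite addr_gt0.
have tE : 1 - P / (P + Q) = Q / (P + Q) by field; rewrite gt_eqF.
set t := Q / (P + Q) in tE.
have tt0 : 0 < t by rewrite /t divr_gt0.
have tr : t <= small_ratio.
  rewrite /t ler_pdivrMr// mulrDr (le_trans QP)// lerDl.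
  by rewrite mulr_ge0 ?(ltW small_ratio_gt0) ?(ltW Q0).
have t1' : t <= 1 by rewrite -tE lerBlDr lerDl ltW.
have := scalar_low (t := t) (x := enorm X) (y := enorm Y).
rewrite (ltW tt0) tr t1' => /(_ isT isT (enorm_ge0 _) (enorm_ge0 _)) H.
rewrite deficitE// tE.
have PE : P / (P + Q) = 1 - t by rewrite -tE; ring.
rewrite PE.
have C := enorm_comb X Y (t := 1 - t).
have {}C : enorm ((1 - t) *: X + t *: Y) <= (1 - t) * enorm X + t * enorm Y.
  have e : 1 - (1 - t) = t by ring.
  by move: C; rewrite e; apply; apply/andP; split; lra.
have C2 : enorm ((1 - t) *: X + t *: Y) `^ p <=
    ((1 - t) * enorm X + t * enorm Y) `^ p.
  apply: ge0_ler_powR; rewrite ?nnegrE ?(ltW p0) ?enorm_ge0//.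
  by rewrite addr_ge0// mulr_ge0 ?enorm_ge0//; lra.
have QE : Q = (P + Q) * t by rewrite /t mulrCA divff ?mulr1// gt_eqF.
have H' : low_cst * t * enorm X `^ p <=
   ((1 - t) * enorm X `^ p + t * enorm Y `^ p -
    enorm ((1 - t) *: X + t *: Y) `^ p) + high_cst * t * enorm Y `^ p by lra.
have := ler_wpM2l (ltW S0) H'.
have -> : low_cst * (Q * enorm X `^ p) = (P + Q) * (low_cst * t * enorm X `^ p).
  by rewrite [in LHS]QE; ring.
have -> : high_cst * (Q * enorm Y `^ p) = (P + Q) * (high_cst * t * enorm Y `^ p).
  by rewrite [in LHS]QE; ring.
by rewrite mulrDr.
Qed.

End convexity_deficit.

(** * A smooth substitute for (|a|^p + |b|^p)^(1/p) *)

Section competitor.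
Context {R : realType} (p : R).
Hypothesis p1 : 1 < p.

Let p0 : 0 < p. Proof. by apply: lt_trans p1. Qed.
Let ph0 : 0 < p / 2. Proof. by rewrite divr_gt0. Qed.
Let pi0 : 0 < p^-1. Proof. by rewrite invr_gt0. Qed.

Definition reg_pow (e a : R) : R := (a ^+ 2 + e ^+ 2) `^ (p / 2).

(** The regularization makes this smooth, and the constant makes it vanish at
    the origin, so that two test functions are combined to a test function. As
    e tends to 0 it becomes (|a|^p + |b|^p)^(1/p). *)
Definition competitor (e a b : R) : R :=
  (reg_pow e a + reg_pow e b) `^ p^-1 - (reg_pow e 0 + reg_pow e 0) `^ p^-1.

Lemma reg_base_gt0 (e a : R) : 0 < e -> 0 < a ^+ 2 + e ^+ 2.
Proof. by move=> e0; rewrite ltr_wpDl ?sqr_ge0// exprn_gt0. Qed.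

Lemma reg_pow_gt0 (e a : R) : 0 < e -> 0 < reg_pow e a.
Proof. by move=> e0; rewrite powR_gt0// reg_base_gt0. Qed.

Lemma sqr_powR (a : R) : (a ^+ 2) `^ (p / 2) = `|a| `^ p.
Proof.
rewrite -real_normK ?num_real// -(powR_mulrn 2 (normr_ge0 a)) -powRrM.
by congr (_ `^ _); field.
Qed.

Lemma competitor_ge0 (e a b : R) : 0 < e -> 0 <= competitor e a b.
Proof.
move=> e0; rewrite subr_ge0; apply: ge0_ler_powR.
- exact: ltW.
- by rewrite nnegrE addr_ge0 ?powR_ge0.
- by rewrite nnegrE addr_ge0 ?powR_ge0.
- have H c : reg_pow e 0 <= reg_pow e c.
    apply: ge0_ler_powR; rewrite ?nnegrE ?addr_ge0 ?sqr_ge0 ?(ltW ph0)//.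
    by rewrite lerD2r expr0n/= sqr_ge0.
  exact: lerD.
Qed.

Lemma competitor0 (e : R) : competitor e 0 0 = 0.
Proof. by rewrite /competitor subrr. Qed.

(** The left-hand side is |X|^p times the power p/2 of a^2 / (a^2 + e^2). *)
Lemma reg_energy_le n (e a : R) (X : 'rV[R]_n) : 0 < e ->
  reg_pow e a * enorm ((a / (a ^+ 2 + e ^+ 2)) *: X) `^ p <= enorm X `^ p.
Proof.
move=> e0; have B0 := reg_base_gt0 a e0.
rewrite enormZ powRM ?enorm_ge0// mulrA ler_piMl ?powR_ge0//.
rewrite normrM normfV (gtr0_norm B0) powRM ?invr_ge0 ?(ltW B0)//.
set B := a ^+ 2 + e ^+ 2 in B0 *.
have -> : (B^-1) `^ p = (B^-1 ^+ 2) `^ (p / 2).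
  by rewrite sqr_powR ger0_norm// invr_ge0 ltW.
rewrite -sqr_powR /reg_pow -/B -powRM ?sqr_ge0//.
have T0 : 0 <= a ^+ 2 * B^-1 ^+ 2 by apply: mulr_ge0; exact: sqr_ge0.
rewrite -powRM ?(ltW B0)//.
rewrite [leRHS](_ : 1 = 1 `^ (p / 2)); last by rewrite powR1.
apply: ge0_ler_powR; [exact: ltW| |by rewrite nnegrE|].
  by rewrite nnegrE mulr_ge0 ?(ltW B0).
have -> : B * (a ^+ 2 * B^-1 ^+ 2) = a ^+ 2 / B by field; rewrite gt_eqF.
by rewrite ler_pdivrMr// mul1r /B lerDl sqr_ge0.
Qed.

Section gradient.
Context {n : nat}.
Implicit Types (phi psi f : 'rV[R]_n -> R) (x : 'rV[R]_n).
Local Notation e_ i := (delta_mx ord0 i : 'rV[R]_n).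

Definition grad f x : 'rV[R]_n := \row_i partial i f x.

Lemma smooth_sqr f : smooth f -> smooth (fun x => f x ^+ 2).
Proof. by move=> fs; exact: smoothM. Qed.

Lemma smooth_reg_pow e phi : 0 < e -> smooth phi ->
  smooth (fun x => reg_pow e (phi x)).
Proof.
move=> e0 ps; apply: smooth_powR => [x|]; first exact: reg_base_gt0.
by apply: smoothD; [exact: smooth_sqr|exact: smooth_cst].
Qed.

Lemma smooth_competitor e phi psi : 0 < e -> smooth phi -> smooth psi ->
  smooth (fun x => competitor e (phi x) (psi x)).
Proof.
move=> e0 phis psis; apply: smoothD; last exact: smooth_cst.
apply: smooth_powR => [x|]; first by rewrite addr_gt0 ?reg_pow_gt0.
by apply: smoothD; exact: smooth_reg_pow.
Qed.

Lemma is_derive_reg_pow e phi i x : 0 < e -> smooth phi ->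
  is_derive x (e_ i) (fun y => reg_pow e (phi y))
    (p * reg_pow e (phi x) * (phi x / (phi x ^+ 2 + e ^+ 2)) * partial i phi x).
Proof.
move=> e0 ps; have B0 := reg_base_gt0 (phi x) e0.
have d1 : is_derive x (e_ i) (fun y => phi y ^+ 2 + e ^+ 2)
    (phi x * partial i phi x + phi x * partial i phi x + 0).
  have dphi := smooth_is_derive i x ps.
  exact: is_derive_add (is_derive_mul dphi dphi) (is_derive_cst _ _ _).
have [D1 D2] := is_derive_comp1 d1 (is_derive1_powR (p / 2) B0).
split; [exact: D1|rewrite D2].
rewrite powRB; last by apply/implyP => _; rewrite gt_eqF.
rewrite powRr1 ?(ltW B0)// /reg_pow.
by field; rewrite gt_eqF.
Qed.

Lemma grad_competitor e phi psi x : 0 < e -> smooth phi -> smooth psi ->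
  grad (fun y => competitor e (phi y) (psi y)) x =
  mean_grad p (reg_pow e (phi x)) (reg_pow e (psi x))
    ((phi x / (phi x ^+ 2 + e ^+ 2)) *: grad phi x)
    ((psi x / (psi x ^+ 2 + e ^+ 2)) *: grad psi x).
Proof.
move=> e0 phis psis; apply/rowP => i; rewrite !mxE; apply: partialE.
have S0 : 0 < reg_pow e (phi x) + reg_pow e (psi x).
  by rewrite addr_gt0 ?reg_pow_gt0.
have d1 := is_derive_add (is_derive_reg_pow i x e0 phis)
  (is_derive_reg_pow i x e0 psis).
have d2 := is_derive_comp1 d1 (is_derive1_powR p^-1 S0).
have d3 : is_derive x (e_ i)
  (fun=> - (reg_pow e 0 + reg_pow e 0) `^ p^-1 : R) 0 by exact: is_derive_cst.
have [D1 D2] := is_derive_add d2 d3.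
split; [exact: D1|rewrite D2].
by field; rewrite !gt_eqF// ?reg_base_gt0.
Qed.

(** The gradient of the competitor is the mean of the regularized logarithmic
    gradients a grad a / (a^2 + e^2), for which the deficit is the exact loss;
    regularizing these only lowers the energies. *)
Lemma competitor_energy_le e phi psi x : 0 < e -> smooth phi -> smooth psi ->
  enorm (grad (fun y => competitor e (phi y) (psi y)) x) `^ p +
  deficit p (reg_pow e (phi x)) (reg_pow e (psi x))
    ((phi x / (phi x ^+ 2 + e ^+ 2)) *: grad phi x)
    ((psi x / (psi x ^+ 2 + e ^+ 2)) *: grad psi x) <=
  enorm (grad phi x) `^ p + enorm (grad psi x) `^ p.
Proof.
move=> e0 phis psis; rewrite grad_competitor// /deficit addrC subrK.
by rewrite lerD// reg_energy_le.
Qed.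

End gradient.

Section limits.

Lemma cvg_powR_pos (u : R^nat) (l r : R) : 0 < l ->
  u k @[k --> \oo] --> l -> (u k `^ r) @[k --> \oo] --> l `^ r.
Proof.
move=> lp ul; have c : {for l, continuous (@powR R ^~ r)}.
  apply/differentiable_continuous/derivable1_diffP.
  by have [] := is_derive1_powR r lp.
exact: (cvg_comp _ _ ul c).
Qed.

Lemma cvg_powR (u : R^nat) (l r : R) : 0 < r -> (forall k, 0 <= u k) ->
  u k @[k --> \oo] --> l -> (u k `^ r) @[k --> \oo] --> l `^ r.
Proof.
move=> r0 u0 ul.
have l0 : 0 <= l by apply: (cvgr_to_ge ul); exact: nearW.
have [lz|ln0] := eqVneq l 0; last first.
  have lp : 0 < l by rewrite lt_def ln0.
  exact: cvg_powR_pos.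
rewrite lz powR0 ?gt_eqF//; apply/cvgrPdist_le => eps eps0.
have d0 : 0 < eps `^ r^-1 by rewrite powR_gt0.
move: ul; rewrite lz => /cvgrPdist_le /(_ _ d0).
apply: filterS => k; rewrite !sub0r !normrN !ger0_norm ?powR_ge0// => h.
rewrite -[leRHS](powRr1 (ltW eps0)) -(mulVf (lt0r_neq0 r0)) powRrM.
by apply: ge0_ler_powR; rewrite ?nnegrE ?powR_ge0 ?u0 ?(ltW r0).
Qed.

Lemma cvg_sum_seq (I : Type) (s : seq I) (f : I -> R^nat) (l : I -> R) :
  (forall i, f i k @[k --> \oo] --> l i) ->
  (\sum_(i <- s) f i k) @[k --> \oo] --> \sum_(i <- s) l i.
Proof.
move=> fl; elim: s => [|i s IH].
  by under eq_fun do rewrite big_nil; rewrite big_nil; exact: cvg_cst.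
under eq_fun do rewrite big_cons; rewrite big_cons.
by apply: cvgD.
Qed.

Lemma cvg_enorm n (X : nat -> 'rV[R]_n) (Y : 'rV[R]_n) :
  (forall i, X k ord0 i @[k --> \oo] --> Y ord0 i) ->
  enorm (X k) @[k --> \oo] --> enorm Y.
Proof.
move=> XY; rewrite /enorm -powR12_sqrt ?dotp_ge0//.
under eq_fun do rewrite -powR12_sqrt ?dotp_ge0//.
apply: cvg_powR; [by rewrite invr_gt0|by move=> k; exact: dotp_ge0|].
by apply: cvg_sum_seq => i; exact: cvgM.
Qed.

Lemma cvg_deficit n (P Q : R^nat) (X Y : nat -> 'rV[R]_n) (P' Q' : R)
    (X' Y' : 'rV[R]_n) : 0 < P' -> 0 < Q' ->
  P k @[k --> \oo] --> P' -> Q k @[k --> \oo] --> Q' ->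
  (forall i, X k ord0 i @[k --> \oo] --> X' ord0 i) ->
  (forall i, Y k ord0 i @[k --> \oo] --> Y' ord0 i) ->
  deficit p (P k) (Q k) (X k) (Y k) @[k --> \oo] --> deficit p P' Q' X' Y'.
Proof.
move=> P0 Q0 PP QQ XX YY.
apply: cvgB; last first.
  apply: cvg_powR => //; first by move=> k; exact: enorm_ge0.
  apply: cvg_enorm => i; rewrite !mxE; under eq_fun do rewrite !mxE.
  apply: cvgM; last by apply: cvgD; exact: cvgM.
  by apply: cvg_powR_pos; [rewrite addr_gt0|exact: cvgD].
apply: cvgD; apply: cvgM => //; apply: cvg_powR => //;
  try (by move=> k; exact: enorm_ge0); exact: cvg_enorm.
Qed.

Lemma cvg_sqr_ratio (e a : R^nat) (al : R) : al != 0 ->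
  e k @[k --> \oo] --> (0 : R) -> a k @[k --> \oo] --> al ->
  a k / (a k ^+ 2 + e k ^+ 2) @[k --> \oo] --> al^-1.
Proof.
move=> al0 el aal; have -> : al^-1 = al / (al ^+ 2 + 0 * 0) by field.
apply: cvgM => //; apply: cvgV; first by rewrite mulr0 addr0 sqrf_eq0.
by apply: cvgD; exact: cvgM.
Qed.

Variables (e a b : R^nat) (al be : R).
Hypotheses (e0 : forall k, 0 < e k) (el : e k @[k --> \oo] --> (0 : R))
  (aal : a k @[k --> \oo] --> al) (bbe : b k @[k --> \oo] --> be).

Lemma cvg_reg_pow (c : R^nat) (ga : R) : c k @[k --> \oo] --> ga ->
  reg_pow (e k) (c k) @[k --> \oo] --> `|ga| `^ p.
Proof.
move=> cga; rewrite -sqr_powR; apply: cvg_powR => //.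
  by move=> k; rewrite addr_ge0 ?sqr_ge0.
rewrite -[X in _ --> X]addr0; apply: cvgD; first exact: cvgM.
rewrite -(mulr0 0); exact: cvgM.
Qed.

Lemma cvg_competitor : competitor (e k) (a k) (b k) `^ p @[k --> \oo] -->
  `|al| `^ p + `|be| `^ p.
Proof.
have S0 : 0 <= `|al| `^ p + `|be| `^ p by rewrite addr_ge0 ?powR_ge0.
rewrite -[X in _ --> X](powRr1 S0) -(mulVf (lt0r_neq0 p0)) powRrM.
apply: cvg_powR => //; first by move=> k; exact: competitor_ge0.
rewrite -[X in _ --> X]subr0; apply: cvgB.
  apply: cvg_powR => // [k|]; first by rewrite addr_ge0 ?powR_ge0.
  by apply: cvgD; exact: cvg_reg_pow.
have z0 : (fun=> 0 : R) @ \oo --> (0 : R) by exact: cvg_cst.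
have z0E : (`|0 : R| `^ p + `|0 : R| `^ p) `^ p^-1 = 0.
  by rewrite normr0 powR0 ?gt_eqF// addr0 powR0// gt_eqF.
rewrite -[X in _ --> X]z0E.
apply: cvg_powR => // [k|]; first by rewrite addr_ge0 ?powR_ge0.
by apply: cvgD; exact: (cvg_reg_pow z0).
Qed.

End limits.

End competitor.

(** * Weak gradients *)

Section weak_gradients.
Context {R : realType} {n : nat}.
Variable Om : set 'rV[R]_n.
Hypothesis oO : open Om.
Implicit Types (u v phi zeta : 'rV[R]_n -> R) (g : 'rV[R]_n -> 'rV[R]_n).
Local Notation mu := (leb R n).
Local Notation T := (lebesgue_space R n).

Let mO : measurable (Om : set T) := open_lebesgue_measurable oO.

Lemma leb_ae_forall (m : nat) (P : 'I_m -> 'rV[R]_n -> Prop) :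
  (forall i, ae_in Om (P i)) -> ae_in Om (fun x => forall i, P i x).
Proof.
move=> H.
have : {ae mu, forall x, forall k : nat, Om x -> forall i : 'I_m, k = i -> P i x}.
  apply: ae_foralln => k; have [km|mk] := ltnP k m.
    apply: leb_ae_mono (H (Ordinal km)) => x Hx Ox i ki.
    by rewrite (_ : i = Ordinal km); [exact: Hx|exact: val_inj].
  by apply: aeW => x Ox i ki; move: (ltn_ord i); rewrite -ki ltnNge mk.
by apply: leb_ae_mono => x Hx Ox i; exact: (Hx i).
Qed.

Lemma in_L1loc_continuous phi : continuous phi -> in_L1loc Om phi.
Proof.
move=> cphi; split; first exact: continuous_lmeasurable.
move=> K cK KO.
have mK : measurable (K : set T).
  by apply: borel_lebesgue_measurable; exact: compact_measurable_rV.
have [C HC] := continuous_compact_bound cphi cK.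
have /integrableP[] // : mu.-integrable (K : set T) (EFin \o phi).
apply: measurable_bounded_integrable => //.
- by apply: leb_bounded_lty => //; exact: compact_bounded.
- apply: measurable_funTS; apply: measurable_funT_borel_lebesgue.
  exact: continuous_measurable_rV.
- exists C; split; first exact: num_real.
  by move=> D CD x Kx; apply: le_trans (ltW CD); exact: HC.
Qed.

Lemma test_partialM phi zeta i x : smooth phi -> smooth zeta ->
  partial i (fun y => phi y * zeta y) x =
  phi x * partial i zeta x + zeta x * partial i phi x.
Proof.
move=> ps zs; apply: partialE.
by apply: is_derive_mul; exact: smooth_is_derive.
Qed.

Let fin_adde_eq0 (x y : \bar R) : x \is a fin_num -> y \is a fin_num ->
  (x + y = 0 -> x = - y)%E.
Proof. by case: x y => [r||] [s||] //= _ _ [] rs; congr (_%:E); lra. Qed.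

(** The product of a smooth function with a test function is a test function,
    and its partial derivatives integrate to zero. *)
Lemma smooth_weak_gradient phi : smooth phi -> is_weak_gradient Om phi (grad phi).
Proof.
move=> ps.
have L1p i : in_L1loc Om (partial i phi).
  by apply/in_L1loc_continuous/smooth_continuous/smooth_partial.
have L1phi : in_L1loc Om phi by exact/in_L1loc_continuous/smooth_continuous.
split => //.
  by move=> i; rewrite (_ : (fun x => _) = partial i phi)//; apply/funext => x; rewrite mxE.
move=> zeta tz i; have [zs _ _] := tz.
under [X in _ = (- X)%E]eq_integral do rewrite mxE.
have tpz : test_function Om (fun y => phi y * zeta y) by exact: test_functionMr.
have P0 : (\int[mu]_(x in Om) ((phi x * partial i zeta x)%:E +
    (partial i phi x * zeta x)%:E) = 0)%E.
  rewrite -(test_integral_partial0 i oO tpz); apply: eq_integral => x _.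
  by rewrite test_partialM// -EFinD [zeta x * _]mulrC.
have i1 := test_partial_integrableM i oO L1phi tz.
have i2 := test_integrableM oO (L1p i) tz.
move: P0; rewrite integralD//; apply: fin_adde_eq0; exact: integrable_fin_num.
Qed.

Lemma weak_gradient_unique u g g' : is_weak_gradient Om u g ->
  is_weak_gradient Om u g' -> ae_in Om (fun x => g x = g' x).
Proof.
move=> [hu hg Hg] [_ hg' Hg'].
have H i : ae_in Om (fun x => 1 * g x ord0 i + (- 1) * g' x ord0 i = 0).
  apply: orthogonal_test_ae0 => //; first exact: in_L1loc_lin.
  move=> zeta tz.
  have i1 := test_integrableM oO (hg i) tz.
  have i2 := test_integrableM oO (hg' i) tz.
  have E : (\int[mu]_(x in Om) (g x ord0 i * zeta x)%:E =
      \int[mu]_(x in Om) (g' x ord0 i * zeta x)%:E)%E.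
    by apply: oppe_inj; rewrite -(Hg _ tz i) -(Hg' _ tz i).
  rewrite (eq_integral (fun x : T => (g x ord0 i * zeta x)%:E -
    (g' x ord0 i * zeta x)%:E)%E); last first.
    by move=> x _; rewrite -EFinB; congr (_%:E); ring.
  by rewrite integralB// E subee// integrable_fin_num.
apply: leb_ae_mono (leb_ae_forall H) => x Hx Ox; apply/rowP => i.
by have := Hx Ox i; lra.
Qed.

Lemma weak_gradient_lin u v g g' (c d : R) : is_weak_gradient Om u g ->
  is_weak_gradient Om v g' ->
  is_weak_gradient Om (fun x => c * u x + d * v x)
    (fun x => c *: g x + d *: g' x).
Proof.
move=> [hu hg Hg] [hv hg' Hg']; split; first exact: in_L1loc_lin.
  move=> i; have := in_L1loc_lin c d oO (hg i) (hg' i).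
  by rewrite (_ : (fun x => (c *: g x + d *: g' x) ord0 i) =
    (fun x => c * g x ord0 i + d * g' x ord0 i))//; apply/funext => x; rewrite !mxE.
move=> zeta tz i.
have i1 := test_partial_integrableM i oO hu tz.
have i2 := test_partial_integrableM i oO hv tz.
have i3 := test_integrableM oO (hg i) tz.
have i4 := test_integrableM oO (hg' i) tz.
rewrite (eq_integral (fun x : T => c%:E * (u x * partial i zeta x)%:E +
   d%:E * (v x * partial i zeta x)%:E)%E); last first.
  by move=> x _; rewrite -!EFinM -EFinD; congr (_%:E); ring.
rewrite [in RHS](eq_integral (fun x : T => c%:E * (g x ord0 i * zeta x)%:E +
   d%:E * (g' x ord0 i * zeta x)%:E)%E); last first.
  by move=> x _; rewrite !mxE -!EFinM -EFinD; congr (_%:E); ring.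
rewrite !integralD//; try exact: integrableZl.
rewrite !integralZl// Hg// Hg'// !muleN oppeD//.
by rewrite fin_num_adde_defl// fin_numM// integrable_fin_num.
Qed.

Lemma wgradP u : (exists g, is_weak_gradient Om u g) ->
  is_weak_gradient Om u (wgrad Om u).
Proof. by move=> [g Hg]; exact: (xgetPex (fun=> 0) (ex_intro _ g Hg)). Qed.

Lemma wgrad_ae u g : is_weak_gradient Om u g ->
  ae_in Om (fun x => wgrad Om u x = g x).
Proof.
move=> Hg; apply: (weak_gradient_unique _ Hg); apply: wgradP; by exists g.
Qed.

End weak_gradients.

(** * Energies and approximation by test functions *)

Section energies.
Context {R : realType} {n : nat}.
Variables (Om : set 'rV[R]_n) (p : R) (w : 'rV[R]_n -> R).
Hypotheses (p1 : 1 < p) (oO : open Om)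
  (hw : class_Ap Om p w).
Implicit Types (u v phi psi zeta : 'rV[R]_n -> R) (g : 'rV[R]_n -> 'rV[R]_n).
Local Notation mu := (leb R n).
Local Notation T := (lebesgue_space R n).

Let p0 : 0 < p. Proof. by apply: lt_trans p1. Qed.
Let mO : measurable (Om : set T) := open_lebesgue_measurable oO.
Let mw : lmeasurable Om w. Proof. by case: hw => [[]]. Qed.

(** The weight is only positive almost everywhere; its positive part is an
    equivalent weight that is nonnegative everywhere. *)
Definition pos_weight x : R := Num.max (w x) 0.

Lemma pos_weight_ge0 x : 0 <= pos_weight x.
Proof. by rewrite /pos_weight le_max lexx orbT. Qed.

Lemma pos_weight_ae : ae_in Om (fun x => pos_weight x = w x /\ 0 < w x).
Proof.
have [[_ w0] _ _] := hw; apply: leb_ae_mono w0 => x H Ox.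
by split; [apply/max_idPl/ltW|]; exact: H.
Qed.

Lemma pos_weight_measurable : lmeasurable Om pos_weight.
Proof. by apply: measurable_maxr => //; exact: measurable_cst. Qed.

Lemma pos_weight_L1loc : in_L1loc Om pos_weight.
Proof.
have [_ [_ Hw] _] := hw; split; first exact: pos_weight_measurable.
move=> K cK KO; apply: le_lt_trans (Hw K cK KO).
have mK : measurable (K : set T).
  by apply: borel_lebesgue_measurable; exact: compact_measurable_rV.
have mnorm (f : 'rV[R]_n -> R) : lmeasurable Om f ->
    measurable_fun (K : set T) (fun x : T => `|f x|%:E).
  move=> mf; apply/measurable_EFinP/measurableT_comp => //.
  exact: measurable_funS mf.
apply: (@ae_ge0_le_integral _ T R mu K mK (fun x : T => `|pos_weight x|%:E)
  (fun x : T => `|w x|%:E) _ (mnorm _ pos_weight_measurable) _ (mnorm _ mw)).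
- by move=> x _; rewrite lee_fin.
- by move=> x _; rewrite lee_fin.
- apply: aeW => x _; rewrite lee_fin ger0_norm ?pos_weight_ge0// /pos_weight.
  by rewrite ge_max ler_norm normr_ge0.
Qed.

Lemma measurable_enorm_pow g (r : R) : (forall i, lmeasurable Om (fun x => g x ord0 i)) ->
  lmeasurable Om (fun x => enorm (g x) `^ r).
Proof.
move=> mg; rewrite /lmeasurable.
rewrite (_ : (fun x => _) = (@powR R ^~ (2^-1 * r)) \o (fun x => dotp (g x) (g x))).
  apply: measurableT_comp; first exact: measurable_powR.
  by apply: measurable_sum => i; apply: measurable_funM; exact: mg.
by apply/funext => x /=; rewrite powRrM powR12_sqrt// dotp_ge0.
Qed.

Lemma measurable_abs_pow u (r : R) : lmeasurable Om u ->
  lmeasurable Om (fun x => `|u x| `^ r).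
Proof.
move=> mu'; have m1 : measurable_fun (Om : set T) (fun x : T => `|u x|).
  exact: measurableT_comp.
exact: (measurableT_comp (measurable_powR r) m1).
Qed.

Lemma weak_gradient_measurable u g i : is_weak_gradient Om u g ->
  lmeasurable Om (fun x => g x ord0 i).
Proof. by move=> [_ /(_ i)[]]. Qed.

Definition energy_density g x : R := pos_weight x * enorm (g x) `^ p.

Lemma energy_density_ge0 g x : 0 <= energy_density g x.
Proof. by rewrite mulr_ge0 ?pos_weight_ge0 ?powR_ge0. Qed.

Lemma energy_density_measurable g :
  (forall i, lmeasurable Om (fun x => g x ord0 i)) ->
  lmeasurable Om (energy_density g).
Proof.
move=> mg; apply: measurable_funM; first exact: pos_weight_measurable.
exact: measurable_enorm_pow.
Qed.

Lemma energyE u g : is_weak_gradient Om u g ->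
  energy Om p w u = (\int[mu]_(x in Om) (energy_density g x)%:E)%E.
Proof.
move=> Hg; have Hw := wgradP (ex_intro _ g Hg).
have m1 : measurable_fun (Om : set T) (fun x : T => enorm (wgrad Om u x) `^ p).
  by apply: measurable_enorm_pow => i; exact: weak_gradient_measurable Hw.
have m2 : measurable_fun (Om : set T) (energy_density g).
  by apply: energy_density_measurable => i; exact: weak_gradient_measurable Hg.
apply: (@ae_eq_integral _ T R mu Om (fun x : T => (energy_density g x)%:E)
  (fun x : T => (w x * enorm (wgrad Om u x) `^ p)%:E) mO).
- by apply/measurable_EFinP; exact: (measurable_funM mw m1).
- exact/measurable_EFinP.
- apply: leb_ae_mono2 (wgrad_ae oO Hg) pos_weight_ae => x H1 H2 Ox.
  by rewrite /energy_density (H1 Ox) (H2 Ox).1.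
Qed.

Lemma energy_ge0 u : (exists g, is_weak_gradient Om u g) ->
  (0 <= energy Om p w u)%E.
Proof.
move=> [g Hg]; rewrite (energyE Hg); apply: integral_ge0 => x _.
by rewrite lee_fin energy_density_ge0.
Qed.

Lemma grad_measurable phi i : smooth phi ->
  lmeasurable Om (fun x => grad phi x ord0 i).
Proof.
move=> ps; rewrite (_ : (fun x => _) = partial i phi).
  by apply: continuous_lmeasurable => //; exact/smooth_continuous/smooth_partial.
by apply/funext => x; rewrite mxE.
Qed.

Lemma smooth_dotp_grad phi : smooth phi ->
  smooth (fun x => dotp (grad phi x) (grad phi x)).
Proof.
move=> ps; rewrite (_ : (fun x => _) =
    fun x => \sum_i partial i phi x * partial i phi x); last first.
  by apply/funext => x; apply: eq_bigr => i _; rewrite mxE.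
elim: (index_enum _) => [|i s IH].
  rewrite (_ : (fun x => _) = fun=> 0); first exact: smooth_cst.
  by apply/funext => x; rewrite big_nil.
rewrite (_ : (fun x => _) = fun x => partial i phi x * partial i phi x +
    \sum_(j <- s) partial j phi x * partial j phi x).
  by apply: smoothD => //; apply: smoothM; exact: smooth_partial.
by apply/funext => x; rewrite big_cons.
Qed.

Lemma test_energy_integrable phi : test_function Om phi ->
  mu.-integrable (Om : set T) (EFin \o energy_density (grad phi)).
Proof.
move=> [ps cp pO].
have [C HC] := continuous_compact_bound (smooth_continuous (smooth_dotp_grad ps)) cp.
apply: (in_L1loc_integrableM_bounded (C := Num.max C 0 `^ (2^-1 * p))
  oO pos_weight_L1loc cp pO).
- by apply: measurable_enorm_pow => i; exact: grad_measurable.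
- move=> x Kx; rewrite ger0_norm ?powR_ge0// /enorm -powR12_sqrt ?dotp_ge0//.
  rewrite -powRrM; apply: ge0_ler_powR; rewrite ?nnegrE ?dotp_ge0//.
  + by rewrite mulr_ge0 ?invr_ge0// ltW.
  + by rewrite le_max lexx orbT.
  + by rewrite le_max (le_trans (ler_norm _) (HC _ Kx)).
- move=> x nK; rewrite (_ : grad phi x = 0) ?enorm0 ?powR0 ?gt_eqF//.
  by apply/rowP => i; rewrite !mxE partial_suppN.
Qed.

Lemma test_pow_integrable phi : test_function Om phi ->
  mu.-integrable (Om : set T) (fun x => (`|phi x| `^ p)%:E).
Proof.
move=> [ps cp pO]; have cphi := smooth_continuous ps.
have [C HC] := continuous_compact_bound cphi cp.
rewrite (_ : (fun x => _) = fun x => ((fun=> 1) x * (`|phi x| `^ p))%:E); last first.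
  by apply/funext => x; rewrite mul1r.
apply: (in_L1loc_integrableM_bounded (C := C `^ p) oO (in_L1loc_cst 1 oO) cp pO).
- exact/measurable_abs_pow/continuous_lmeasurable.
- move=> x Kx; rewrite ger0_norm ?powR_ge0//.
  apply: ge0_ler_powR; rewrite ?nnegrE ?(ltW p0)//; last exact: HC.
  exact: le_trans (HC _ Kx).
- by move=> x /suppN ->; rewrite normr0 powR0// gt_eqF.
Qed.

Lemma test_energyE phi : test_function Om phi ->
  energy Om p w phi = (\int[mu]_(x in Om) (energy_density (grad phi) x)%:E)%E.
Proof.
by move=> [ps _ _]; apply: energyE; exact: smooth_weak_gradient.
Qed.

Lemma sobolev_norm_lt u (e : R) : 0 < e -> (exists g, is_weak_gradient Om u g) ->
  (sobolev_norm Om p w u < e%:E)%E ->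
  (\int[mu]_(x in Om) (`|u x| `^ p)%:E + energy Om p w u < (e `^ p)%:E)%E.
Proof.
move=> e0 Hg; rewrite /sobolev_norm.
have : (0 <= \int[mu]_(x in Om) (`|u x| `^ p)%:E + energy Om p w u)%E.
  apply: adde_ge0; last exact: energy_ge0.
  by apply: integral_ge0 => x _; rewrite lee_fin powR_ge0.
have pi0 : 0 < p^-1 by rewrite invr_gt0.
case: (_ + _)%E => [r r0||//]; last by rewrite poweRyr// gt_eqF.
rewrite lee_fin in r0; rewrite poweR_EFin !lte_fin => h.
rewrite -[ltLHS](powRr1 r0) -(mulVf (lt0r_neq0 p0)) powRrM.
by apply: gt0_ltr_powR; rewrite ?nnegrE ?powR_ge0 ?(ltW e0).
Qed.

Lemma test_W1p0 phi : test_function Om phi -> W1p0 Om p w phi.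
Proof.
move=> tp; have [ps _ _] := tp; have Hg := smooth_weak_gradient oO ps.
split; first split; first by exists (grad phi).
  rewrite /sobolev_norm; apply: poweR_lty; apply: lte_add_pinfty.
    apply: (integrable_lty mO (test_pow_integrable tp)).
  rewrite (test_energyE tp); exact: (integrable_lty mO (test_energy_integrable tp)).
move=> e e0; exists phi; split => //.
rewrite (_ : phi \- phi = fun=> 0); last by apply/funext => x; rewrite /= subrr.
have t0 := @test_function_cst0 R n Om.
rewrite /sobolev_norm (test_energyE t0).
have -> : (\int[mu]_(x in Om) (`|(fun=> 0 : R) x| `^ p)%:E = 0)%E.
  by apply: integral0_eq => x _; rewrite normr0 powR0// gt_eqF.
have -> : (\int[mu]_(x in Om) (energy_density (grad (fun=> 0)) x)%:E = 0)%E.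
  apply: integral0_eq => x _; rewrite /energy_density.
  rewrite (_ : grad _ x = 0) ?enorm0 ?powR0 ?mulr0// ?gt_eqF//.
  by apply/rowP => i; rewrite !mxE /partial derive_cst.
by rewrite adde0 poweR0r ?lte_fin// gt_eqF// invr_gt0.
Qed.

End energies.

Section summable_domination.
Context d (T : measurableType d) (R : realType) (mu : {measure set T -> \bar R}).

(** The dominating function is the sum of the series, integrable by monotone
    convergence; where the sum is finite, its terms tend to 0. *)
Lemma summable_domination (D : set T) (f : nat -> T -> R) : measurable D ->
  (forall k, measurable_fun D (f k)) -> (forall k x, 0 <= f k x) ->
  (forall k, \int[mu]_(x in D) (f k x)%:E <= (1 / (2 ^ k.+1)%:R)%:E)%E ->
  exists H : T -> R, mu.-integrable D (EFin \o H) /\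
    {ae mu, forall x, D x ->
       (forall k, f k x <= H x) /\ f k x @[k --> \oo] --> (0 : R)}.
Proof.
move=> mD mf f0 If.
have mef k : measurable_fun D (fun x => (f k x)%:E).
  by apply/measurable_EFinP; exact: mf.
have fe0 k x : (0 <= (f k x)%:E)%E by rewrite lee_fin.
pose S x := (\sum_(k <oo) (f k x)%:E)%E.
have S0 x : (0 <= S x)%E by apply: nneseries_ge0 => k _ _; exact: fe0.
have mS : measurable_fun D S.
  apply: (@ge0_emeasurable_sum _ _ _ D (fun k x => (f k x)%:E) xpredT).
    by move=> k x _ _; exact: fe0.
  by move=> k _; exact: mef.
have IS : mu.-integrable D S.
  apply/integrableP; split => //.
  under eq_integral do rewrite gee0_abs//.
  rewrite /S integral_nneseries//.
  apply: le_lt_trans (ltry 1).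
  apply: le_trans (epsilon_trick0 xpredT ler01).
  by apply: lee_nneseries => [k _ _|k _]; [exact: integral_ge0|exact: If].
exists (fine \o S); split.
  apply: le_integrable IS => //.
    by apply/measurable_EFinP; apply: measurableT_comp.
  by move=> x _ /=; case: (S x) (S0 x) => //= _; rewrite leey.
apply: filterS (integrable_ae mD IS) => x H Dx; have Sf := H Dx.
have part m : \sum_(0 <= k < m) f k x <= fine (S x).
  rewrite -lee_fin fineK// -sumEFin; apply: nneseries_lim_ge => k _ _; exact: fe0.
split.
  move=> k; apply: le_trans (part k.+1); rewrite big_nat_recr//= lerDr.
  exact: sumr_ge0.
apply: cvg_series_cvg_0; apply: nondecreasing_is_cvgn.
  by apply: nondecreasing_series => k _ _; exact: f0.
by exists (fine (S x)) => _ [m _ <-]; exact: part.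
Qed.

End summable_domination.

Section sobolev_approximation.
Context {R : realType} {n : nat}.
Variables (Om : set 'rV[R]_n) (p : R) (w : 'rV[R]_n -> R).
Hypotheses (p1 : 1 < p) (oO : open Om)
  (hw : class_Ap Om p w).
Implicit Types (u v phi psi zeta : 'rV[R]_n -> R) (g : 'rV[R]_n -> 'rV[R]_n).
Local Notation mu := (leb R n).
Local Notation T := (lebesgue_space R n).

Let p0 : 0 < p. Proof. by apply: lt_trans p1. Qed.
Let mO : measurable (Om : set T) := open_lebesgue_measurable oO.

Let cvg0_powR (a b : R^nat) (c : R) : 0 < c -> (forall k, 0 <= a k) ->
  (forall k, c * a k `^ p <= b k) -> b k @[k --> \oo] --> (0 : R) ->
  a k @[k --> \oo] --> (0 : R).
Proof.
move=> c0 a0 ab b0.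
have bc : b k / c @[k --> \oo] --> (0 : R).
  by rewrite -(mul0r c^-1); apply: cvgM => //; exact: cvg_cst.
have h : a k `^ p @[k --> \oo] --> (0 : R).
  apply: (squeeze_cvgr _ (cvg_cst 0) bc); apply: nearW => k.
  by rewrite powR_ge0 ler_pdivlMr// mulrC ab.
have pi0 : 0 < p^-1 by rewrite invr_gt0.
have := cvg_powR pi0 (fun k => powR_ge0 (a k) p) h.
rewrite powR0 ?gt_eqF//.
by under eq_fun do rewrite -powRrM mulfV ?gt_eqF// powRr1//.
Qed.

Let cvg_of_diff (a : R^nat) (l : R) :
  (l - a k) @[k --> \oo] --> (0 : R) -> a k @[k --> \oo] --> l.
Proof.
move=> h; have -> : a = (fun k => l - (l - a k)).
  by apply/funext => k; ring.
by rewrite -[X in _ --> X]subr0; apply: cvgB => //; exact: cvg_cst.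
Qed.

(** If the p-th powers of the errors are below 2^-(k+1), then the energies of
    the differences are summable. This gives the convergence of the gradients
    almost everywhere and the integrable bound for dominated convergence. *)
Lemma W1p0_approx u : W1p0 Om p w u -> exists (phi : nat -> 'rV[R]_n -> R)
    (H : 'rV[R]_n -> R),
  [/\ forall k, test_function Om (phi k),
      mu.-integrable (Om : set T) (EFin \o H) &
      ae_in Om (fun x => [/\
        forall k, pos_weight w x * enorm (wgrad Om u x - grad (phi k) x) `^ p <= H x,
        phi k x @[k --> \oo] --> u x &
        forall i, grad (phi k) x ord0 i @[k --> \oo] --> wgrad Om u x ord0 i])].
Proof.
move=> [[Hu _] Hap]; have Hg := wgradP Hu.
pose ek (k : nat) := (1 / (2 ^ k.+1)%:R : R) `^ p^-1.
have ek0 k : 0 < ek k by rewrite powR_gt0// divr_gt0// ltr0n expn_gt0.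
have /choice[phi Hphi] (k : nat) := Hap _ (ek0 k).
have tphi k : test_function Om (phi k) by have [] := Hphi k.
have sphi k : smooth (phi k) by have [] := tphi k.
pose dk k x := 1 *: wgrad Om u x + (-1) *: grad (phi k) x.
have Hd k : is_weak_gradient Om (u \- phi k) (dk k).
  have := weak_gradient_lin oO 1 (-1) Hg (smooth_weak_gradient oO (sphi k)).
  rewrite (_ : (fun x => 1 * u x + _) = u \- phi k)//.
  by apply/funext => x /=; ring.
pose f k x := `|u x - phi k x| `^ p + energy_density p w (dk k) x.
have mu1 k : lmeasurable Om (fun x => u x - phi k x).
  by have [[]] := Hd k.
have m1 k : lmeasurable Om (fun x => `|u x - phi k x| `^ p).
  exact: measurable_abs_pow.
have m2 k : lmeasurable Om (energy_density p w (dk k)).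
  apply: (energy_density_measurable hw) => i.
  exact: weak_gradient_measurable (Hd k).
have f0 k x : 0 <= f k x.
  by rewrite addr_ge0 ?powR_ge0// energy_density_ge0.
have If k : (\int[mu]_(x in Om) (f k x)%:E <= (1 / (2 ^ k.+1)%:R)%:E)%E.
  have [_ Hk] := Hphi k.
  have ex : exists g, is_weak_gradient Om (u \- phi k) g by exists (dk k).
  have ekE : ek k `^ p = 1 / (2 ^ k.+1)%:R.
    by rewrite /ek -powRrM mulVf ?gt_eqF// powRr1 ?divr_ge0.
  have h := sobolev_norm_lt p1 oO hw (ek0 k) ex Hk.
  have D : (\int[mu]_(x in Om) (f k x)%:E =
      \int[mu]_(x in Om) (`|(u \- phi k) x| `^ p)%:E +
      \int[mu]_(x in Om) (energy_density p w (dk k) x)%:E)%E.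
    apply: (@ge0_integralD _ T R mu Om mO (fun x : T => (`|u x - phi k x| `^ p)%:E)
      (fun x : T => (energy_density p w (dk k) x)%:E)).
    - by move=> x _; rewrite lee_fin powR_ge0.
    - by apply/measurable_EFinP; exact: m1.
    - by move=> x _; rewrite lee_fin energy_density_ge0.
    - by apply/measurable_EFinP; exact: m2.
  by rewrite D -(energyE oO hw (Hd k)) -ekE; exact: ltW.
have [H [iH aeH]] := summable_domination mO (fun k => measurable_funD (m1 k) (m2 k))
  f0 If.
exists phi, H; split => //.
have dE k x : wgrad Om u x - grad (phi k) x = dk k x.
  by rewrite /dk scale1r scaleN1r.
apply: leb_ae_mono2 aeH (pos_weight_ae hw) => x H1 H2 Ox.
have [fH fcvg] := H1 Ox; have [wE wp] := H2 Ox.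
have edf k : pos_weight w x * enorm (dk k x) `^ p <= f k x.
  by rewrite /f lerDr powR_ge0.
have pf k : 1 * `|u x - phi k x| `^ p <= f k x.
  by rewrite mul1r /f lerDl energy_density_ge0.
split.
- by move=> k; rewrite dE; exact: le_trans (edf k) (fH k).
- have := cvg0_powR ltr01 (fun k => normr_ge0 _) pf fcvg.
  by move/norm_cvg0P; exact: cvg_of_diff.
- move=> i.
  have wpp : 0 < pos_weight w x by rewrite wE.
  have := cvg0_powR wpp (fun k => enorm_ge0 (dk k x)) edf fcvg.
  move=> h.
  have : (wgrad Om u x ord0 i - grad (phi k) x ord0 i) @[k --> \oo] --> (0 : R).
    apply/norm_cvg0P; apply: (squeeze_cvgr _ (cvg_cst 0) h); apply: nearW => k.
    rewrite normr_ge0/=; have := le_coord_enorm (dk k x) i.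
    by rewrite -dE !mxE.
  exact: cvg_of_diff.
Qed.

End sobolev_approximation.

(** * Passing to the limit in integrals *)

Section limits_of_integrals.
Context d (T : measurableType d) (R : realType) (mu : {measure set T -> \bar R}).
Variable D : set T.
Hypothesis mD : measurable D.

Lemma fatou_bound (f : nat -> T -> R) (g : T -> R) (a : (\bar R)^nat) (l : \bar R) :
  (forall k, measurable_fun D (f k)) -> measurable_fun D g ->
  (forall k x, D x -> 0 <= f k x) -> (forall x, D x -> 0 <= g x) ->
  {ae mu, forall x, D x -> f k x @[k --> \oo] --> g x} ->
  (forall k, \int[mu]_(x in D) (f k x)%:E <= a k)%E ->
  a k @[k --> \oo] --> l -> (\int[mu]_(x in D) (g x)%:E <= l)%E.
Proof.
move=> mf mg f0 g0 fg fa al.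
have mef k : measurable_fun D (fun x => (f k x)%:E) by exact/measurable_EFinP/mf.
have [N [mN N0 sN]] := fg.
have meg : measurable_fun D (fun x => (g x)%:E) by exact/measurable_EFinP.
have eg0 x : D x -> (0 <= (g x)%:E)%E by move=> Dx; rewrite lee_fin g0.
rewrite (ge0_negligible_integral mN mD meg eg0 N0).
have mDN : measurable (D `\` N) by exact: measurableD.
have E x : D x -> ~ N x -> (g x)%:E = limn_einf (fun k => (f k x)%:E).
  move=> Dx Nx; have fgx : f k x @[k --> \oo] --> g x.
    by apply: contrapT => h; apply: Nx; apply: sN => /= /(_ Dx).
  have fgxe : (f k x)%:E @[k --> \oo] --> (g x)%:E by apply: cvg_EFin => //; exact: nearW.
  rewrite is_cvg_limn_einfE; last by apply/cvg_ex; exists (g x)%:E.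
  by apply/esym/cvg_lim.
rewrite (eq_integral (fun x => limn_einf (fun k => (f k x)%:E))); last first.
  by move=> x /[!inE] -[Dx Nx]; exact: E.
have mfN k : measurable_fun (D `\` N) (fun x => (f k x)%:E).
  by apply: measurable_funS (mef k) => // x [].
have f0N k x : (D `\` N) x -> (0 <= (f k x)%:E)%E.
  by move=> [Dx _]; rewrite lee_fin f0.
apply: (@le_trans _ _ (limn_einf (fun k => \int[mu]_(x in D `\` N) (f k x)%:E)%E)).
  exact: fatou.
rewrite -(cvg_lim _ al)// limn_einf_lim; apply: lee_lim.
- exact: is_cvg_einfs.
- by apply/cvg_ex; exists l.
apply: nearW => k; apply: le_trans (fa k).
apply: (@le_trans _ _ (\int[mu]_(x in D `\` N) (f k x)%:E)%E).
  by apply: ereal_inf_lbound; exists k => //=.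
apply: ge0_subset_integral => //.
- by move=> x Dx; rewrite lee_fin f0.
Qed.

Lemma dominated_limit (f : nat -> T -> R) (g h : T -> R) :
  (forall k, measurable_fun D (f k)) -> measurable_fun D g ->
  mu.-integrable D (EFin \o h) ->
  {ae mu, forall x, D x -> (forall k, `|f k x| <= h x) /\
    f k x @[k --> \oo] --> g x} ->
  (\int[mu]_(x in D) (f k x)%:E)%E @[k --> \oo] --> (\int[mu]_(x in D) (g x)%:E)%E.
Proof.
move=> mf mg ih H.
have H1 : {ae mu, forall x, D x -> (f k x)%:E @[k --> \oo] --> (g x)%:E}.
  apply: filterS H => x H Dx; have [_ fg] := H Dx.
  by apply: cvg_EFin => //; exact: nearW.
have H2 : {ae mu, forall x, forall k, D x -> (`|(f k x)%:E| <= (EFin \o h) x)%E}.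
  by apply: filterS H => x H k Dx; have [fh _] := H Dx; rewrite /= lee_fin.
have mef k : measurable_fun D (fun x => (f k x)%:E) by exact/measurable_EFinP/mf.
have meg : measurable_fun D (fun x => (g x)%:E) by exact/measurable_EFinP.
by have [] := dominated_convergence mD mef meg H1 ih H2.
Qed.

End limits_of_integrals.

Lemma powRD_le (R : realType) (p a b : R) : 0 < p -> 0 <= a -> 0 <= b ->
  (a + b) `^ p <= 2 `^ p * (a `^ p + b `^ p).
Proof.
move=> p0 a0 b0; wlog ab : a b a0 b0 / a <= b.
  move=> H; case: (leP a b) => [|/ltW] ab; first exact: H.
  by rewrite addrC [X in _ * X]addrC; exact: H.
apply: (@le_trans _ _ ((2 * b) `^ p)).
  by apply: ge0_ler_powR; rewrite ?nnegrE ?(ltW p0)//; lra.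
by rewrite powRM// ler_wpM2l ?powR_ge0// lerDr powR_ge0.
Qed.

(** The first term is enough if w z^(p-1) >= 1, and the second one otherwise.
    This turns integrability of w z^p into integrability of z. *)
Lemma weight_young (R : realType) (p w z : R) : 1 < p -> 0 < w -> 0 <= z ->
  z <= w * z `^ p + w `^ (- (p - 1)^-1).
Proof.
move=> p1 w0 z0; have [->|zn0] := eqVneq z 0.
  by rewrite addr_ge0 ?mulr_ge0 ?powR_ge0// ltW.
have zp : 0 < z by rewrite lt_def zn0.
have q0 : 0 < p - 1 by rewrite subr_gt0.
have zE : z `^ p = z * z `^ (p - 1).
  by rewrite -{2}(powRr1 z0) -powRD ?zn0 ?implybT//; congr (_ `^ _); ring.
have [h|h] := leP 1 (w * z `^ (p - 1)).
  apply: (@le_trans _ _ (w * z `^ p)); last by rewrite lerDl powR_ge0.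
  by rewrite zE mulrCA ler_peMr.
apply: (@le_trans _ _ (w `^ (- (p - 1)^-1))); last first.
  by rewrite lerDr mulr_ge0 ?powR_ge0// ltW.
have h' : z `^ (p - 1) <= w^-1 by rewrite -[leRHS]mul1r ler_pdivlMr// mulrC ltW.
have : (z `^ (p - 1)) `^ (p - 1)^-1 <= (w^-1) `^ (p - 1)^-1.
  by apply: ge0_ler_powR; rewrite ?nnegrE ?powR_ge0 ?invr_ge0 ?(ltW q0) ?(ltW w0).
rewrite -powRrM mulfV ?gt_eqF// powRr1//.
by rewrite -powR_inv1 ?(ltW w0)// -powRrM mulN1r.
Qed.

(** * Energies along approximating sequences *)

Section measurability.
Context {R : realType} {n : nat}.
Variables (Om : set 'rV[R]_n).
Local Notation T := (lebesgue_space R n).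

Lemma lmeasurableD (f g : 'rV[R]_n -> R) : lmeasurable Om f -> lmeasurable Om g ->
  lmeasurable Om (fun x => f x + g x).
Proof. exact: measurable_funD. Qed.

Lemma lmeasurableM (f g : 'rV[R]_n -> R) : lmeasurable Om f -> lmeasurable Om g ->
  lmeasurable Om (fun x => f x * g x).
Proof. exact: measurable_funM. Qed.

(** For t = 0 both sides of 1/t = t (t^2)^(-1) vanish by convention. *)
Lemma measurable_inv (f : 'rV[R]_n -> R) : lmeasurable Om f ->
  lmeasurable Om (fun x => (f x)^-1).
Proof.
move=> mf; rewrite /lmeasurable.
have -> : (fun x => (f x)^-1) = fun x => f x * (f x * f x) `^ (-1).
  apply/funext => x; have [->|fx] := eqVneq (f x) 0; first by rewrite invr0 mul0r.
  by rewrite powR_inv1 -?expr2 ?sqr_ge0//; field.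
have m1 : measurable_fun (Om : set T) (fun x => f x * f x) by exact: measurable_funM.
exact: (lmeasurableM mf (measurableT_comp (measurable_powR (-1)) m1)).
Qed.

Lemma measurable_neq0 (f : 'rV[R]_n -> R) : lmeasurable Om f ->
  lmeasurable Om (fun x => (f x != 0)%:R).
Proof.
move=> mf; rewrite /lmeasurable.
have -> : (fun x => (f x != 0)%:R) = fun x => f x * (f x)^-1.
  by apply/funext => x; have [->|fx] := eqVneq (f x) 0; rewrite ?mul0r// divff.
exact: (measurable_funM mf (measurable_inv mf)).
Qed.

Lemma measurable_deficit (p : R) (P Q : 'rV[R]_n -> R) (X Y : 'rV[R]_n -> 'rV[R]_n) :
  lmeasurable Om P -> lmeasurable Om Q ->
  (forall i, lmeasurable Om (fun x => X x ord0 i)) ->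
  (forall i, lmeasurable Om (fun x => Y x ord0 i)) ->
  lmeasurable Om (fun x => deficit p (P x) (Q x) (X x) (Y x)).
Proof.
move=> mP mQ mX mY.
have mXp := measurable_enorm_pow p mX; have mYp := measurable_enorm_pow p mY.
apply: measurable_funB.
  exact: (measurable_funD (measurable_funM mP mXp) (measurable_funM mQ mYp)).
apply: measurable_enorm_pow => i.
have m1 : measurable_fun (Om : set T) (fun x => P x + Q x) by exact: measurable_funD.
rewrite /lmeasurable.
have -> : (fun x => mean_grad p (P x) (Q x) (X x) (Y x) ord0 i) =
  fun x => (P x + Q x) `^ (p^-1 - 1) * (P x * X x ord0 i + Q x * Y x ord0 i).
  by apply/funext => x; rewrite !mxE.
have m2 : measurable_fun (Om : set T) (fun x => P x * X x ord0 i + Q x * Y x ord0 i).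
  exact: (measurable_funD (measurable_funM mP (mX i)) (measurable_funM mQ (mY i))).
have m3 : measurable_fun (Om : set T) (fun x => (P x + Q x) `^ (p^-1 - 1)).
  exact: (measurableT_comp (measurable_powR _) m1).
exact: (measurable_funM m3 m2).
Qed.

Hypothesis mO : measurable (Om : set T).
Local Notation mu := (leb R n).

Lemma leb_integralD (f g : 'rV[R]_n -> R) : lmeasurable Om f -> lmeasurable Om g ->
  (forall x, 0 <= f x) -> (forall x, 0 <= g x) ->
  (\int[mu]_(x in Om) (f x + g x)%:E =
   \int[mu]_(x in Om) (f x)%:E + \int[mu]_(x in Om) (g x)%:E)%E.
Proof.
move=> mf mg f0 g0.
apply: (@ge0_integralD _ T R mu Om mO (fun x : T => (f x)%:E) (fun x : T => (g x)%:E)).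
- by move=> x _; rewrite lee_fin.
- exact/measurable_EFinP.
- by move=> x _; rewrite lee_fin.
- exact/measurable_EFinP.
Qed.

Lemma leb_integral_le_ae (f g : 'rV[R]_n -> R) : lmeasurable Om f -> lmeasurable Om g ->
  (forall x, 0 <= f x) -> (forall x, 0 <= g x) -> ae_in Om (fun x => f x <= g x) ->
  (\int[mu]_(x in Om) (f x)%:E <= \int[mu]_(x in Om) (g x)%:E)%E.
Proof.
move=> mf mg f0 g0 fg.
have mef : measurable_fun (Om : set T) (fun x : T => (f x)%:E) by exact/measurable_EFinP.
have meg : measurable_fun (Om : set T) (fun x : T => (g x)%:E) by exact/measurable_EFinP.
apply: (@ae_ge0_le_integral _ T R mu Om mO (fun x : T => (f x)%:E)
  (fun x : T => (g x)%:E) _ mef _ meg).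
- by move=> x _; rewrite lee_fin.
- by move=> x _; rewrite lee_fin.
- by apply: leb_ae_mono fg => x h Ox; rewrite lee_fin; exact: h.
Qed.

Lemma leb_integral_le (f g : 'rV[R]_n -> R) : lmeasurable Om f -> lmeasurable Om g ->
  (forall x, 0 <= f x) -> (forall x, f x <= g x) ->
  (\int[mu]_(x in Om) (f x)%:E <= \int[mu]_(x in Om) (g x)%:E)%E.
Proof.
move=> mf mg f0 fg; apply: leb_integral_le_ae => //.
  by move=> x; exact: le_trans (f0 x) (fg x).
by apply: aeW => x _; exact: fg.
Qed.

Lemma leb_integralZ (c : R) (f : 'rV[R]_n -> R) : lmeasurable Om f -> 0 <= c ->
  (forall x, 0 <= f x) ->
  (\int[mu]_(x in Om) (c * f x)%:E = c%:E * \int[mu]_(x in Om) (f x)%:E)%E.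
Proof.
move=> mf c0 f0.
have mef : measurable_fun (Om : set T) (fun x : T => (f x)%:E) by exact/measurable_EFinP.
have f0' (x : T) : Om x -> (0 <= (f x)%:E)%E by move=> _; rewrite lee_fin.
exact: (ge0_integralZl_EFin mu mO f0' mef).
Qed.

End measurability.

Section energies_of_approximations.
Context {R : realType} {n : nat}.
Variables (Om : set 'rV[R]_n) (p : R) (w : 'rV[R]_n -> R).
Hypotheses (p1 : 1 < p) (oO : open Om) (hw : class_Ap Om p w).
Implicit Types (u v phi psi zeta : 'rV[R]_n -> R).
Local Notation mu := (leb R n).
Local Notation T := (lebesgue_space R n).

Let p0 : 0 < p. Proof. by apply: lt_trans p1. Qed.
Let mO : measurable (Om : set T) := open_lebesgue_measurable oO.

Lemma W1p0_weak_gradient u : W1p0 Om p w u -> is_weak_gradient Om u (wgrad Om u).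
Proof. by move=> [[Hu _] _]; exact: wgradP. Qed.

Lemma wgrad_measurable u i : W1p0 Om p w u ->
  lmeasurable Om (fun x => wgrad Om u x ord0 i).
Proof. by move=> /W1p0_weak_gradient; exact: weak_gradient_measurable. Qed.

Lemma W1p0_measurable u : W1p0 Om p w u -> lmeasurable Om u.
Proof. by move=> /W1p0_weak_gradient[[]]. Qed.

Lemma W1p0_energyE u : W1p0 Om p w u ->
  energy Om p w u = (\int[mu]_(x in Om) (energy_density p w (wgrad Om u) x)%:E)%E.
Proof. by move=> Hu; apply: energyE => //; exact: W1p0_weak_gradient. Qed.

Lemma W1p0_energy_integrable u : W1p0 Om p w u ->
  mu.-integrable (Om : set T) (EFin \o energy_density p w (wgrad Om u)).
Proof.
move=> Hu; have [[exg un] _] := Hu; apply/integrableP; split.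
  apply/measurable_EFinP/(energy_density_measurable hw) => i.
  exact: wgrad_measurable.
have -> : (\int[mu]_(x in Om) `|(EFin \o energy_density p w (wgrad Om u)) x| =
    energy Om p w u)%E.
  rewrite W1p0_energyE//; apply: eq_integral => x _ /=.
  by rewrite ger0_norm// energy_density_ge0.
have n0 : (0 <= sobolev_norm Om p w u)%E by exact: poweR_ge0.
pose e := fine (sobolev_norm Om p w u) + 1.
have e0 : 0 < e by rewrite ltr_wpDl// fine_ge0.
have ue : (sobolev_norm Om p w u < e%:E)%E.
  by rewrite /e EFinD fineK ?ge0_fin_numE// lteDl ?ge0_fin_numE// lte_fin.
apply: le_lt_trans (lt_le_trans (sobolev_norm_lt p1 oO hw e0 exg ue) (leey _)).
apply: leeDr; apply: integral_ge0 => x _; by rewrite lee_fin powR_ge0.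
Qed.

Lemma W1p0_energy_fin u : W1p0 Om p w u -> energy Om p w u \is a fin_num.
Proof.
move=> Hu; rewrite W1p0_energyE//.
exact: integrable_fin_num (W1p0_energy_integrable Hu).
Qed.

Lemma approx_energy_cvg u (phi : nat -> 'rV[R]_n -> R) (H : 'rV[R]_n -> R) :
  W1p0 Om p w u -> (forall k, test_function Om (phi k)) ->
  mu.-integrable (Om : set T) (EFin \o H) ->
  ae_in Om (fun x => [/\
    forall k, pos_weight w x * enorm (wgrad Om u x - grad (phi k) x) `^ p <= H x,
    phi k x @[k --> \oo] --> u x &
    forall i, grad (phi k) x ord0 i @[k --> \oo] --> wgrad Om u x ord0 i]) ->
  (\int[mu]_(x in Om) (energy_density p w (grad (phi k)) x)%:E)%E @[k --> \oo] -->
    energy Om p w u.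
Proof.
move=> Hu tphi iH aeH; rewrite W1p0_energyE//.
have iD : mu.-integrable (Om : set T)
    (EFin \o (fun x => 2 `^ p * (energy_density p w (wgrad Om u) x + H x))).
  apply: eq_integrable (integrableZl mO (2 `^ p)
    (integrableD mO (W1p0_energy_integrable Hu) iH)) => //.
apply: (@dominated_limit _ T R mu Om mO (fun k => energy_density p w (grad (phi k)))
  (energy_density p w (wgrad Om u)) _ _ _ iD).
- move=> k; apply: (energy_density_measurable hw) => i.
  by apply: grad_measurable => //; case: (tphi k).
- by apply: (energy_density_measurable hw) => i; exact: wgrad_measurable.
- apply: leb_ae_mono aeH => x h Ox; have [h1 _ h3] := h Ox; split; last first.
    apply: cvgM; first exact: cvg_cst.
    by apply: cvg_powR => // [k|]; [exact: enorm_ge0|exact: cvg_enorm].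
  move=> k; rewrite ger0_norm ?energy_density_ge0//.
  apply: (@le_trans _ _ (2 `^ p * (energy_density p w (wgrad Om u) x +
     pos_weight w x * enorm (wgrad Om u x - grad (phi k) x) `^ p))); last first.
    by rewrite ler_wpM2l ?powR_ge0// lerD2l.
  rewrite /energy_density -mulrDr mulrCA ler_wpM2l ?pos_weight_ge0//.
  apply: le_trans (powRD_le p0 (enorm_ge0 _) (enorm_ge0 _)).
  apply: ge0_ler_powR; rewrite ?nnegrE ?addr_ge0 ?enorm_ge0 ?(ltW p0)//.
  have -> : enorm (wgrad Om u x - grad (phi k) x) =
      enorm ((-1) *: (wgrad Om u x - grad (phi k) x)).
    by rewrite enormZ normrN1 mul1r.
  apply: le_trans (enormD _ _); rewrite scaleN1r opprB addrC subrK.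
  exact: lexx.
Qed.

End energies_of_approximations.

(** * Hidden convexity of the Rayleigh quotient *)

Section minimizers.
Context {R : realType} {n : nat}.
Variables (Om : set 'rV[R]_n) (p : R) (w b : 'rV[R]_n -> R).
Hypotheses (p1 : 1 < p) (oO : open Om) (hw : class_Ap Om p w).
Hypotheses (b0 : forall x, 0 <= b x) (mb : lmeasurable Om b).
Local Notation mu := (leb R n).
Local Notation T := (lebesgue_space R n).
Hypothesis min_test : forall phi, test_function Om phi ->
  (\int[mu]_(x in Om) (b x * `|phi x| `^ p)%:E <=
   \int[mu]_(x in Om) (energy_density p w (grad phi) x)%:E)%E.
Implicit Types (u v phi psi zeta : 'rV[R]_n -> R).

Let p0 : 0 < p. Proof. by apply: lt_trans p1. Qed.
Let mO : measurable (Om : set T) := open_lebesgue_measurable oO.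

Definition log_grad u x : 'rV[R]_n := (u x)^-1 *: wgrad Om u x.

(** By the convention 0^-1 = 0 the logarithmic gradient is defined everywhere.
    The first two factors restrict to the points where the regularized
    logarithmic gradients converge. *)
Definition deficit_density u v x : R := (u x != 0)%:R * (v x != 0)%:R *
  (pos_weight w x *
   deficit p (`|u x| `^ p) (`|v x| `^ p) (log_grad u x) (log_grad v x)).

Lemma deficit_density_ge0 u v x : 0 <= deficit_density u v x.
Proof.
rewrite /deficit_density; have [->|ux] := eqVneq (u x) 0; first by rewrite !mul0r.
have [->|vx] := eqVneq (v x) 0; first by rewrite !(mul0r, mulr0).
rewrite !mul1r mulr_ge0 ?pos_weight_ge0//.
by apply: deficit_ge0 => //; rewrite powR_gt0// normr_gt0.
Qed.

Lemma log_grad_measurable u i : W1p0 Om p w u ->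
  lmeasurable Om (fun x => log_grad u x ord0 i).
Proof.
move=> Hu; rewrite (_ : (fun x => _) = fun x => (u x)^-1 * wgrad Om u x ord0 i).
  apply: lmeasurableM; last exact: wgrad_measurable Hu.
  by apply: measurable_inv; exact: W1p0_measurable Hu.
by apply/funext => x; rewrite mxE.
Qed.

Lemma deficit_density_measurable u v : W1p0 Om p w u -> W1p0 Om p w v ->
  lmeasurable Om (deficit_density u v).
Proof.
move=> Hu Hv; have mu' := W1p0_measurable Hu; have mv := W1p0_measurable Hv.
have mup := measurable_abs_pow p mu'; have mvp := measurable_abs_pow p mv.
apply: lmeasurableM.
  by apply: lmeasurableM; exact: measurable_neq0.
apply: lmeasurableM; first exact: pos_weight_measurable hw.
by apply: measurable_deficit => // i; exact: log_grad_measurable.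
Qed.

(** The competitor preserves the sum of the weighted p-th powers up to
    regularization and lowers the sum of the energies by the deficit;
    minimality, applied to the competitors of approximating test functions,
    bounds this loss. *)
Lemma hidden_convexity u v : W1p0 Om p w u -> W1p0 Om p w v ->
  (\int[mu]_(x in Om) (deficit_density u v x)%:E +
   \int[mu]_(x in Om) (b x * `|u x| `^ p)%:E +
   \int[mu]_(x in Om) (b x * `|v x| `^ p)%:E <=
   energy Om p w u + energy Om p w v)%E.
Proof.
move=> Hu Hv.
have [phi [H [tphi iH aeH]]] := W1p0_approx p1 oO hw Hu.
have [psi [K [tpsi iK aeK]]] := W1p0_approx p1 oO hw Hv.
have sphi k : smooth (phi k) by case: (tphi k).
have spsi k : smooth (psi k) by case: (tpsi k).
(* The regularization parameter is tied to the index of the approximation. *)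
pose e (k : nat) : R := k.+1%:R^-1.
have e0 k : 0 < e k by rewrite invr_gt0.
have el : e k @[k --> \oo] --> (0 : R) by exact: cvg_invn0.
pose F k x := competitor p (e k) (phi k x) (psi k x).
have tF k : test_function Om (F k).
  apply: (test_function_supp (tphi k) (tpsi k)); first exact: smooth_competitor.
  by move=> x; rewrite /F => -> ->; rewrite competitor0.
have sF k : smooth (F k) by case: (tF k).
have F0 k x : 0 <= F k x by exact: competitor_ge0.
pose X k x := (phi k x / (phi k x ^+ 2 + e k ^+ 2)) *: grad (phi k) x.
pose Y k x := (psi k x / (psi k x ^+ 2 + e k ^+ 2)) *: grad (psi k) x.
pose P k x := reg_pow p (e k) (phi k x).
pose Q k x := reg_pow p (e k) (psi k x).
pose D k x := pos_weight w x * deficit p (P k x) (Q k x) (X k x) (Y k x).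
have D0 k x : 0 <= D k x.
  by rewrite mulr_ge0 ?pos_weight_ge0// deficit_ge0// reg_pow_gt0.
have ms f : smooth f -> lmeasurable Om f.
  by move=> sf; apply: continuous_lmeasurable => //; exact: smooth_continuous.
have mX f k : smooth f -> forall i, lmeasurable Om (fun x =>
    ((f x / (f x ^+ 2 + e k ^+ 2)) *: grad f x) ord0 i).
  move=> sf i; rewrite (_ : (fun x => _) =
      fun x => f x * (f x * f x + e k ^+ 2)^-1 * grad f x ord0 i).
    apply: lmeasurableM; last exact: grad_measurable.
    apply: lmeasurableM; first exact: ms.
    apply: measurable_inv; apply: lmeasurableD; last exact: measurable_cst.
    by apply: lmeasurableM; exact: ms.
  by apply/funext => x; rewrite !mxE.
have mD k : lmeasurable Om (D k).
  apply: lmeasurableM; first exact: pos_weight_measurable hw.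
  apply: measurable_deficit; last 2 first.
  - exact: mX.
  - exact: mX.
  - by apply: ms; exact: smooth_reg_pow.
  - by apply: ms; exact: smooth_reg_pow.
have mF k : lmeasurable Om (fun x => b x * F k x `^ p).
  apply: lmeasurableM; first exact: mb.
  rewrite (_ : (fun x => _) = fun x => `|F k x| `^ p).
    by apply: measurable_abs_pow; exact: ms.
  by apply/funext => x; rewrite ger0_norm.
have mE f : smooth f -> lmeasurable Om (energy_density p w (grad f)).
  by move=> sf; apply: (energy_density_measurable hw) => i; exact: grad_measurable.
have bF0 k x : 0 <= b x * F k x `^ p by rewrite mulr_ge0 ?powR_ge0.
pose chi x : R := (u x != 0)%:R * (v x != 0)%:R.
have chi01 x : 0 <= chi x <= 1.
  by rewrite /chi; case: (u x != 0); case: (v x != 0); rewrite !(mul0r, mulr0, mul1r) ?lexx ?ler01.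
have mchi : lmeasurable Om chi.
  exact: (lmeasurableM (measurable_neq0 (W1p0_measurable Hu))
    (measurable_neq0 (W1p0_measurable Hv))).
pose f k x := chi x * D k x + b x * F k x `^ p.
pose g x := deficit_density u v x + (b x * `|u x| `^ p + b x * `|v x| `^ p).
have mg1 : lmeasurable Om (fun x => b x * `|u x| `^ p).
  by apply: (lmeasurableM mb); apply: measurable_abs_pow; exact: W1p0_measurable Hu.
have mg2 : lmeasurable Om (fun x => b x * `|v x| `^ p).
  by apply: (lmeasurableM mb); apply: measurable_abs_pow; exact: W1p0_measurable Hv.
have g10 x : 0 <= b x * `|u x| `^ p by rewrite mulr_ge0 ?powR_ge0.
have g20 x : 0 <= b x * `|v x| `^ p by rewrite mulr_ge0 ?powR_ge0.
have mdd := deficit_density_measurable Hu Hv.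
have dd0 := deficit_density_ge0 u v.
have -> : (\int[mu]_(x in Om) (deficit_density u v x)%:E +
   \int[mu]_(x in Om) (b x * `|u x| `^ p)%:E +
   \int[mu]_(x in Om) (b x * `|v x| `^ p)%:E = \int[mu]_(x in Om) (g x)%:E)%E.
  rewrite (leb_integralD mO mdd (lmeasurableD mg1 mg2))//; last first.
    by move=> x; rewrite addr_ge0.
  by rewrite (leb_integralD mO mg1 mg2)// addeA.
have cvgE : (\int[mu]_(x in Om) (energy_density p w (grad (phi k)) x)%:E +
    \int[mu]_(x in Om) (energy_density p w (grad (psi k)) x)%:E)%E @[k --> \oo] -->
    (energy Om p w u + energy Om p w v)%E.
  apply: cvgeD.
  - by apply: fin_num_adde_defl; exact: W1p0_energy_fin Hv.
  - exact: approx_energy_cvg iH aeH.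
  - exact: approx_energy_cvg iK aeK.
apply: (fatou_bound mO (f := f) _ _ _ _ _ _ cvgE).
- by move=> k; exact: (lmeasurableD (lmeasurableM mchi (mD k)) (mF k)).
- exact: (lmeasurableD mdd (lmeasurableD mg1 mg2)).
- move=> k x _; rewrite addr_ge0// mulr_ge0//.
  by have /andP[] := chi01 x.
- by move=> x _; rewrite !addr_ge0.
- apply: leb_ae_mono2 aeH aeK => x hx kx Ox.
  have [_ h2 h3] := hx Ox; have [_ k2 k3] := kx Ox.
  apply: cvgD; last first.
    rewrite -mulrDr; apply: cvgM; first exact: cvg_cst.
    exact: cvg_competitor.
  rewrite /chi /deficit_density.
  have [ux|ux] := eqVneq (u x) 0.
    by under eq_fun do rewrite !mul0r; rewrite !mul0r; exact: cvg_cst.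
  have [vx|vx] := eqVneq (v x) 0.
    by under eq_fun do rewrite mulr0 mul0r; rewrite mulr0 mul0r; exact: cvg_cst.
  apply: cvgM; first exact: cvg_cst.
  apply: cvgM; first exact: cvg_cst.
  apply: cvg_deficit => //.
  + by rewrite powR_gt0// normr_gt0.
  + by rewrite powR_gt0// normr_gt0.
  + exact: cvg_reg_pow.
  + exact: cvg_reg_pow.
  + move=> i; rewrite mxE; under eq_fun do rewrite mxE.
    by apply: cvgM; [exact: cvg_sqr_ratio|exact: h3].
  + move=> i; rewrite mxE; under eq_fun do rewrite mxE.
    by apply: cvgM; [exact: cvg_sqr_ratio|exact: k3].
move=> k.
have ed0 h x : 0 <= energy_density p w (grad h) x by exact: energy_density_ge0.
rewrite -(leb_integralD mO (mE _ (sphi k)) (mE _ (spsi k)) (ed0 _) (ed0 _)).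
apply: (@le_trans _ _ (\int[mu]_(x in Om) (D k x + b x * F k x `^ p)%:E)%E).
  apply: (leb_integral_le mO).
  - exact: (lmeasurableD (lmeasurableM mchi (mD k)) (mF k)).
  - exact: (lmeasurableD (mD k) (mF k)).
  - by move=> x; rewrite addr_ge0// mulr_ge0//; have /andP[] := chi01 x.
  - by move=> x; rewrite lerD2r ler_piMl//; have /andP[] := chi01 x.
rewrite (leb_integralD mO (mD k) (mF k) (D0 k) (bF0 k)).
apply: (@le_trans _ _ (\int[mu]_(x in Om) (D k x)%:E +
    \int[mu]_(x in Om) (energy_density p w (grad (F k)) x)%:E)%E).
  rewrite leeD2l//; apply: le_trans (min_test (tF k)).
  rewrite le_eqVlt; apply/orP; left; apply/eqP; apply: eq_integral => x _.
  by rewrite ger0_norm.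
rewrite -(leb_integralD mO (mD k) (mE _ (sF k)) (D0 k) (ed0 _)).
apply: (leb_integral_le mO).
- exact: (lmeasurableD (mD k) (mE _ (sF k))).
- exact: (lmeasurableD (mE _ (sphi k)) (mE _ (spsi k))).
- by move=> x; rewrite addr_ge0.
have scale (c d1 d2 d3 d4 : R) : 0 <= c -> d1 + d2 <= d3 + d4 ->
    c * d2 + c * d1 <= c * d3 + c * d4.
  by move=> c0 dd; rewrite -!mulrDr ler_wpM2l// addrC.
move=> x; exact: (scale _ _ _ _ _ (pos_weight_ge0 w x)
  (competitor_energy_le p1 x (e0 k) (sphi k) (spsi k))).
Qed.

(** For a minimizer u the energy and the weighted p-th power of u cancel. *)
Lemma minimizer_deficit u v : W1p0 Om p w u -> W1p0 Om p w v ->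
  energy Om p w u = (\int[mu]_(x in Om) (b x * `|u x| `^ p)%:E)%E ->
  (\int[mu]_(x in Om) (deficit_density u v x)%:E +
   \int[mu]_(x in Om) (b x * `|v x| `^ p)%:E <= energy Om p w v)%E.
Proof.
move=> Hu Hv Eu; have Ef := W1p0_energy_fin p1 oO hw Hu.
have cancel (a c d e : \bar R) : e \is a fin_num ->
    (a + e + c <= e + d -> a + c <= d)%E.
  by move=> ef; rewrite addeAC [X in (X <= _)%E]addeC leeD2lE.
by apply: (cancel _ _ _ _ Ef); rewrite {1}Eu; exact: hidden_convexity.
Qed.

End minimizers.

(** * The logarithmic Caccioppoli estimate *)

Section log_caccioppoli.
Context {R : realType} {n : nat}.
Variables (Om : set 'rV[R]_n) (p : R) (w b : 'rV[R]_n -> R).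
Hypotheses (p1 : 1 < p) (oO : open Om) (hw : class_Ap Om p w).
Hypotheses (b0 : forall x, 0 <= b x) (mb : lmeasurable Om b).
Local Notation mu := (leb R n).
Local Notation T := (lebesgue_space R n).
Hypothesis min_test : forall phi, test_function Om phi ->
  (\int[mu]_(x in Om) (b x * `|phi x| `^ p)%:E <=
   \int[mu]_(x in Om) (energy_density p w (grad phi) x)%:E)%E.
Implicit Types (u v phi psi zeta : 'rV[R]_n -> R).

Let p0 : 0 < p. Proof. by apply: lt_trans p1. Qed.
Let mO : measurable (Om : set T) := open_lebesgue_measurable oO.

Definition log_energy u zeta x : R :=
  pos_weight w x * (`|zeta x| `^ p * enorm (log_grad Om u x) `^ p).

Lemma log_energy_ge0 u zeta x : 0 <= log_energy u zeta x.
Proof. by rewrite !mulr_ge0 ?pos_weight_ge0 ?powR_ge0. Qed.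

Lemma log_energy_measurable u zeta : W1p0 Om p w u -> lmeasurable Om zeta ->
  lmeasurable Om (log_energy u zeta).
Proof.
move=> Hu mz; apply: lmeasurableM; first exact: pos_weight_measurable hw.
apply: lmeasurableM; first exact: measurable_abs_pow.
by apply: measurable_enorm_pow => i; exact: log_grad_measurable Hu.
Qed.

Lemma measurable_ler (f g : 'rV[R]_n -> R) : lmeasurable Om f -> lmeasurable Om g ->
  lmeasurable Om (fun x => ((f x <= g x)%R : bool)%:R).
Proof.
move=> mf mg; pose h x := Num.max (f x + (-1) * g x) 0.
have mc c : lmeasurable Om (fun=> c : R) by exact: measurable_cst.
have mh : lmeasurable Om h.
  apply: measurable_maxr; last exact: mc.
  exact: (lmeasurableD mf (lmeasurableM (mc (-1)) mg)).
have -> : (fun x => ((f x <= g x)%R : bool)%:R) = (fun x => 1 + (-1) * (h x != 0)%:R : R).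
  apply/funext => x; rewrite /h (mulN1r (g x)); have [fg|gf] := leP (f x) (g x).
    have /max_idPr -> : f x - g x <= 0 by rewrite subr_le0.
    by rewrite eqxx mulr0 addr0.
  have /max_idPl -> : 0 <= f x - g x by rewrite subr_ge0 ltW.
  by rewrite subr_eq0 (gt_eqF gf) mulr1 subrr.
exact: (lmeasurableD (mc 1) (lmeasurableM (mc (-1)) (measurable_neq0 mh))).
Qed.

(** The lower bound deficit_low with P = |u|^p and Q = |t zeta|^p, divided by
    t^p; the indicator function expresses the condition Q <= small_ratio P. *)
Lemma log_energy_low u zeta (t : R) x : 0 < t ->
  log_grad Om (fun y => t * zeta y) x = (zeta x)^-1 *: grad zeta x ->
  ((t `^ p * `|zeta x| `^ p <= small_ratio p * `|u x| `^ p)%R : bool)%:R * log_energy u zeta x <=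
  (low_cst p * t `^ p)^-1 * deficit_density Om p w u (fun y => t * zeta y) x +
  high_cst p / low_cst p * energy_density p w (grad zeta) x.
Proof.
move=> t0 E.
have lc := low_cst_gt0 p1; have hc := high_cst_gt0 p1.
have tp : 0 < t `^ p by rewrite powR_gt0.
have rhs0 : 0 <= (low_cst p * t `^ p)^-1 * deficit_density Om p w u (fun y => t * zeta y) x +
    high_cst p / low_cst p * energy_density p w (grad zeta) x.
  have h1 := deficit_density_ge0 Om w p1 u (fun y => t * zeta y) x.
  have h2 := energy_density_ge0 p w (grad zeta) x.
  apply: addr_ge0; apply: mulr_ge0 => //.
    by rewrite invr_ge0 mulr_ge0 ?(ltW lc) ?(ltW tp).
  by rewrite divr_ge0 ?(ltW lc) ?(ltW hc).
have [h|_] := boolP (t `^ p * `|zeta x| `^ p <= _); last by rewrite mul0r.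
rewrite mul1r; have [ux|ux] := eqVneq (u x) 0.
  rewrite /log_energy /log_grad ux invr0 scale0r enorm0 powR0 ?gt_eqF//.
  by rewrite !mulr0.
have [zx|zx] := eqVneq (zeta x) 0.
  by rewrite /log_energy zx normr0 powR0 ?gt_eqF// mul0r mulr0.
have tz : t * zeta x != 0 by rewrite mulf_neq0// gt_eqF.
have QE : `|t * zeta x| `^ p = t `^ p * `|zeta x| `^ p.
  by rewrite normrM (gtr0_norm t0) powRM// ltW.
have -> : deficit_density Om p w u (fun y => t * zeta y) x = pos_weight w x *
    deficit p (`|u x| `^ p) (t `^ p * `|zeta x| `^ p) (log_grad Om u x)
      ((zeta x)^-1 *: grad zeta x).
  by rewrite /deficit_density E ux tz QE (mul1r 1) mul1r.
have P0 : 0 < `|u x| `^ p by rewrite powR_gt0// normr_gt0.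
have Q0 : 0 < t `^ p * `|zeta x| `^ p by rewrite mulr_gt0// powR_gt0// normr_gt0.
have := deficit_low p1 (log_grad Om u x) ((zeta x)^-1 *: grad zeta x) P0 Q0 h.
have -> : t `^ p * `|zeta x| `^ p * enorm ((zeta x)^-1 *: grad zeta x) `^ p =
    t `^ p * enorm (grad zeta x) `^ p.
  rewrite enormZ powRM ?enorm_ge0// -mulrA; congr (_ * _); rewrite mulrA -powRM//.
  by rewrite -normrM mulfV// normr1 powR1 mul1r.
rewrite /log_energy /energy_density.
set W := pos_weight w x; set A := `|zeta x| `^ p; set L := enorm _ `^ p.
set D := deficit _ _ _ _ _; set G := enorm _ `^ p => H.
have k0 : 0 <= W * (low_cst p * t `^ p)^-1.
  by rewrite mulr_ge0 ?pos_weight_ge0// invr_ge0 mulr_ge0 ?(ltW lc) ?(ltW tp).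
have := ler_wpM2l k0 H.
set l := low_cst p in lc *; set hh := high_cst p; set s := t `^ p in tp *.
have -> : W * (l * s)^-1 * (l * (s * A * L)) = W * (A * L).
  by field; rewrite !gt_eqF.
have -> // : W * (l * s)^-1 * (D + hh * (s * G)) = (l * s)^-1 * (W * D) + hh / l * (W * G).
by field; rewrite !gt_eqF.
Qed.

Lemma gradZ (t : R) zeta x : smooth zeta ->
  grad (fun y => t * zeta y) x = t *: grad zeta x.
Proof.
move=> zs; apply/rowP => i; rewrite !mxE.
rewrite (test_partialM i x (@smooth_cst R n t) zs).
by rewrite [partial i (fun=> t) x]derive_cst mulr0 addr0.
Qed.

(** The deficit of u and t zeta is at most the energy of t zeta, of order t^p,
    while log_energy_low bounds it below by t^p times the energy density of
    the logarithm, on sets that exhaust the set where u does not vanish as t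
    tends to 0. *)
Lemma log_caccioppoli u zeta : W1p0 Om p w u ->
  energy Om p w u = (\int[mu]_(x in Om) (b x * `|u x| `^ p)%:E)%E ->
  test_function Om zeta ->
  mu.-integrable (Om : set T) (EFin \o log_energy u zeta).
Proof.
move=> Hu Eu tz; have [zs _ _] := tz.
have mz : lmeasurable Om zeta.
  exact: (continuous_lmeasurable oO (smooth_continuous zs)).
have mu' := W1p0_measurable Hu.
have mL := log_energy_measurable Hu mz; have L0 := log_energy_ge0 u zeta.
have lc := low_cst_gt0 p1; have hc := high_cst_gt0 p1.
have mc c : lmeasurable Om (fun=> c : R) by exact: measurable_cst.
pose Z := energy_density p w (grad zeta).
have Z0 x : 0 <= Z x by exact: energy_density_ge0.
have mZ : lmeasurable Om Z.
  by apply: (energy_density_measurable hw) => i; exact: grad_measurable.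
pose E := (\int[mu]_(x in Om) (Z x)%:E)%E.
have Ef : E \is a fin_num.
  exact: (integrable_fin_num mO (test_energy_integrable p1 oO hw tz)).
pose M := ((low_cst p)^-1%:E * E + (high_cst p / low_cst p)%:E * E)%E.
have Mf : M \is a fin_num by rewrite fin_numD !fin_numM.
pose t (k : nat) : R := k.+1%:R^-1.
have t0 k : 0 < t k by rewrite invr_gt0.
have tl : t k @[k --> \oo] --> (0 : R) by exact: cvg_invn0.
pose chi k x : R := ((t k `^ p * `|zeta x| `^ p <= small_ratio p * `|u x| `^ p)%R : bool)%:R.
have mchi k : lmeasurable Om (chi k).
  by apply: measurable_ler; apply: (lmeasurableM (mc _)); exact: measurable_abs_pow.
have chi0 k x : 0 <= chi k x by exact: ler0n.
have bound k : (\int[mu]_(x in Om) (chi k x * log_energy u zeta x)%:E <= M)%E.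
  have tp0 : 0 < t k `^ p by rewrite powR_gt0.
  pose v y := t k * zeta y.
  have tv : test_function Om v by exact: test_functionZ.
  have Hv : W1p0 Om p w v by exact: test_W1p0.
  have mdd := deficit_density_measurable hw Hu Hv.
  have dd0 := deficit_density_ge0 Om w p1 u v.
  have c10 : 0 <= (low_cst p * t k `^ p)^-1 by rewrite invr_ge0; exact/ltW/mulr_gt0.
  have c20 : 0 <= high_cst p / low_cst p by exact/ltW/divr_gt0.
  pose r1 x := (low_cst p * t k `^ p)^-1 * deficit_density Om p w u v x.
  pose r2 x := high_cst p / low_cst p * Z x.
  have r10 x : 0 <= r1 x by rewrite mulr_ge0.
  have r20 x : 0 <= r2 x by rewrite mulr_ge0.
  have mr1 : lmeasurable Om r1 by exact: (lmeasurableM (mc _) mdd).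
  have mr2 : lmeasurable Om r2 by exact: (lmeasurableM (mc _) mZ).
  apply: (@le_trans _ _ (\int[mu]_(x in Om) (r1 x + r2 x)%:E)%E).
    apply: (leb_integral_le_ae mO (lmeasurableM (mchi k) mL) (lmeasurableD mr1 mr2)).
    - by move=> x; rewrite mulr_ge0.
    - by move=> x; rewrite addr_ge0.
    - have vs : smooth v by case: tv.
      apply: leb_ae_mono (wgrad_ae oO (smooth_weak_gradient oO vs)) => x hx Ox.
      apply: (log_energy_low u (t0 k)).
      have tn0 : t k != 0 by exact: lt0r_neq0.
      rewrite /log_grad (hx Ox) (gradZ _ _ zs) scalerA invfM.
      by rewrite -mulrA mulrCA (mulVf tn0) mulr1.
  rewrite (leb_integralD mO mr1 mr2 r10 r20).
  rewrite (leb_integralZ mO mdd c10 dd0) (leb_integralZ mO mZ c20 Z0) leeD2r//.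
  have Ev : energy Om p w v = ((t k `^ p)%:E * E)%E.
    rewrite (test_energyE oO hw tv) -(leb_integralZ mO mZ (ltW tp0) Z0).
    apply: eq_integral => x _; congr (_%:E).
    rewrite /Z /energy_density gradZ// enormZ (gtr0_norm (t0 k)).
    by rewrite powRM ?enorm_ge0 ?(ltW (t0 k))// mulrCA.
  have h : (\int[mu]_(x in Om) (deficit_density Om p w u v x)%:E <= (t k `^ p)%:E * E)%E.
    rewrite -Ev; apply: le_trans (minimizer_deficit p1 oO hw b0 mb min_test Hu Hv Eu).
    by apply: leeDl; apply: integral_ge0 => x _; rewrite lee_fin mulr_ge0 ?powR_ge0.
  apply: (@le_trans _ _ ((low_cst p * t k `^ p)^-1%:E * ((t k `^ p)%:E * E))%E).
    by apply: lee_wpmul2l => //; rewrite lee_fin.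
  rewrite muleA -EFinM invfM -mulrA mulVf ?mulr1//.
  by rewrite gt_eqF.
have lim x : chi k x * log_energy u zeta x @[k --> \oo] --> log_energy u zeta x.
  have [ux|ux] := eqVneq (u x) 0.
    have -> : log_energy u zeta x = 0.
      by rewrite /log_energy /log_grad ux invr0 scale0r enorm0 powR0 ?gt_eqF// !mulr0.
    by under eq_fun do rewrite mulr0; exact: cvg_cst.
  have tz0 : t k `^ p * `|zeta x| `^ p @[k --> \oo] --> (0 : R).
    rewrite -(mul0r (`|zeta x| `^ p)); apply: cvgM; last exact: cvg_cst.
    rewrite -[X in _ --> X](powR0 (lt0r_neq0 p0)).
    exact: (cvg_powR p0 (fun k => ltW (t0 k)) tl).
  apply: cvg_near_cst.
  have s0 : 0 < small_ratio p * `|u x| `^ p.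
    by apply: (mulr_gt0 (small_ratio_gt0 p1)); apply: powR_gt0; rewrite normr_gt0.
  near=> k; rewrite /chi (_ : (_ <= _)%R = true) ?mul1r//.
  apply/ltW; near: k; exact: cvgr_lt tz0 _ s0.
apply/integrableP; split; first exact/measurable_EFinP.
have -> : (\int[mu]_(x in Om) `|(EFin \o log_energy u zeta) x| =
    \int[mu]_(x in Om) (log_energy u zeta x)%:E)%E.
  by apply: eq_integral => x _ /=; rewrite ger0_norm.
apply: (@le_lt_trans _ _ M); last by rewrite ltey_eq Mf.
apply: (@fatou_bound _ T R mu Om mO (fun k x => chi k x * log_energy u zeta x)
  (log_energy u zeta) (fun=> M) M).
- by move=> k; exact: (lmeasurableM (mchi k) mL).
- exact: mL.
- by move=> k x _; rewrite mulr_ge0.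
- by move=> x _.
- by apply: aeW => x _; exact: lim.
- exact: bound.
- exact: cvg_cst.
Unshelve. all: by end_near. Qed.

End log_caccioppoli.

(** * Quotients of proportional functions *)

Section quotients.
Context {R : realType}.
Variables (al be : R).
Implicit Types (e a b x y : R).

(** As e tends to 0 this becomes a (al a + be b) / (a^2 + b^2), a function of
    the ratio b / a only. *)
Definition quot e a b : R := a * (al * a + be * b) / (a ^+ 2 + b ^+ 2 + e ^+ 2).

(** The derivative of quot e at (a, b) in the direction (x, y). *)
Definition dquot e a b x y : R :=
  (x * (al * a + be * b) + a * (al * x + be * y)) / (a ^+ 2 + b ^+ 2 + e ^+ 2) -
  a * (al * a + be * b) * (2 * (a * x + b * y)) / (a ^+ 2 + b ^+ 2 + e ^+ 2) ^+ 2.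

Let K : R := `|al| + `|be|.
Let K0 : 0 <= K. Proof. by rewrite addr_ge0. Qed.

Lemma quot_den_gt0 e a b : 0 < e -> 0 < a ^+ 2 + b ^+ 2 + e ^+ 2.
Proof. by move=> e0; rewrite ltr_wpDl ?exprn_gt0// addr_ge0 ?sqr_ge0. Qed.

Let prod_bound a b : `|a * b| <= (a ^+ 2 + b ^+ 2) / 2.
Proof.
have h1 := sqr_ge0 (a - b); have h2 := sqr_ge0 (a + b).
rewrite ler_norml; apply/andP; split; lra.
Qed.

Let num_bound a b : `|a * (al * a + be * b)| <= K * (a ^+ 2 + b ^+ 2).
Proof.
rewrite mulrDr (le_trans (ler_normD _ _))// /K mulrDl lerD//.
  rewrite mulrCA normrM ler_wpM2l// -expr2 ger0_norm ?sqr_ge0//.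
  by rewrite lerDl sqr_ge0.
rewrite mulrCA normrM ler_wpM2l//; apply: le_trans (prod_bound a b) _.
have := sqr_ge0 a; have := sqr_ge0 b; lra.
Qed.

Let abs_bound e a b : 0 < e -> `|a| <= (a ^+ 2 + b ^+ 2 + e ^+ 2) / e.
Proof.
move=> e0; rewrite ler_pdivlMr// -{1}(gtr0_norm e0) -normrM.
apply: le_trans (prod_bound a e) _.
have := sqr_ge0 a; have := sqr_ge0 b; have := sqr_ge0 e; lra.
Qed.

Lemma quot_bound e a b : `|quot e a b| <= K.
Proof.
have h0 : 0 <= a ^+ 2 + b ^+ 2 + e ^+ 2 by rewrite !addr_ge0 ?sqr_ge0.
rewrite /quot normrM normfV (ger0_norm h0); have [->|sn0] := eqVneq (a ^+ 2 + b ^+ 2 + e ^+ 2) 0.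
  by rewrite invr0 mulr0.
rewrite ler_pdivrMr ?lt_def ?sn0//.
by apply: le_trans (num_bound a b) _; rewrite ler_wpM2l// lerDl sqr_ge0.
Qed.

Lemma dquot_bound e a b x y : 0 < e ->
  `|dquot e a b x y| <= 4 * K / e * (`|x| + `|y|).
Proof.
move=> e0; have s0 := quot_den_gt0 a b e0.
have ha := abs_bound a b e0.
have hb : `|b| <= (a ^+ 2 + b ^+ 2 + e ^+ 2) / e.
  by rewrite [a ^+ 2 + _]addrC; exact: abs_bound.
have hn : `|a * (al * a + be * b)| <= K * (a ^+ 2 + b ^+ 2 + e ^+ 2).
  by apply: le_trans (num_bound a b) _; rewrite ler_wpM2l// lerDl sqr_ge0.
rewrite /dquot; set s := a ^+ 2 + b ^+ 2 + e ^+ 2 in s0 ha hb hn *.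
have comb c d M : 0 <= M -> `|c| <= M -> `|d| <= M -> `|al * c + be * d| <= K * M.
  move=> M0 cM dM; apply: le_trans (ler_normD _ _) _.
  by rewrite /K mulrDl !normrM lerD// ler_wpM2l.
have xy : `|x| <= `|x| + `|y| by rewrite lerDl.
have yx : `|y| <= `|x| + `|y| by rewrite lerDr.
set B := `|x| + `|y| in xy yx *; have B0 : 0 <= B by rewrite addr_ge0.
have se0 : 0 <= s / e by rewrite divr_ge0 ?ltW.
have h1 : `|x * (al * a + be * b)| <= B * (K * (s / e)).
  by rewrite normrM ler_pM// comb.
have h2 : `|a * (al * x + be * y)| <= s / e * (K * B).
  by rewrite normrM ler_pM// comb.
have h3 : `|2 * (a * x + b * y)| <= 2 * (s / e * B).
  rewrite normrM (ger0_norm (_ : 0 <= 2)) ?ler0n// ler_wpM2l//.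
  apply: le_trans (ler_normD _ _) _; rewrite !normrM /B mulrDr.
  by rewrite lerD// ler_wpM2r.
apply: le_trans (ler_normB _ _) _.
rewrite !normrM !normfV normrX (gtr0_norm s0).
have t1 : `|x * (al * a + be * b) + a * (al * x + be * y)| / s <=
    (B * (K * (s / e)) + s / e * (K * B)) / s.
  rewrite ler_pM2r ?invr_gt0//; apply: le_trans (ler_normD _ _) _.
  exact: lerD.
have t2 : `|a * (al * a + be * b)| * `|2 * (a * x + b * y)| / s ^+ 2 <=
    K * s * (2 * (s / e * B)) / s ^+ 2.
  by rewrite ler_pM2r ?invr_gt0 ?exprn_gt0// ler_pM.
move: t1 t2; rewrite !normrM => t1 t2.
apply: le_trans (lerD t1 t2) _; rewrite le_eqVlt; apply/orP; left; apply/eqP.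
by field; rewrite !gt_eqF.
Qed.

(** For e = 0 the quotient is homogeneous of degree 0, so that by Euler's
    identity its derivative along (a, b) vanishes: only the regularization
    contributes. *)
Lemma dquot_log e a b x : 0 < e ->
  dquot e a b (a * x) (b * x) =
  2 * quot e a b * (e ^+ 2 / (a ^+ 2 + b ^+ 2 + e ^+ 2)) * x.
Proof.
move=> e0; have s0 := quot_den_gt0 a b e0.
by rewrite /dquot /quot; field; rewrite gt_eqF.
Qed.

Lemma dquot00 e x y : dquot e 0 0 x y = 0.
Proof. by rewrite /dquot !(mul0r, mulr0, addr0, subr0). Qed.

Section smooth_quotients.
Context {n : nat}.
Implicit Types (phi psi : 'rV[R]_n -> R).

Lemma quotE e phi psi : 0 < e -> (fun z => quot e (phi z) (psi z)) =
  (fun z => phi z * (al * phi z + be * psi z) *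
    (phi z * phi z + psi z * psi z + e ^+ 2) `^ (-1)).
Proof.
move=> e0; apply/funext => z; rewrite /quot -!expr2 powR_inv1//.
exact/ltW/quot_den_gt0.
Qed.

Lemma smooth_quot e phi psi : 0 < e -> smooth phi -> smooth psi ->
  smooth (fun z => quot e (phi z) (psi z)).
Proof.
move=> e0 phis psis; rewrite quotE//; apply: smoothM.
  by apply: smoothM => //; apply: smoothD; exact: smoothZ.
apply: smooth_powR.
  by move=> z; rewrite -!expr2; exact: quot_den_gt0.
by apply: smoothD; [apply: smoothD; exact: smoothM|exact: smooth_cst].
Qed.

Lemma partial_quot e phi psi i z : 0 < e -> smooth phi -> smooth psi ->
  partial i (fun z => quot e (phi z) (psi z)) z =
  dquot e (phi z) (psi z) (partial i phi z) (partial i psi z).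
Proof.
move=> e0 phis psis; rewrite quotE//; apply: partialE.
have dphi := smooth_is_derive i z phis; have dpsi := smooth_is_derive i z psis.
have s0 : 0 < phi z * phi z + psi z * psi z + e ^+ 2.
  by rewrite -!expr2; exact: quot_den_gt0.
have dc c : is_derive z (delta_mx ord0 i : 'rV[R]_n) (fun=> c : R) 0.
  exact: is_derive_cst.
have d1 := is_derive_mul dphi (is_derive_add (is_derive_mul (dc al) dphi)
  (is_derive_mul (dc be) dpsi)).
have d2 := is_derive_add (is_derive_add (is_derive_mul dphi dphi)
  (is_derive_mul dpsi dpsi)) (dc (e ^+ 2)).
have d3 := is_derive_comp1 d2 (is_derive1_powR (-1) s0).
have [D1 D2] := is_derive_mul d1 d3.
split; [exact: D1|rewrite D2 /dquot /= -!expr2].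
rewrite powRB; last by apply/implyP => _; rewrite expr2 expr2 gt_eqF.
rewrite -!expr2 in s0.
rewrite powRr1 ?(ltW s0)// powR_inv1 ?(ltW s0)//.
by field; rewrite gt_eqF.
Qed.

End smooth_quotients.

End quotients.

Section integrable_functions.
Context {R : realType} {n : nat}.
Variables (Om : set 'rV[R]_n).
Hypothesis oO : open Om.
Implicit Types (f g : 'rV[R]_n -> R).
Local Notation mu := (leb R n).
Local Notation T := (lebesgue_space R n).
Local Notation leb_integrable f := (mu.-integrable (Om : set T) (EFin \o f)).

Let mO : measurable (Om : set T) := open_lebesgue_measurable oO.

Lemma leb_integrableD f g : leb_integrable f -> leb_integrable g ->
  leb_integrable (fun x => f x + g x).
Proof. by move=> hf hg; exact: eq_integrable (integrableD mO hf hg). Qed.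

Lemma leb_integrableZ (c : R) f : leb_integrable f ->
  leb_integrable (fun x => c * f x).
Proof. by move=> hf; exact: eq_integrable (integrableZl mO c hf). Qed.

Lemma leb_integrable_norm f : leb_integrable f -> leb_integrable (fun x => `|f x|).
Proof. by move=> hf; exact: eq_integrable (integrable_abse hf). Qed.

Lemma leb_integrable_L1loc f : leb_integrable f -> in_L1loc Om f.
Proof.
move=> /integrableP[mf If]; have mrf : lmeasurable Om f by exact/measurable_EFinP.
split => // K cK KO; apply: le_lt_trans If.
have mK : measurable (K : set T).
  by apply: borel_lebesgue_measurable; exact: compact_measurable_rV.
have mnf : measurable_fun (Om : set T) (fun x : T => `|f x|%:E).
  exact/measurable_EFinP/measurableT_comp.
apply: (@ge0_subset_integral _ T R mu K Om mK mO _ mnf _ KO).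
by move=> x _; rewrite lee_fin.
Qed.

End integrable_functions.

Section proportional_functions.
Context {R : realType} {n : nat}.
Variables (Om : set 'rV[R]_n) (p : R) (w : 'rV[R]_n -> R).
Hypotheses (p1 : 1 < p) (oO : open Om) (hw : class_Ap Om p w).
Implicit Types (u v phi psi zeta : 'rV[R]_n -> R).
Local Notation mu := (leb R n).
Local Notation T := (lebesgue_space R n).

Let p0 : 0 < p. Proof. by apply: lt_trans p1. Qed.
Let mO : measurable (Om : set T) := open_lebesgue_measurable oO.
Let conj_weight x : R := w x `^ (- (p - 1)^-1).
Let conj_L1loc : in_L1loc Om conj_weight. Proof. by case: hw. Qed.

Lemma measurable_quot (al be e : R) u v : lmeasurable Om u -> lmeasurable Om v ->
  lmeasurable Om (fun x => quot al be e (u x) (v x)).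
Proof.
move=> mu' mv; have mc c : lmeasurable Om (fun=> c : R) by exact: measurable_cst.
have m1 := lmeasurableD (lmeasurableM (mc al) mu') (lmeasurableM (mc be) mv).
have m2 := lmeasurableD (lmeasurableD (lmeasurableM mu' mu') (lmeasurableM mv mv))
  (mc (e ^+ 2)).
exact: (lmeasurableM (lmeasurableM mu' m1) (measurable_inv m2)).
Qed.

Lemma measurable_dquot (al be e : R) u v f g : lmeasurable Om u ->
  lmeasurable Om v -> lmeasurable Om f -> lmeasurable Om g ->
  lmeasurable Om (fun x => dquot al be e (u x) (v x) (f x) (g x)).
Proof.
move=> mu' mv mf mg; have mc c : lmeasurable Om (fun=> c : R) by exact: measurable_cst.
have m1 := lmeasurableD (lmeasurableM (mc al) mu') (lmeasurableM (mc be) mv).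
have m2 := measurable_inv (lmeasurableD (lmeasurableD (lmeasurableM mu' mu')
  (lmeasurableM mv mv)) (mc (e ^+ 2))).
have m3 := lmeasurableD (lmeasurableM (mc al) mf) (lmeasurableM (mc be) mg).
have m4 := lmeasurableM (lmeasurableD (lmeasurableM mf m1) (lmeasurableM mu' m3)) m2.
have m5 := lmeasurableM (mc 2) (lmeasurableD (lmeasurableM mu' mf) (lmeasurableM mv mg)).
have m6 := lmeasurableM (lmeasurableM (lmeasurableM mu' m1) m5) (lmeasurableM m2 m2).
have := lmeasurableD m4 (lmeasurableM (mc (-1)) m6).
rewrite /lmeasurable; apply: eq_measurable_fun => x _.
by rewrite /dquot mulN1r -!expr2 exprVn.
Qed.

Lemma cvg_quot (al be e : R) (a b : R^nat) (a' b' : R) : 0 < e ->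
  a k @[k --> \oo] --> a' -> b k @[k --> \oo] --> b' ->
  quot al be e (a k) (b k) @[k --> \oo] --> quot al be e a' b'.
Proof.
move=> e0 aa bb.
have cc (c : R) (f : R^nat) (l : R) : f k @[k --> \oo] --> l ->
    c * f k @[k --> \oo] --> c * l by move=> fl; apply: cvgM => //; exact: cvg_cst.
apply: cvgM; first by apply: cvgM => //; apply: cvgD; exact: cc.
apply: cvgV; first by rewrite gt_eqF// quot_den_gt0.
by apply: cvgD; [apply: cvgD; exact: cvgM|exact: cvg_cst].
Qed.

Lemma cvg_dquot (al be e : R) (a b x y : R^nat) (a' b' x' y' : R) : 0 < e ->
  a k @[k --> \oo] --> a' -> b k @[k --> \oo] --> b' ->
  x k @[k --> \oo] --> x' -> y k @[k --> \oo] --> y' ->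
  dquot al be e (a k) (b k) (x k) (y k) @[k --> \oo] --> dquot al be e a' b' x' y'.
Proof.
move=> e0 aa bb xx yy.
have cc (c : R) (f : R^nat) (l : R) : f k @[k --> \oo] --> l ->
    c * f k @[k --> \oo] --> c * l by move=> fl; apply: cvgM => //; exact: cvg_cst.
have cl (f g : R^nat) (l m : R) : f k @[k --> \oo] --> l -> g k @[k --> \oo] --> m ->
    al * f k + be * g k @[k --> \oo] --> al * l + be * m.
  by move=> fl gm; apply: cvgD; exact: cc.
have den : a k ^+ 2 + b k ^+ 2 + e ^+ 2 @[k --> \oo] --> a' ^+ 2 + b' ^+ 2 + e ^+ 2.
  by apply: cvgD; [apply: cvgD; exact: cvgM|exact: cvg_cst].
have s0 := quot_den_gt0 a' b' e0.
apply: cvgB.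
  apply: cvgM; last by apply: cvgV => //; rewrite gt_eqF.
  by apply: cvgD; apply: cvgM => //; exact: cl.
apply: cvgM; last first.
  by apply: cvgV; [rewrite expf_neq0// gt_eqF|exact: cvgM].
apply: cvgM; first by apply: cvgM => //; exact: cl.
by apply: cc; apply: cvgD; exact: cvgM.
Qed.

(** For test functions phi, psi the quotient is smooth and can be integrated
    by parts. By weight_young, the sequences approximating u and v have
    gradients that are dominated on the support of zeta. *)
Lemma quot_weak_derivative (al be e : R) u v zeta i : 0 < e ->
  W1p0 Om p w u -> W1p0 Om p w v -> test_function Om zeta ->
  (\int[mu]_(x in Om) (quot al be e (u x) (v x) * partial i zeta x +
     zeta x * dquot al be e (u x) (v x) (wgrad Om u x ord0 i)
       (wgrad Om v x ord0 i))%:E = 0)%E.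
Proof.
move=> e0 Hu Hv tz; have [zs _ _] := tz.
have [phi [H [tphi iH aeH]]] := W1p0_approx p1 oO hw Hu.
have [psi [G [tpsi iG aeG]]] := W1p0_approx p1 oO hw Hv.
have sphi k : smooth (phi k) by case: (tphi k).
have spsi k : smooth (psi k) by case: (tpsi k).
pose h k x := quot al be e (phi k x) (psi k x) * zeta x.
have th k : test_function Om (h k).
  by apply: test_functionMr => //; exact: smooth_quot.
pose f k x := quot al be e (phi k x) (psi k x) * partial i zeta x +
  zeta x * dquot al be e (phi k x) (psi k x) (grad (phi k) x ord0 i)
    (grad (psi k) x ord0 i).
have If k : (\int[mu]_(x in Om) (f k x)%:E = 0)%E.
  rewrite -(test_integral_partial0 i oO (th k)); apply: eq_integral => x _.
  rewrite (test_partialM i x (smooth_quot al be e0 (sphi k) (spsi k)) zs).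
  by rewrite partial_quot// /f !mxE.
have ms g : smooth g -> lmeasurable Om g.
  by move=> sg; apply: continuous_lmeasurable => //; exact: smooth_continuous.
have mz := ms _ zs; have mdz := ms _ (smooth_partial i zs).
have mu' := W1p0_measurable Hu; have mv := W1p0_measurable Hv.
pose K : R := `|al| + `|be|.
have K0 : 0 <= K by rewrite addr_ge0.
have C0 : 0 <= 4 * K / e by rewrite divr_ge0 ?(ltW e0)// mulr_ge0.
pose D x := K * `|1 * partial i zeta x| + 4 * K / e *
  (`|wgrad Om u x ord0 i * zeta x| + `|wgrad Om v x ord0 i * zeta x| +
   (`|H x * zeta x| + `|G x * zeta x| + 2 * `|conj_weight x * zeta x|)).
have iD : mu.-integrable (Om : set T) (EFin \o D).
  have [_ hgu _] := W1p0_weak_gradient Hu; have [_ hgv _] := W1p0_weak_gradient Hv.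
  have i1 := leb_integrable_norm oO (test_partial_integrableM i oO (in_L1loc_cst 1 oO) tz).
  have iM q : in_L1loc Om q -> mu.-integrable (Om : set T)
      (EFin \o (fun x => `|q x * zeta x|)).
    by move=> hq; exact: (leb_integrable_norm oO (test_integrableM oO hq tz)).
  have i2 := leb_integrableD oO (iM _ (hgu i)) (iM _ (hgv i)).
  have i3 := leb_integrableD oO (iM _ (leb_integrable_L1loc oO iH))
    (iM _ (leb_integrable_L1loc oO iG)).
  have i4 := leb_integrableD oO i3 (leb_integrableZ oO 2 (iM _ conj_L1loc)).
  exact: (leb_integrableD oO (leb_integrableZ oO K i1)
    (leb_integrableZ oO (4 * K / e) (leb_integrableD oO i2 i4))).
have mf k : lmeasurable Om (f k).
  apply: lmeasurableD.
    by apply: (lmeasurableM _ mdz); apply: measurable_quot; exact: ms.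
  apply: (lmeasurableM mz); apply: measurable_dquot; try exact: ms.
  - exact: grad_measurable.
  - exact: grad_measurable.
have mlim : lmeasurable Om (fun x => quot al be e (u x) (v x) * partial i zeta x +
     zeta x * dquot al be e (u x) (v x) (wgrad Om u x ord0 i) (wgrad Om v x ord0 i)).
  apply: lmeasurableD; first exact: (lmeasurableM (measurable_quot al be e mu' mv) mdz).
  apply: (lmeasurableM mz); apply: measurable_dquot => //.
  - exact: wgrad_measurable Hu.
  - exact: wgrad_measurable Hv.
have grad_bound q (chi : 'rV[R]_n -> R) M x : 0 < w x -> pos_weight w x = w x ->
    w x * enorm (wgrad Om q x - grad chi x) `^ p <= M ->
    `|grad chi x ord0 i| <= `|wgrad Om q x ord0 i| + (`|M| + `|conj_weight x|).
  move=> w0 wE hM.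
  have h1 := le_coord_enorm (wgrad Om q x - grad chi x) i.
  have h2 := weight_young p1 w0 (enorm_ge0 (wgrad Om q x - grad chi x)).
  have h3 : `|grad chi x ord0 i| <= `|wgrad Om q x ord0 i| +
      `|(wgrad Om q x - grad chi x) ord0 i|.
    have -> : grad chi x ord0 i = wgrad Om q x ord0 i -
        (wgrad Om q x - grad chi x) ord0 i by rewrite !mxE; ring.
    exact: ler_normB.
  apply: le_trans h3 _; rewrite lerD2l; apply: le_trans h1 _.
  apply: le_trans h2 _; apply: lerD; last exact: ler_norm.
  by apply: le_trans hM _; exact: ler_norm.
have lim := @dominated_limit _ T R mu Om mO f _ D mf mlim iD.
have : (\int[mu]_(x in Om) (f k x)%:E)%E @[k --> \oo] --> (0 : \bar R)%E.
  by under eq_fun do rewrite If; exact: cvg_cst.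
suff h1 : {ae mu, forall x, Om x -> (forall k, `|f k x| <= D x) /\
    f k x @[k --> \oo] --> quot al be e (u x) (v x) * partial i zeta x +
     zeta x * dquot al be e (u x) (v x) (wgrad Om u x ord0 i) (wgrad Om v x ord0 i)}.
  by move=> h2; exact: (cvg_unique _ (lim h1) h2).
have ae3 : {ae mu, forall x, Om x -> 0 < w x /\ pos_weight w x = w x}.
  by apply: leb_ae_mono (pos_weight_ae hw) => x hx /hx[? ?].
have aeHw := leb_ae_mono2 (fun x a b => conj a b) aeH ae3.
apply: leb_ae_mono2 aeHw aeG => x [hx wx] gx Ox.
have [w0 wE] := wx Ox; have [H1 H2 H3] := hx Ox; have [G1 G2 G3] := gx Ox.
split; last first.
  apply: cvgD.
    by apply: cvgM; [exact: cvg_quot|exact: cvg_cst].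
  by apply: cvgM; [exact: cvg_cst|apply: cvg_dquot].
move=> k; rewrite wE in H1 G1.
have b1 := grad_bound u (phi k) _ x w0 wE (H1 k).
have b2 := grad_bound v (psi k) _ x w0 wE (G1 k).
apply: le_trans (ler_normD _ _) _; rewrite /D; apply: lerD.
  by rewrite normrM mul1r ler_wpM2r// quot_bound.
rewrite normrM.
apply: (@le_trans _ _ (`|zeta x| * (4 * K / e *
    (`|grad (phi k) x ord0 i| + `|grad (psi k) x ord0 i|)))).
  by rewrite ler_wpM2l// dquot_bound.
rewrite mulrCA ler_wpM2l//; apply: (@le_trans _ _ (`|zeta x| *
  (`|wgrad Om u x ord0 i| + (`|H x| + `|conj_weight x|) +
   (`|wgrad Om v x ord0 i| + (`|G x| + `|conj_weight x|))))).
  by rewrite ler_wpM2l// lerD.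
by rewrite !normrM le_eqVlt; apply/orP; left; apply/eqP; ring.
Qed.

End proportional_functions.

Section proportional_gradients.
Context {R : realType} {n : nat}.
Variables (Om : set 'rV[R]_n) (p : R) (w : 'rV[R]_n -> R).
Hypotheses (p1 : 1 < p) (oO : open Om) (hw : class_Ap Om p w).
Implicit Types (u v phi psi zeta : 'rV[R]_n -> R).
Local Notation mu := (leb R n).
Local Notation T := (lebesgue_space R n).

Let p0 : 0 < p. Proof. by apply: lt_trans p1. Qed.
Let mO : measurable (Om : set T) := open_lebesgue_measurable oO.
Let conj_weight x : R := w x `^ (- (p - 1)^-1).
Let conj_L1loc : in_L1loc Om conj_weight. Proof. by case: hw. Qed.

Lemma lerB_shrink (e s : R) : 0 <= s -> 0 <= e ^+ 2 / (s + e ^+ 2) <= 1.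
Proof.
move=> s0; have e0 := sqr_ge0 e; rewrite divr_ge0 ?addr_ge0//=.
have [->|sn0] := eqVneq (s + e ^+ 2) 0; first by rewrite invr0 mulr0 ler01.
by rewrite ler_pdivrMr ?mul1r ?lerDr// lt_def sn0 addr_ge0.
Qed.

(** By dquot_log the derivative of the regularized quotient is grad u / u
    times a bounded factor that tends to 0 with e. Multiplied by zeta it is
    dominated, as the logarithm of u has finite energy on the support of zeta.
    *)
Lemma proportional_ratio (al be : R) u v zeta i :
  W1p0 Om p w u -> W1p0 Om p w v -> test_function Om zeta ->
  mu.-integrable (Om : set T) (EFin \o log_energy Om p w u zeta) ->
  ae_in Om (fun x => u x *: wgrad Om v x = v x *: wgrad Om u x) ->
  ae_in Om (fun x => u x = 0 -> v x = 0) ->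
  (\int[mu]_(x in Om) (quot al be 0 (u x) (v x) * partial i zeta x)%:E = 0)%E.
Proof.
move=> Hu Hv tz iL prop zero; have [zs cz zO] := tz.
pose e (k : nat) : R := k.+1%:R^-1.
have e0 k : 0 < e k by rewrite invr_gt0.
have el : e k @[k --> \oo] --> (0 : R) by exact: cvg_invn0.
have el2 : e k ^+ 2 @[k --> \oo] --> (0 : R).
  by rewrite -(mulr0 0); exact: cvgM.
pose f k x := quot al be (e k) (u x) (v x) * partial i zeta x +
  zeta x * dquot al be (e k) (u x) (v x) (wgrad Om u x ord0 i) (wgrad Om v x ord0 i).
have If k : (\int[mu]_(x in Om) (f k x)%:E = 0)%E.
  exact: (quot_weak_derivative p1 oO hw al be i (e0 k) Hu Hv tz).
have ms g : smooth g -> lmeasurable Om g.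
  by move=> sg; apply: continuous_lmeasurable => //; exact: smooth_continuous.
have mz := ms _ zs; have mdz := ms _ (smooth_partial i zs).
have mu' := W1p0_measurable Hu; have mv := W1p0_measurable Hv.
have mf k : lmeasurable Om (f k).
  apply: lmeasurableD; first exact: (lmeasurableM (measurable_quot al be (e k) mu' mv) mdz).
  apply: (lmeasurableM mz); apply: measurable_dquot => //.
  - exact: wgrad_measurable Hu.
  - exact: wgrad_measurable Hv.
have mlim : lmeasurable Om (fun x => quot al be 0 (u x) (v x) * partial i zeta x).
  exact: (lmeasurableM (measurable_quot al be 0 mu' mv) mdz).
pose K : R := `|al| + `|be|.
have K0 : 0 <= K by rewrite addr_ge0.
pose D x := K * `|1 * partial i zeta x| + 2 * K *
  (log_energy Om p w u zeta x + `|conj_weight x * \1_(supp zeta) x|).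
have iD : mu.-integrable (Om : set T) (EFin \o D).
  have i1 := leb_integrable_norm oO (test_partial_integrableM i oO (in_L1loc_cst 1 oO) tz).
  have i2 : mu.-integrable (Om : set T)
      (EFin \o (fun x => conj_weight x * \1_(supp zeta) x)).
    apply: (in_L1loc_integrableM_bounded (C := 1) oO conj_L1loc cz zO).
    - have mK : measurable (supp zeta : set T).
        by apply: borel_lebesgue_measurable; exact: compact_measurable_rV.
      exact: measurable_indic.
    - by move=> x _; rewrite indicE; case: (_ \in _); rewrite ?normr1// normr0.
    - by move=> x Kx; rewrite indicE memNset.
  exact: (leb_integrableD oO (leb_integrableZ oO K i1) (leb_integrableZ oO (2 * K)
    (leb_integrableD oO iL (leb_integrable_norm oO i2)))).
have lim := @dominated_limit _ T R mu Om mO f _ D mf mlim iD.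
have : (\int[mu]_(x in Om) (f k x)%:E)%E @[k --> \oo] --> (0 : \bar R)%E.
  by under eq_fun do rewrite If; exact: cvg_cst.
suff h1 : {ae mu, forall x, Om x -> (forall k, `|f k x| <= D x) /\
    f k x @[k --> \oo] --> quot al be 0 (u x) (v x) * partial i zeta x}.
  by move=> h2; exact: (cvg_unique _ (lim h1) h2).
have aep := leb_ae_mono2 (fun x a b => conj a b) prop zero.
apply: leb_ae_mono2 aep (pos_weight_ae hw) => x [px zx] wx Ox.
have [wE w0] := wx Ox; have {}px := px Ox; have {}zx := zx Ox.
pose r k := e k ^+ 2 / (u x ^+ 2 + v x ^+ 2 + e k ^+ 2).
pose L := log_grad Om u x ord0 i.
have dE k : dquot al be (e k) (u x) (v x) (wgrad Om u x ord0 i) (wgrad Om v x ord0 i) =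
    2 * quot al be (e k) (u x) (v x) * r k * L.
  have [ux|ux] := eqVneq (u x) 0.
    by rewrite /L /log_grad ux (zx ux) dquot00 invr0 scale0r mxE mulr0.
  have hu : wgrad Om u x ord0 i = u x * L.
    by rewrite /L /log_grad mxE mulrA mulfV// mul1r.
  have hv : wgrad Om v x ord0 i = v x * L.
    rewrite /L /log_grad mxE mulrCA.
    have /matrixP/(_ ord0 i) := px; rewrite !mxE => <-.
    by rewrite mulrA mulVf// mul1r.
  by rewrite hu hv dquot_log.
have S0 : 0 <= u x ^+ 2 + v x ^+ 2 by rewrite addr_ge0 ?sqr_ge0.
have r01 k : 0 <= r k <= 1 by exact: lerB_shrink.
have zL : `|zeta x * L| <= log_energy Om p w u zeta x + `|conj_weight x * \1_(supp zeta) x|.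
  have [zx0|zx0] := eqVneq (zeta x) 0.
    by rewrite zx0 mul0r normr0 addr_ge0 ?log_energy_ge0.
  have sx : supp zeta x by exact: subset_closure.
  rewrite indicE mem_set// mulr1 normrM.
  apply: (@le_trans _ _ (`|zeta x| * enorm (log_grad Om u x))).
    by rewrite ler_wpM2l// le_coord_enorm.
  apply: le_trans (weight_young p1 w0 (mulr_ge0 (normr_ge0 _) (enorm_ge0 _))) _.
  rewrite powRM ?enorm_ge0// /log_energy wE.
  by apply: lerD => //; exact: ler_norm.
split.
  move=> k; rewrite /f dE.
  apply: le_trans (ler_normD _ _) _; rewrite /D; apply: lerD.
    by rewrite normrM mul1r ler_wpM2r// quot_bound.
  have -> : zeta x * (2 * quot al be (e k) (u x) (v x) * r k * L) =
      2 * (quot al be (e k) (u x) (v x) * r k) * (zeta x * L) by ring.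
  rewrite normrM; apply: ler_pM => //.
  rewrite normrM (ger0_norm (_ : 0 <= 2)) ?ler0n// ler_wpM2l//.
  rewrite normrM -[leRHS]mulr1; apply: ler_pM => //; first exact: quot_bound.
  by have /andP[r0 r1] := r01 k; rewrite ger0_norm.
rewrite /f; under eq_fun do rewrite dE.
have [ux|ux] := eqVneq (u x) 0.
  have q0 e' : quot al be e' (u x) (v x) = 0 by rewrite /quot ux !mul0r.
  under eq_fun do rewrite q0 mulr0 !mul0r mulr0 addr0.
  by rewrite q0 mul0r; exact: cvg_cst.
have Sp : u x ^+ 2 + v x ^+ 2 != 0.
  by rewrite gt_eqF// ltr_pwDl ?sqr_ge0// lt_def sqr_ge0 sqrf_eq0 ux.
have den : u x ^+ 2 + v x ^+ 2 + e k ^+ 2 @[k --> \oo] --> u x ^+ 2 + v x ^+ 2 + 0 ^+ 2.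
  by apply: cvgD; [exact: cvg_cst|rewrite expr0n].
have idn : (u x ^+ 2 + v x ^+ 2 + e k ^+ 2)^-1 @[k --> \oo] -->
    (u x ^+ 2 + v x ^+ 2 + 0 ^+ 2)^-1.
  by apply: cvgV => //; rewrite expr0n addr0.
have qc : quot al be (e k) (u x) (v x) @[k --> \oo] --> quot al be 0 (u x) (v x).
  by apply: cvgM; [exact: cvg_cst|exact: idn].
have rc : r k @[k --> \oo] --> (0 : R).
  by rewrite -[X in _ --> X](mul0r (u x ^+ 2 + v x ^+ 2 + 0 ^+ 2)^-1); exact: cvgM.
have c1 : quot al be (e k) (u x) (v x) * partial i zeta x @[k --> \oo] -->
    quot al be 0 (u x) (v x) * partial i zeta x by apply: cvgM => //; exact: cvg_cst.
have c2 : zeta x * (2 * quot al be (e k) (u x) (v x) * r k * L) @[k --> \oo] -->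
    zeta x * (2 * quot al be 0 (u x) (v x) * 0 * L).
  apply: cvgM; first exact: cvg_cst.
  apply: cvgM; last exact: cvg_cst.
  by apply: cvgM => //; apply: cvgM => //; exact: cvg_cst.
have := cvgD c1 c2; rewrite mulr0 mul0r mulr0 addr0; exact.
Qed.

End proportional_gradients.

(** * Uniqueness of minimizers *)

Section uniqueness.
Context {R : realType} {n : nat}.
Variables (Om : set 'rV[R]_n) (p : R) (w b : 'rV[R]_n -> R).
Hypotheses (p1 : 1 < p) (oO : open Om) (cO : connected Om) (nO : Om !=set0)
  (hw : class_Ap Om p w).
Hypotheses (b0 : forall x, 0 <= b x) (mb : lmeasurable Om b).
Local Notation mu := (leb R n).
Local Notation T := (lebesgue_space R n).
Hypothesis min_test : forall phi, test_function Om phi ->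
  (\int[mu]_(x in Om) (b x * `|phi x| `^ p)%:E <=
   \int[mu]_(x in Om) (energy_density p w (grad phi) x)%:E)%E.
Implicit Types (u v : 'rV[R]_n -> R).

Let p0 : 0 < p. Proof. by apply: lt_trans p1. Qed.
Let mO : measurable (Om : set T) := open_lebesgue_measurable oO.

(** Equality in the inequality that holds for all test functions. *)
Definition minimizer u : Prop := W1p0 Om p w u /\
  energy Om p w u = (\int[mu]_(x in Om) (b x * `|u x| `^ p)%:E)%E.

Lemma ratio_constant (al be : R) u v : minimizer u -> W1p0 Om p w v ->
  ae_in Om (fun x => u x *: wgrad Om v x = v x *: wgrad Om u x) ->
  ae_in Om (fun x => u x = 0 -> v x = 0) ->
  exists c, ae_in Om (fun x => quot al be 0 (u x) (v x) = c).
Proof.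
move=> [Hu Eu] Hv prop zero; apply: (weakly_constant oO cO nO).
  apply: (in_L1loc_bounded (C := `|al| + `|be|) _ oO).
    by apply: measurable_quot; [exact: W1p0_measurable Hu|exact: W1p0_measurable Hv].
  by move=> x _; exact: quot_bound.
move=> zeta j tz; have iL := log_caccioppoli p1 oO hw b0 mb min_test Hu Eu tz.
exact: (proportional_ratio p1 oO hw al be j Hu Hv tz iL prop zero).
Qed.

(** For v = u the preceding lemma says that the indicator function of the set
    where u does not vanish is constant. *)
Lemma minimizer_neq0 u : minimizer u -> ~ ae_in Om (fun x => u x = 0) ->
  ae_in Om (fun x => u x != 0).
Proof.
move=> mu' nz; have [Hu _] := mu'.
have [c Hc] : exists c, ae_in Om (fun x => quot 1 0 0 (u x) (u x) = c).
  by apply: ratio_constant => //; apply: aeW => x _.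
have q1 x : u x != 0 -> quot 1 0 0 (u x) (u x) = 2^-1.
  by move=> ux; rewrite /quot; field; rewrite -mulr2n mulrn_eq0/= sqrf_eq0.
have q0 x : u x = 0 -> quot 1 0 0 (u x) (u x) = 0.
  by move=> ->; rewrite /quot !mul0r.
have [cz|cn] := eqVneq c 0.
  exfalso; apply: nz; apply: leb_ae_mono Hc => x hx Ox.
  apply: contrapT => /eqP ux; have := hx Ox.
  by rewrite q1// cz => /eqP; rewrite invr_eq0 pnatr_eq0.
apply: leb_ae_mono Hc => x hx Ox; apply/eqP => ux.
by move: cn; rewrite -(hx Ox) q0// eqxx.
Qed.

(** Both energies cancel in the bound for the deficit, which therefore
    vanishes. *)
Lemma minimizers_log_grad u v : minimizer u -> minimizer v ->
  ae_in Om (fun x => u x != 0 -> v x != 0 -> log_grad Om u x = log_grad Om v x).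
Proof.
move=> [Hu Eu] [Hv Ev].
have D0 := deficit_density_ge0 Om w p1 u v.
have mD := deficit_density_measurable hw Hu Hv.
have I0 : (\int[mu]_(x in Om) (deficit_density Om p w u v x)%:E = 0)%E.
  have := minimizer_deficit p1 oO hw b0 mb min_test Hu Hv Eu.
  rewrite -Ev -[X in (_ <= X)%E]add0e leeD2rE; last exact: W1p0_energy_fin Hv.
  move=> h; apply/eqP; rewrite eq_le h/=; apply: integral_ge0 => x _.
  by rewrite lee_fin.
have meD : measurable_fun (Om : set T) (fun x : T => (deficit_density Om p w u v x)%:E).
  exact/measurable_EFinP.
have aeD : {ae mu, forall x, Om x -> deficit_density Om p w u v x = 0}.
  have [+ _] := @ae_eq_integral_abs _ T R mu Om mO _ meD.
  have -> : (\int[mu]_(x in Om) `|(deficit_density Om p w u v x)%:E| = 0)%E.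
    rewrite -[RHS]I0; apply: eq_integral => x _ /=; by rewrite ger0_norm.
  move=> /(_ erefl); apply: leb_ae_mono => x hx Ox.
  by have := hx Ox; case.
apply: leb_ae_mono2 aeD (pos_weight_ae hw) => x dx wx Ox ux vx.
have [wE w0] := wx Ox; have := dx Ox.
rewrite /deficit_density ux vx (mul1r 1) mul1r wE => /eqP.
rewrite mulf_eq0 (gt_eqF w0) => /eqP.
by apply: (deficit_eq0 p1); apply: powR_gt0; rewrite normr_gt0.
Qed.

(** The functions u^2 / (u^2 + v^2) and u v / (u^2 + v^2) are constant, and v
    / u is the quotient of the second by the first. *)
Lemma minimizers_proportional u v : minimizer u -> minimizer v ->
  ~ ae_in Om (fun x => u x = 0) -> ~ ae_in Om (fun x => v x = 0) ->
  exists c, ae_in Om (fun x => v x = c * u x).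
Proof.
move=> mu' mv un vn; have [Hv _] := mv.
have uv := leb_ae_mono2 (fun x a b => conj a b) (minimizer_neq0 mu' un)
  (minimizer_neq0 mv vn).
have prop : ae_in Om (fun x => u x *: wgrad Om v x = v x *: wgrad Om u x).
  apply: leb_ae_mono2 uv (minimizers_log_grad mu' mv) => x [ux vx] lg Ox.
  have {}ux := ux Ox; have {}vx := vx Ox; have E := lg Ox ux vx.
  have -> : wgrad Om v x = v x *: log_grad Om v x.
    by rewrite /log_grad scalerA mulfV// scale1r.
  by rewrite -E /log_grad !scalerA; congr (_ *: _); field.
have zero : ae_in Om (fun x => u x = 0 -> v x = 0).
  apply: leb_ae_mono uv => x [ux _] Ox u0; exfalso.
  by move: (ux Ox); rewrite u0 eqxx.
have [c1 H1] := ratio_constant 1 0 mu' Hv prop zero.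
have [c2 H2] := ratio_constant 0 1 mu' Hv prop zero.
exists (c2 / c1).
have H12 := leb_ae_mono2 (fun x a b => conj a b) H1 H2.
apply: leb_ae_mono2 uv H12 => x [ux vx] [h1 h2] Ox.
rewrite -(h1 Ox) -(h2 Ox) /quot; have {}ux := ux Ox.
have s0 : u x ^+ 2 + v x ^+ 2 != 0.
  by rewrite gt_eqF// ltr_pwDl ?sqr_ge0// lt_def sqr_ge0 sqrf_eq0 ux.
by rewrite expr0n addr0 !mul0r !mul1r add0r addr0; field; rewrite ux s0.
Qed.

End uniqueness.

(** * The first eigenvalue *)

Section integrable_weights.
Context {R : realType} {n : nat}.
Variables (Om : set 'rV[R]_n).
Hypotheses (oO : open Om) (bO : bounded_set Om).
Implicit Types (f : 'rV[R]_n -> R).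
Local Notation mu := (leb R n).
Local Notation T := (lebesgue_space R n).

Let mO : measurable (Om : set T) := open_lebesgue_measurable oO.
Let muO : (mu Om < +oo)%E. Proof. exact: leb_bounded_lty. Qed.

Lemma in_Linfty_integrable f : Om !=set0 -> in_Lp Om +oo%E f ->
  mu.-integrable (Om : set T) (EFin \o f).
Proof.
move=> [x0 Ox0] [mf]; rewrite /finite_norm unlock.
have -> : (0 < mu setT)%E.
  have [a [b [abx abO _]]] := nbhs_box oO Ox0.
  apply: (lt_le_trans (leb_open_box_gt0 abx)); apply: le_measure; rewrite ?inE//.
  by apply: borel_lebesgue_measurable; exact: measurable_open_box.
set M := ess_sup _ _ => Moo.
have aeM : {ae mu, forall x : T, (`|((f \_ Om) x)%:E| <= M)%E} by exact: ess_sup_ge.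
have fM : ae_in Om (fun x => `|f x| <= fine M).
  apply: leb_ae_mono aeM => x + Ox; rewrite /= patchE mem_set//.
  by case: M Moo => //= r _; rewrite lee_fin.
apply/integrableP; split; first exact/measurable_EFinP.
apply: (@le_lt_trans _ _ (\int[mu]_(x in Om) (`|fine M|%:E))%E); last first.
  by rewrite integral_cst// lte_mul_pinfty// lee_fin.
apply: (leb_integral_le_ae mO (f := fun x => `|f x|) (g := fun=> `|fine M|)).
- exact: measurableT_comp.
- exact: measurable_cst.
- by move=> x.
- by move=> x.
- by apply: leb_ae_mono fM => x h Ox; exact: le_trans (h Ox) (ler_norm _).
Qed.

Lemma in_Lp_integrable f (r : R) : 1 <= r -> in_Lp Om r%:E f ->
  mu.-integrable (Om : set T) (EFin \o f).
Proof.
move=> r1 [mf fr]; have r0 : 0 < r by exact: lt_le_trans r1.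
have mfr := measurable_abs_pow r mf.
have Ir : (\int[mu]_(x in Om) (`|f x| `^ r)%:E < +oo)%E.
  have : ('N[mu]_r%:E[EFin \o (f \_ Om : T -> R)] `^ r < +oo)%E.
    by apply: poweR_lty.
  rewrite (poweR_Lnorm mu _ (lt0r_neq0 r0)); apply: le_lt_trans.
  rewrite [X in (X <= _)%E]integral_mkcond le_eqVlt; apply/orP; left; apply/eqP.
  apply: eq_integral => x _; rewrite /= !patchE; case: ifPn => // _.
  by rewrite /= normr0 powR0// gt_eqF.
apply/integrableP; split; first exact/measurable_EFinP.
apply: (@le_lt_trans _ _ (\int[mu]_(x in Om) (1 + `|f x| `^ r)%:E)%E).
  apply: (leb_integral_le mO (f := fun x => `|f x|)).
  - exact: measurableT_comp.
  - by apply: (lmeasurableD _ mfr); exact: measurable_cst.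
  - by move=> x.
  - move=> x; have [h|h] := leP `|f x| 1.
      by rewrite (le_trans h)// lerDl powR_ge0.
    rewrite -[leLHS]powRr1//; apply: (@le_trans _ _ (`|f x| `^ r)).
      by apply: ler_powR => //; exact: ltW.
    by rewrite lerDr.
rewrite (leb_integralD mO (f := fun=> 1) _ mfr) ?ler01//; last exact: measurable_cst.
by apply: lte_add_pinfty => //; rewrite integral_cst// mul1e.
Qed.

End integrable_weights.

Section rayleigh_quotient.
Context {R : realType} {n : nat}.
Variables (Om : set 'rV[R]_n) (p : R) (w beta : 'rV[R]_n -> R).
Hypotheses (p1 : 1 < p) (oO : open Om) (hw : class_Ap Om p w).
Hypotheses (beta_ge0 : ae_in Om (fun x => 0 <= beta x)) (hbeta : in_L1loc Om beta).
Implicit Types (u v phi : 'rV[R]_n -> R).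
Local Notation mu := (leb R n).
Local Notation T := (lebesgue_space R n).
Local Notation lambda := (first_eigenvalue Om p w beta).

Let p0 : 0 < p. Proof. by apply: lt_trans p1. Qed.
Let mO : measurable (Om : set T) := open_lebesgue_measurable oO.

Let admissible : set R := [set r | exists v, [/\ W1p0 Om p w v,
    (\int[mu]_(x in Om) (beta x * `|v x| `^ p)%:E = 1%:E)%E &
    energy Om p w v = r%:E]].

Let admissible_ge0 : lbound admissible 0.
Proof.
move=> r [v [[[Hv _] _] _ Ev]]; have := energy_ge0 oO hw Hv.
by rewrite Ev lee_fin.
Qed.

Lemma first_eigenvalue_ge0 : 0 <= lambda.
Proof.
change (0 <= inf admissible).
have [->|/set0P ne] := eqVneq admissible set0; first by rewrite inf0.
exact: lb_le_inf.
Qed.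

Let beta_pos := pos_weight beta.

Let beta_pos_ge0 x : 0 <= beta_pos x. Proof. exact: pos_weight_ge0. Qed.

Let beta_pos_ae : ae_in Om (fun x => beta_pos x = beta x).
Proof. by apply: leb_ae_mono beta_ge0 => x h Ox; apply/max_idPl; exact: h. Qed.

Let beta_pos_measurable : lmeasurable Om beta_pos.
Proof.
case: hbeta => mb _.
have m0 : measurable_fun (Om : set T) (fun=> 0 : R) by exact: measurable_cst.
exact: (measurable_maxr mb m0).
Qed.

Let beta_integralE u : lmeasurable Om u ->
  (\int[mu]_(x in Om) (beta x * `|u x| `^ p)%:E =
   \int[mu]_(x in Om) (beta_pos x * `|u x| `^ p)%:E)%E.
Proof.
case: hbeta => mb _ mu'; have mup := measurable_abs_pow p mu'.
apply: (@ae_eq_integral _ T R mu Om (fun x : T => (beta_pos x * `|u x| `^ p)%:E)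
  (fun x : T => (beta x * `|u x| `^ p)%:E) mO).
- by apply/measurable_EFinP; exact: (lmeasurableM mb mup).
- by apply/measurable_EFinP; exact: (lmeasurableM beta_pos_measurable mup).
- by apply: leb_ae_mono beta_pos_ae => x h Ox; rewrite (h Ox).
Qed.

Let test_beta_fin phi : test_function Om phi ->
  (\int[mu]_(x in Om) (beta x * `|phi x| `^ p)%:E)%E \is a fin_num.
Proof.
move=> [ps cp pO].
have [C HC] := continuous_compact_bound (smooth_continuous ps) cp.
apply: (integrable_fin_num mO).
apply: (in_L1loc_integrableM_bounded (C := Num.max C 0 `^ p) oO hbeta cp pO).
- apply: measurable_abs_pow; apply: continuous_lmeasurable => //.
  exact: smooth_continuous.
- move=> x Kx; rewrite ger0_norm ?powR_ge0//.
  apply: ge0_ler_powR; rewrite ?nnegrE ?(ltW p0) ?le_max ?lexx ?orbT//.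
  by rewrite (le_trans _ (HC _ Kx))// normr_id.
- by move=> x /suppN ->; rewrite normr0 powR0// gt_eqF.
Qed.

Lemma first_eigenvalue_le phi : test_function Om phi ->
  (\int[mu]_(x in Om) (lambda * pos_weight beta x * `|phi x| `^ p)%:E <=
   \int[mu]_(x in Om) (energy_density p w (grad phi) x)%:E)%E.
Proof.
move=> tp; have [ps _ _] := tp.
have mphi : lmeasurable Om phi.
  by apply: continuous_lmeasurable => //; exact: smooth_continuous.
have l0 := first_eigenvalue_ge0.
have mB := lmeasurableM beta_pos_measurable (measurable_abs_pow p mphi).
have B0 x : 0 <= beta_pos x * `|phi x| `^ p by rewrite mulr_ge0 ?powR_ge0.
have -> : (\int[mu]_(x in Om) (lambda * pos_weight beta x * `|phi x| `^ p)%:E =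
    lambda%:E * \int[mu]_(x in Om) (beta_pos x * `|phi x| `^ p)%:E)%E.
  rewrite -(leb_integralZ mO mB l0 B0); apply: eq_integral => x _.
  by rewrite mulrA.
have := test_beta_fin tp; rewrite (beta_integralE mphi).
have : (0 <= \int[mu]_(x in Om) (beta_pos x * `|phi x| `^ p)%:E)%E.
  by apply: integral_ge0 => x _; rewrite lee_fin.
have ed0 x : 0 <= energy_density p w (grad phi) x by exact: energy_density_ge0.
have med : lmeasurable Om (energy_density p w (grad phi)).
  by apply: (energy_density_measurable hw) => i; exact: grad_measurable.
have Ef : (\int[mu]_(x in Om) (energy_density p w (grad phi) x)%:E)%E \is a fin_num.
  exact: (integrable_fin_num mO (test_energy_integrable p1 oO hw tp)).
have E0 : (0 <= \int[mu]_(x in Om) (energy_density p w (grad phi) x)%:E)%E.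
  by apply: integral_ge0 => x _; rewrite lee_fin.
have EE := fineK Ef.
case BE : (\int[mu]_(x in Om) (beta_pos x * `|phi x| `^ p)%:E)%E => [c| |]// c0 _.
rewrite lee_fin in c0.
have [->|cn0] := eqVneq c 0; first by rewrite mule0.
have cp : 0 < c by rewrite lt_def cn0.
(* Both sides are homogeneous of degree p in phi: normalize the weighted p-th power. *)
pose t := c `^ (- p^-1).
have t0 : 0 < t by rewrite powR_gt0.
have tp1 : t `^ p = c^-1.
  by rewrite /t -powRrM mulNr mulVf ?gt_eqF// powR_inv1// ltW.
pose v x := t * phi x.
have tv : test_function Om v by exact: test_functionZ.
have mv : lmeasurable Om v.
  by apply: continuous_lmeasurable => //; apply: smooth_continuous; case: tv.
have Bv : (\int[mu]_(x in Om) (beta x * `|v x| `^ p)%:E = 1%:E)%E.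
  have -> : (1%:E = (t `^ p)%:E * c%:E :> \bar R)%E by rewrite tp1 -EFinM mulVf.
  rewrite (beta_integralE mv) -BE -(leb_integralZ mO mB (powR_ge0 _ _) B0).
  apply: eq_integral => x _; congr (_%:E).
  by rewrite /v normrM (gtr0_norm t0) powRM ?(ltW t0)// mulrCA.
have Ev : energy Om p w v = (t `^ p *
    fine (\int[mu]_(x in Om) (energy_density p w (grad phi) x)%:E)%E)%:E.
  rewrite EFinM EE (test_energyE oO hw tv) -(leb_integralZ mO med (powR_ge0 _ _) ed0).
  apply: eq_integral => x _; congr (_%:E).
  rewrite /energy_density (gradZ t x ps) enormZ (gtr0_norm t0).
  by rewrite powRM ?enorm_ge0 ?(ltW t0)// mulrCA.
have : lambda <= t `^ p *
    fine (\int[mu]_(x in Om) (energy_density p w (grad phi) x)%:E)%E.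
  apply: ge_inf; first by exists 0; exact: admissible_ge0.
  by exists v; split => //; exact: (test_W1p0 p1 oO hw).
by rewrite tp1 -{2}EE -EFinM lee_fin mulrC ler_pdivlMr.
Qed.

(** The equation is tested with the eigenfunction itself. *)
Lemma eigenfunction_minimizer u : is_eigenfunction Om p w beta lambda u ->
  minimizer Om p w (fun x => lambda * pos_weight beta x) u.
Proof.
move=> [Hu _ /(_ u Hu) E]; split; first exact: Hu.
have powE (a : R) : 0 <= a -> a `^ (p - 2) * a ^+ 2 = a `^ p.
  move=> a0; have [->|an0] := eqVneq a 0.
    by rewrite expr0n/= mulr0 powR0// gt_eqF.
  by rewrite -powR_mulrn// -powRD ?an0 ?implybT//; congr (_ `^ _); ring.
have mu' := W1p0_measurable Hu.
have mB := lmeasurableM beta_pos_measurable (measurable_abs_pow p mu').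
have B0 x : 0 <= beta_pos x * `|u x| `^ p by rewrite mulr_ge0 ?powR_ge0.
have -> : energy Om p w u = (\int[mu]_(x in Om) (w x * enorm (wgrad Om u x) `^ (p - 2)
    * dotp (wgrad Om u x) (wgrad Om u x))%:E)%E.
  apply: eq_integral => x _; congr (_%:E).
  by rewrite -sqr_enorm -mulrA powE// enorm_ge0.
rewrite E; have -> : (\int[mu]_(x in Om) (beta x * `|u x| `^ (p - 2) * u x * u x)%:E =
    \int[mu]_(x in Om) (beta x * `|u x| `^ p)%:E)%E.
  apply: eq_integral => x _; congr (_%:E).
  by rewrite -!mulrA -expr2 -real_normK ?num_real// powE.
rewrite (beta_integralE mu') -(leb_integralZ mO mB first_eigenvalue_ge0 B0).
by apply: eq_integral => x _; rewrite mulrA.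
Qed.

End rayleigh_quotient.

Theorem theorem3p4 (R : realType) (N : nat) (hN : (1 <= N)%N)
    (p : R) (hp : 1 < p)
    (Om : set 'rV[R]_N) (hOm : bounded_smooth_domain Om)
    (w : 'rV[R]_N -> R) (hw : class_At Om p w)
    (s : R) (hs : At_exponent Om p w s)
    (beta : 'rV[R]_N -> R)
    (hbeta_ge0 : ae_in Om (fun x => 0 <= beta x))
    (hbeta_gt0 : (0 < leb R N (Om `&` [set x | (0 < beta x)%R]))%E)
    (hbeta : in_Lp Om +oo%E beta \/
       (1 <= p_sub p s < N%:R /\
        exists q : R, p < q < critical_exponent N (p_sub p s) /\
          in_Lp Om (q / (q - p))%:E beta))
    (u v : 'rV[R]_N -> R)
    (hu : is_eigenfunction Om p w beta (first_eigenvalue Om p w beta) u)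
    (hv : is_eigenfunction Om p w beta (first_eigenvalue Om p w beta) v) :
  exists c : R, ae_in Om (fun x => v x = c * u x).
Proof.
have [nO oO cO bO _] := hOm; have [hAp _] := hw.
have Lbeta : in_L1loc Om beta.
  apply: (leb_integrable_L1loc oO); case: hbeta => [|[_ [q [/andP[pq _]]]]].
    exact: in_Linfty_integrable.
  apply: in_Lp_integrable => //.
  have P := hp; rewrite ler_pdivlMr ?mul1r ?subr_gt0//; lra.
have l0 : 0 <= first_eigenvalue Om p w beta by exact: first_eigenvalue_ge0.
have [_ un _] := hu; have [_ vn _] := hv.
have mb : lmeasurable Om (fun x => first_eigenvalue Om p w beta * pos_weight beta x).
  have mc c : lmeasurable Om (fun=> c : R) by exact: measurable_cst.
  have [m _] := Lbeta.
  exact: (lmeasurableM (mc _) (measurable_maxr m (mc 0))).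
apply: (minimizers_proportional hp oO cO nO hAp _ mb _
  (eigenfunction_minimizer hp oO hAp hbeta_ge0 Lbeta hu)
  (eigenfunction_minimizer hp oO hAp hbeta_ge0 Lbeta hv) un vn).
- by move=> x; rewrite mulr_ge0 ?pos_weight_ge0.
- by move=> phi; exact: first_eigenvalue_le.
Qed.
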